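(* Let $P,Q$ be von Neumann algebras with faithful normal states $\varphi_P,\varphi_Q$, let $G$ be a countable discrete group with group von Neumann algebra $L(G)$, canonical trace $\tau_G$ and left regular representation $\lambda_g$ ($g\in G$). Let $(M,\varphi)=(P\otimes L(G),\varphi_P\otimes\tau_G)*(Q,\varphi_Q)$, let $\mathbb K_G=(L(G),\delta_G,\kappa_G,\tau_G)$ be the compact co-commutative Kac algebra of $G$, and let $\Gamma^G=(\mathrm{Id}_P\otimes\delta_G)*(\mathrm{Id}_Q\otimes1_{L(G)})$ be the free product (co-)action of $\mathbb K_G$ on $M$. Regard $P$, $Q$, $L(G)$ as subalgebras of $M$, put $$N=\Bigl(P\cup\bigcup_{g\in G}\lambda_gQ\lambda_g^*\Bigr)''\subseteq M,$$ and let $\alpha$ be the action of $G$ on $N$ given by $\alpha_g=\mathrm{Ad}\,\lambda_g|_N$. Then: (1) $(M,\Gamma^G)\cong(N\rtimes_\alpha G,\widehat\alpha)$, where $\widehat\alpha$ is the dual action of $\alpha$ (that is, $\widehat\alpha=\widehat{\mathrm{Id}_P*\gamma^G}$ under the identification of $\alpha$ with $\mathrm{Id}_P*\gamma^G$); (2) $N=M^{\Gamma^G}$; (3) $M\rtimes_{\Gamma^G}\mathbb K_G\cong N\otimes B(\ell^2(G))$.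
   Context: Tensor products are von Neumann algebra tensor products and $*$ is the von Neumann algebra free product with respect to the indicated faithful normal states. The coproduct $\delta_G:L(G)\to L(G)\otimes L(G)$ is the normal $*$-homomorphism with $\delta_G(\lambda_g)=\lambda_g\otimes\lambda_g$, and the antipode is $\kappa_G(\lambda_g)=\lambda_{g^{-1}}$. The (co-)action $\Gamma^G:M\to M\otimes L(G)$ is the normal unital $*$-homomorphism determined by $\Gamma^G(x)=x\otimes1$ for $x\in P$ and for $x\in Q$, and $\Gamma^G(\lambda_g)=\lambda_g\otimes\lambda_g$ for $g\in G$. Its fixed-point algebra is $M^{\Gamma^G}=\{x\in M:\Gamma^G(x)=x\otimes1\}$, and the crossed-product is $M\rtimes_{\Gamma^G}\mathbb K_G=(\Gamma^G(M)\cup(\mathbf C1\otimes\ell^\infty(G)))''\subseteq M\otimes B(\ell^2(G))$, where $\ell^\infty(G)$ acts on $\ell^2(G)$ by multiplication. The dual action $\widehat\alpha:N\rtimes_\alpha G\to(N\rtimes_\alpha G)\otimes L(G)$ is determined by $\widehat\alpha(y)=y\otimes1$ for $y\in N$ and $\widehat\alpha(\lambda_g)=\lambda_g\otimes\lambda_g$, where $\lambda_g$ also denotes the implementing unitaries of $N\rtimes_\alpha G$. An isomorphism $(M,\Gamma^G)\cong(N\rtimes_\alpha G,\widehat\alpha)$ is a von Neumann algebra isomorphism intertwining the two (co-)actions. $\gamma^G$ denotes the $G$-free shift action on $*_{g\in G}(Q,\varphi_Q)_g$ (free product of copies of $(Q,\varphi_Q)$ indexed by $G$), where $\gamma^G_g$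 sends the $h$-th copy identically onto the $gh$-th copy. One identifies $(N,\varphi|_N)$ with $(P,\varphi_P)*\bigl( *_{g\in G}(Q,\varphi_Q)_g\bigr)$, with $\lambda_gQ\lambda_g^*$ corresponding to the $g$-th copy; under this identification $\alpha$ is the free product action $\mathrm{Id}_P*\gamma^G$. *)

(* Defs.v *)
From HB Require Import structures.
From mathcomp Require Import all_boot all_order all_algebra.
From mathcomp Require Import complex.
From mathcomp Require Import all_classical all_reals all_analysis.
Set Implicit Arguments.
Unset Strict Implicit.
Unset Printing Implicit Defensive.
Import Order.TTheory GRing.Theory Num.Theory.
Import numFieldNormedType.Exports.
Local Open Scope classical_set_scope.
Local Open Scope complex_scope.
Local Open Scope ring_scope.

(* Complex Hilbert spaces, over the scalars R[i] for an arbitrary model R of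
   the reals; the inner product is linear in its first argument. *)
HB.mixin Record isHilbert (R : realType) V of CompleteNormedModule R[i] V := {
  dotp : {dot V for (@Num.conj R[i])} ;
  dotp_norm : forall x : V, dotp x x = `|x| ^+ 2 }.

#[short(type="hilbertType")]
HB.structure Definition Hilbert (R : realType) :=
  {V of isHilbert R V & CompleteNormedModule R[i] V}.

(* Operators on H are plain functions H -> H, with composition as product, and
   sets of operators are [set (H -> H)]; boundedness is imposed separately. *)
Section Operators.
Context {R : realType}.
Implicit Types H K : hilbertType R.

Definition bounded_op H : set (H -> H) :=
  [set x | linear x /\ exists k : R[i], forall v, `|x v| <= k * `|v|].

(* The bounded operator determined by the property S; it is only used when S
   determines exactly one bounded operator. *)
Definition the_op H (S : set (H -> H)) : H -> H := xget 0 (@bounded_op H `&` S).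

Definition adj H (x : H -> H) : H -> H :=
  the_op [set y | forall v w, dotp (x v) w = dotp v (y w)].

Definition commutant H (S : set (H -> H)) : set (H -> H) :=
  [set x | bounded_op x /\ forall y, S y -> x \o y = y \o x].

Definition bicommutant H (S : set (H -> H)) := commutant (commutant S).

Definition von_neumann_algebra H (A : set (H -> H)) :=
  [/\ A `<=` @bounded_op H, (forall x, A x -> A (adj x)) & bicommutant A = A].

Definition square_summable H (u : nat -> H) :=
  exists c : R[i], forall n, \sum_(k < n) `|u k| ^+ 2 <= c.

(* The functionals inducing the ultraweak (sigma-weak) topology of B(H):
   x |-> \sum_n <x u_n, v_n> with (u_n), (v_n) square summable. The scalars
   carry their usual topology under the alias R[i]^o. *)
Definition ultraweak_functional H (w : (H -> H) -> R[i]^o) :=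
  exists u v : nat -> H, [/\ square_summable u, square_summable v &
    forall x, bounded_op x ->
      series (fun n => dotp (x (u n)) (v n) : R[i]^o) @ \oo --> w x].

Definition ultraweak_cvg H (F : set_system (H -> H)) (x : H -> H) :=
  forall w, ultraweak_functional w -> w @ F --> w x.

(* Normality is ultraweak continuity. *)
Definition normal_map H K (A : set (H -> H)) (f : (H -> H) -> (K -> K)) :=
  forall F x, ProperFilter F -> F A -> A x ->
    ultraweak_cvg F x -> ultraweak_cvg (f @ F) (f x).

Definition normal_functional H (A : set (H -> H)) (phi : (H -> H) -> R[i]^o) :=
  forall F x, ProperFilter F -> F A -> A x ->
    ultraweak_cvg F x -> phi @ F --> phi x.

Definition normal_state H (A : set (H -> H)) (phi : (H -> H) -> R[i]) :=
  [/\ forall (a : R[i]) x y, A x -> A y -> phi (a *: x + y) = a * phi x + phi y,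
      phi idfun = 1,
      forall x, A x -> 0 <= phi (adj x \o x) &
      normal_functional A phi].

Definition faithful_normal_state H (A : set (H -> H)) (phi : (H -> H) -> R[i]) :=
  normal_state A phi /\ forall x, A x -> phi (adj x \o x) = 0 -> x = 0.

(* Unital *-homomorphisms from A to B; the values of f outside of A are
   irrelevant. *)
Definition star_hom H K (A : set (H -> H)) (B : set (K -> K))
    (f : (H -> H) -> (K -> K)) :=
  [/\ set_fun A B f,
      f idfun = idfun,
      forall (a : R[i]) x y, A x -> A y -> f (a *: x + y) = a *: f x + f y,
      forall x y, A x -> A y -> f (x \o y) = f x \o f y &
      forall x, A x -> f (adj x) = adj (f x)].

Definition normal_star_hom H K (A : set (H -> H)) (B : set (K -> K))
    (f : (H -> H) -> (K -> K)) :=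
  star_hom A B f /\ normal_map A f.

(* Isomorphisms of von Neumann algebras; *-isomorphisms between von Neumann
   algebras are automatically normal. *)
Definition vn_iso H K (A : set (H -> H)) (B : set (K -> K))
    (f : (H -> H) -> (K -> K)) :=
  star_hom A B f /\ set_bij A B f.

Definition freely_independent H (I : Type) (B : I -> set (H -> H))
    (phi : (H -> H) -> R[i]) :=
  forall (n : nat) (i : nat -> I) (x : nat -> H -> H),
    (forall k, (k <= n)%N -> B (i k) (x k) /\ phi (x k) = 0) ->
    (forall k, (k < n)%N -> i k <> i k.+1) ->
    phi (\big[(fun f g : H -> H => f \o g)/idfun]_(k < n.+1) x k) = 0.

(* phi is the free product state of its restrictions to the unital
   subalgebras B_i, and M is the von Neumann algebra free product of the
   (B_i, phi|B_i): the B_i generate M, phi is a faithful normal state, and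
   alternating products of phi-centred elements of the B_i are phi-centred.
   This determines (M, phi) up to a unique isomorphism fixing the B_i. *)
Definition is_free_product H (I : Type) (B : I -> set (H -> H))
    (M : set (H -> H)) (phi : (H -> H) -> R[i]) :=
  [/\ von_neumann_algebra M, faithful_normal_state M phi,
      M = bicommutant (\bigcup_i B i) & freely_independent B phi].

(* A state-preserving copy of (A, phiA) inside (M, phi); since phiA will be
   faithful, such an f is injective. *)
Definition state_embedding H K (A : set (H -> H)) (phiA : (H -> H) -> R[i])
    (M : set (K -> K)) (phi : (K -> K) -> R[i]) (f : (H -> H) -> (K -> K)) :=
  normal_star_hom A M f /\ forall x, A x -> phi (f x) = phiA x.

Definition total H (S : set H) :=
  dense [set v | exists (n : nat) (a : 'I_n -> R[i]) (s : 'I_n -> H),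
           (forall k, S (s k)) /\ v = \sum_k a k *: s k].

End Operators.

(* The Hilbert space tensor product H (x) K, which is unique up to a unique
   unitary; every realization is allowed. *)
Record tensor_space (R : realType) (H K : hilbertType R) := TensorSpace {
  tspace :> hilbertType R ;
  tens : H -> K -> tspace ;
  tens_linearl : forall v, linear (fun u => tens u v) ;
  tens_linearr : forall u, linear (tens u) ;
  tens_dotp : forall u v u' v',
    dotp (tens u v) (tens u' v') = dotp u u' * dotp v v' ;
  tens_total : total [set w | exists u v, w = tens u v] }.

(* l^2(G), presented as a Hilbert space with its canonical orthonormal basis
   (delta_g), again in an arbitrary realization. *)
Record l2_space (R : realType) (G : groupType) := L2Space {
  l2 :> hilbertType R ;
  delta : G -> l2 ;
  delta_orthonormal : forall g h, dotp (delta g) (delta h) = (g == h)%:R ;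
  delta_total : total (range delta) }.

Section Tensor.
Context {R : realType} {H K : hilbertType R} (T : tensor_space H K).

Definition tens_op (x : H -> H) (y : K -> K) : T -> T :=
  the_op [set z | forall u v, z (tens T u v) = tens T (x u) (y v)].

Definition vn_tensor (A : set (H -> H)) (B : set (K -> K)) : set (T -> T) :=
  bicommutant [set z | exists x y, [/\ A x, B y & z = tens_op x y]].

Definition is_product_state (A : set (H -> H)) (phiA : (H -> H) -> R[i])
    (B : set (K -> K)) (phiB : (K -> K) -> R[i]) (psi : (T -> T) -> R[i]) :=
  normal_state (vn_tensor A B) psi /\
  forall x y, A x -> B y -> psi (tens_op x y) = phiA x * phiB y.

End Tensor.
Arguments tens_op {R H K} T x y.
Arguments vn_tensor {R H K} T A B.
Arguments is_product_state {R H K T} A phiA B phiB psi.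

Section Group.
Context {R : realType} {G : groupType} (L : l2_space R G).

Definition lambda (g : G) : L -> L :=
  the_op [set x | forall h, x (delta L h) = delta L (g * h)%g].

Definition group_vna : set (L -> L) := bicommutant (range lambda).

Definition group_trace (x : L -> L) : R[i] := dotp (x (delta L 1%g)) (delta L 1%g).

Definition mult_op (c : G -> R[i]) : L -> L :=
  the_op [set x | forall g, x (delta L g) = c g *: delta L g].

Definition linfty : set (L -> L) :=
  [set x | exists c : G -> R[i],
     (exists k : R[i], forall g, `|c g| <= k) /\ x = mult_op c].

End Group.
Arguments lambda {R G} L g.
Arguments group_vna {R G} L.
Arguments group_trace {R G} L x.
Arguments mult_op {R G} L c.
Arguments linfty {R G} L.

Section CrossedProducts.
Context {R : realType} {G : groupType} {L : l2_space R G}.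
Context {H : hilbertType R} (T : tensor_space H L).

(* N ><|_alpha G, generated by pi_alpha(N) and the 1 (x) lambda_g, with
   (pi_alpha(x))(xi (x) delta_h) = alpha_{h^-1}(x) xi (x) delta_h. *)
Definition crossed_embed (alpha : G -> (H -> H) -> (H -> H)) (x : H -> H) : T -> T :=
  the_op [set z | forall u h,
    z (tens T u (delta L h)) = tens T (alpha h^-1%g x u) (delta L h)].

Definition crossed_unitary (g : G) : T -> T := tens_op T idfun (lambda L g).

Definition crossed_product (N : set (H -> H)) (alpha : G -> (H -> H) -> (H -> H)) :
    set (T -> T) :=
  bicommutant (crossed_embed alpha @` N `|` range crossed_unitary).

(* M ><|_Gamma K_G for a coaction Gamma : M -> M (x) L(G). *)
Definition cocrossed_product (M : set (H -> H)) (Gamma : (H -> H) -> (T -> T)) :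
    set (T -> T) :=
  bicommutant (Gamma @` M `|` tens_op T idfun @` linfty L).

Definition fixed_points (M : set (H -> H)) (Gamma : (H -> H) -> (T -> T)) :
    set (H -> H) :=
  [set x | M x /\ Gamma x = tens_op T x idfun].

Definition is_dual_action (TT : tensor_space T L)
    (N : set (H -> H)) (alpha : G -> (H -> H) -> (H -> H))
    (alphahat : (T -> T) -> (TT -> TT)) :=
  [/\ normal_star_hom (crossed_product N alpha)
        (vn_tensor TT (crossed_product N alpha) (group_vna L)) alphahat,
      forall y, N y -> alphahat (crossed_embed alpha y) =
                       tens_op TT (crossed_embed alpha y) idfun &
      forall g, alphahat (crossed_unitary g) =
                tens_op TT (crossed_unitary g) (lambda L g)].

(* (A, Ga) and (B, Gb) are isomorphic: Gb o theta = (theta (x) Id) o Ga for an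
   isomorphism theta, where Theta is theta (x) Id. *)
Definition coaction_iso (K : hilbertType R) (TK : tensor_space K L)
    (A : set (H -> H)) (Ga : (H -> H) -> (T -> T))
    (B : set (K -> K)) (Gb : (K -> K) -> (TK -> TK)) :=
  exists (theta : (H -> H) -> (K -> K)) (Theta : (T -> T) -> (TK -> TK)),
    [/\ vn_iso A B theta,
        vn_iso (vn_tensor T A (group_vna L)) (vn_tensor TK B (group_vna L)) Theta,
        forall x y, A x -> group_vna L y ->
          Theta (tens_op T x y) = tens_op TK (theta x) y &
        forall x, A x -> Gb (theta x) = Theta (Ga x)].

End CrossedProducts.
Arguments crossed_embed {R G L H} T alpha x.
Arguments crossed_unitary {R G L H} T g.
Arguments crossed_product {R G L H} T N alpha.
Arguments cocrossed_product {R G L H} T M Gamma.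
Arguments fixed_points {R G L H} T M Gamma.
Arguments is_dual_action {R G L H T} TT N alpha alphahat.
Arguments coaction_iso {R G L H T K TK} A Ga B Gb.

(* Main.v *)
(** Conjugating Gamma by the unitary W (u (x) delta_h) = lambda_h u (x)
    delta_h gives a representation theta of M on H (x) l2(G) with theta(n) =
    pi_alpha(n) for n in N and theta(lambda_g) = 1 (x) lambda_g. Since Gamma
    preserves phi, theta and the identity representation have intertwiners
    with total ranges in both directions; hence theta is an isomorphism onto
    the von Neumann algebra N x| G, and after tensoring with L(G) it carries
    Gamma to the dual action. Normality enters only through density: a normal
    functional that vanishes on a *-algebra A vanishes on A''. In particular
    the span of the n lambda_g determines normal maps on M, and slicing
    Gamma(x) = x (x) 1 at delta_1 gives N = M^Gamma. A reduced word in P and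
    the lambda_g Q lambda_g^*, times lambda_k, is a reduced word in P (x) L(G)
    and Q up to a unitary, whence freeness. Part (3) compares commutants after
    conjugating by W. *)

From HB Require Import structures.
Require Import Defs.
From mathcomp Require Import all_boot all_order all_algebra.
From mathcomp Require Import complex ring lra.
From mathcomp Require Import all_classical all_reals all_analysis.
Set Implicit Arguments.
Unset Strict Implicit.
Unset Printing Implicit Defensive.
Import Order.TTheory GRing.Theory Num.Theory.
Import numFieldNormedType.Exports.
Local Open Scope classical_set_scope.
Local Open Scope complex_scope.
Local Open Scope ring_scope.

(** The obstacle is that elements of a bicommutant are known only through commutation, while theta
    must be shown to map onto a whole bicommutant and theta (x) Id must be built on another one. Two
    devices answer this. On l2(nat, H) an ultraweak functional is a single coefficient x |-> <hat x
    u, v> of the amplification hat x; density then becomes linear algebra with one projection, and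
    finitely many functionals are matched exactly, not approximately. To move x to another space one
    prescribes z (J h) = J (x h) for all intertwiners J; that z is bounded is a spectral radius
    estimate by Cauchy-Schwarz, and the same estimate constructs x (x) 1. Transports in the two
    directions are mutually inverse, which yields surjectivity; amplified intertwiners yield theta
    (x) Id. Intertwiners from theta back to the identity come from faithfulness of phi once phi is a
    normal functional of theta x, and this rests on phi (n lambda_g) = 0 for g <> 1. Countability of
    G enters in the normality of x |-> x (x) 1. *)

(** * Real and imaginary parts of complex scalars *)

Section ComplexNumbers.
Context {R : realType}.
Implicit Types z w : R[i].

Lemma ReD z w : complex.Re (z + w) = complex.Re z + complex.Re w.
Proof. by case: z; case: w. Qed.

Lemma ReN z : complex.Re (- z) = - complex.Re z.
Proof. by case: z. Qed.

Lemma ReB z w : complex.Re (z - w) = complex.Re z - complex.Re w.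
Proof. by rewrite ReD ReN. Qed.

Lemma ReZ (t : R) z : complex.Re (t%:C * z) = t * complex.Re z.
Proof. by case: z => a b /=; rewrite mul0r subr0. Qed.

Lemma Re_conj z : complex.Re (Num.conj z) = complex.Re z.
Proof. by case: z. Qed.

Lemma Re_iN z : complex.Re ('i * z) = - complex.Im z.
Proof. by case: z => a b /=; rewrite mul0r mul1r sub0r. Qed.

Lemma conj_i : Num.conj ('i : R[i]) = - 'i.
Proof. by apply/eqP; rewrite eq_complex /= oppr0 !eqxx. Qed.

Lemma conj_real (t : R) : Num.conj t%:C = t%:C.
Proof. by apply/eqP; rewrite eq_complex /= oppr0 !eqxx. Qed.

Lemma complex_eq z w : complex.Re z = complex.Re w ->
  complex.Im z = complex.Im w -> z = w.
Proof. by case: z => a b; case: w => c d /= -> ->. Qed.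

Lemma ge0_Re z : 0 <= z -> z = (complex.Re z)%:C.
Proof. by move=> z0; rewrite RRe_real // ger0_real. Qed.

Lemma ge0_Re_ge0 z : 0 <= z -> 0 <= complex.Re z.
Proof. by move=> z0; rewrite -ler0c -ge0_Re. Qed.

Lemma sqr_norm_Re z : `|z| ^+ 2 = (complex.Re z ^+ 2 + complex.Im z ^+ 2)%:C.
Proof. by rewrite add_Re2_Im2. Qed.

End ComplexNumbers.

(** * Inner products and squared norms *)

Section InnerProduct.
Context {R : realType} {H : hilbertType R}.
Implicit Types (u v w : H) (a : R[i]).

Lemma dotDl u v w : dotp (u + v) w = dotp u w + dotp v w.
Proof. by rewrite linearDl. Qed.

Lemma dotDr u v w : dotp u (v + w) = dotp u v + dotp u w.
Proof. by rewrite linearDr. Qed.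

Lemma dotZl a u v : dotp (a *: u) v = a * dotp u v.
Proof. by rewrite linearZl. Qed.

Lemma dotZr a u v : dotp u (a *: v) = Num.conj a * dotp u v.
Proof. by rewrite linearZr. Qed.

Lemma dotC u v : dotp u v = Num.conj (dotp v u).
Proof. by rewrite [LHS]hermC /= expr0 mul1r. Qed.

Lemma dotNl u v : dotp (- u) v = - dotp u v.
Proof. by rewrite -scaleN1r dotZl mulN1r. Qed.

Lemma dotNr u v : dotp u (- v) = - dotp u v.
Proof. by rewrite -scaleN1r dotZr rmorphN1 mulN1r. Qed.

Lemma dotBl u v w : dotp (u - v) w = dotp u w - dotp v w.
Proof. by rewrite dotDl dotNl. Qed.

Lemma dotBr u v w : dotp u (v - w) = dotp u v - dotp u w.
Proof. by rewrite dotDr dotNr. Qed.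

Lemma dot0l v : dotp (0 : H) v = 0.
Proof. by rewrite -(scale0r 0) dotZl mul0r. Qed.

Lemma dot0r v : dotp v (0 : H) = 0.
Proof. by rewrite dotC dot0l rmorph0. Qed.

Lemma dot_suml (I : Type) (r : seq I) (P : pred I) (F : I -> H) v :
  dotp (\sum_(i <- r | P i) F i) v = \sum_(i <- r | P i) dotp (F i) v.
Proof. by elim/big_rec2: _ => [|i y1 y2 _ <-]; rewrite ?dot0l ?dotDl. Qed.

Lemma dot_sumr (I : Type) (r : seq I) (P : pred I) (F : I -> H) v :
  dotp v (\sum_(i <- r | P i) F i) = \sum_(i <- r | P i) dotp v (F i).
Proof. by elim/big_rec2: _ => [|i y1 y2 _ <-]; rewrite ?dot0r ?dotDr. Qed.

(** The norm of a vector is an element of [R[i]]; its square is taken in [R] so that estimates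
    become real arithmetic. *)
Definition sqn u : R := complex.Re (dotp u u).

Lemma dot_sqn u : dotp u u = (sqn u)%:C.
Proof. by apply: ge0_Re; rewrite dotp_norm exprn_ge0. Qed.

Lemma sqn_ge0 u : 0 <= sqn u.
Proof. by apply: ge0_Re_ge0; rewrite dotp_norm exprn_ge0. Qed.

Lemma sqn_norm u : (sqn u)%:C = `|u| ^+ 2.
Proof. by rewrite -dot_sqn dotp_norm. Qed.

Lemma norm_sqn u : `|u| = (Num.sqrt (sqn u))%:C.
Proof.
apply/eqP; rewrite -(@eqrXn2 _ 2) ?normr_ge0 ?ler0c ?sqrtr_ge0 //.
by rewrite -sqn_norm -rmorphXn /= sqr_sqrtr ?sqn_ge0.
Qed.

Lemma sqn_eq0 u : sqn u = 0 -> u = 0.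
Proof.
by move=> u0; apply/eqP; rewrite -normr_eq0 norm_sqn u0 sqrtr0.
Qed.

Lemma dotp_eq0 u : dotp u u = 0 -> u = 0.
Proof. by rewrite dot_sqn => -[/sqn_eq0]. Qed.

Lemma sqn0 : sqn 0 = 0. Proof. by rewrite /sqn dot0l. Qed.

Lemma Re_dotC u v : complex.Re (dotp u v) = complex.Re (dotp v u).
Proof. by rewrite dotC Re_conj. Qed.

Lemma sqnD u v : sqn (u + v) = sqn u + sqn v + 2 * complex.Re (dotp u v).
Proof.
by rewrite /sqn dotDl !dotDr !ReD (Re_dotC v u); ring.
Qed.

Lemma sqnN u : sqn (- u) = sqn u.
Proof. by rewrite /sqn dotNl dotNr opprK. Qed.

Lemma sqnB u v : sqn (u - v) = sqn u + sqn v - 2 * complex.Re (dotp u v).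
Proof. by rewrite sqnD sqnN dotNr ReN mulrN. Qed.

Lemma sqnBC u v : sqn (u - v) = sqn (v - u).
Proof. by rewrite -sqnN opprB. Qed.

Lemma sqnZ a u : sqn (a *: u) = (complex.Re a ^+ 2 + complex.Im a ^+ 2) * sqn u.
Proof.
have: (sqn (a *: u))%:C = ((complex.Re a ^+ 2 + complex.Im a ^+ 2) * sqn u)%:C.
  by rewrite sqn_norm normrZ exprMn -sqn_norm sqr_norm_Re -rmorphM.
by case.
Qed.

Lemma sqnZr (t : R) u : sqn (t%:C *: u) = t ^+ 2 * sqn u.
Proof. by rewrite sqnZ /= expr0n addr0. Qed.

(** The nonnegative quadratic t |-> |u + t v|^2 is evaluated at its minimum t = - X / |v|^2. Only
    the real part is bounded; imaginary parts are reached by replacing u with i u. *)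
Lemma sqrRe_dotp u v : complex.Re (dotp u v) ^+ 2 <= sqn u * sqn v.
Proof.
have Q t : 0 <= sqn u + t ^+ 2 * sqn v + 2 * (t * complex.Re (dotp u v)).
  have := sqn_ge0 (u + t%:C *: v).
  by rewrite sqnD sqnZr dotZr conj_real ReZ.
have [v0|v0] := eqVneq (sqn v) 0.
  by rewrite (sqn_eq0 v0) dot0r sqn0 mulr0 expr0n.
have vp : 0 < sqn v by rewrite lt_def v0 sqn_ge0.
set X := complex.Re (dotp u v); have := Q (- (X / sqn v)); rewrite -/X.
have -> : sqn u + (- (X / sqn v)) ^+ 2 * sqn v + 2 * (- (X / sqn v) * X)
   = sqn u - X ^+ 2 / sqn v by field.
by rewrite subr_ge0 ler_pdivrMr.
Qed.

Lemma dotp_ext u v : (forall w, dotp u w = dotp v w) -> u = v.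
Proof.
by move=> E; apply/eqP; rewrite -subr_eq0; apply/eqP/dotp_eq0; rewrite dotBl E subrr.
Qed.

Lemma dotp_extr u v : (forall w, dotp w u = dotp w v) -> u = v.
Proof. by move=> E; apply: dotp_ext => w; rewrite dotC E -dotC. Qed.

(** Completeness restated for sequences and real squared distances, the form in which minimising
    sequences and coordinatewise limits use it. *)
Lemma sqn_complete (u : nat -> H) :
  (forall e : R, 0 < e -> exists N, forall m n, (N <= m)%N -> (N <= n)%N ->
     sqn (u m - u n) < e) ->
  exists l, forall e : R, 0 < e -> exists N, forall n, (N <= n)%N ->
     sqn (u n - l) < e.
Proof.
move=> Cu.
have ltn (x : H) (e : R) : 0 < e -> (`|x| < e%:C) = (sqn x < e ^+ 2).
  move=> e0; rewrite -ltr_sqr ?nnegrE ?normr_ge0 ?ler0c ?ltW // -sqn_norm.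
  by rewrite -rmorphXn ltcR.
have posC (e : R[i]) : 0 < e -> 0 < complex.Re e /\ e = (complex.Re e)%:C.
  by move=> e0; have E := ge0_Re (ltW e0); split=> //; rewrite -ltcR -E.
have /cauchy_cvg/cvg_ex[l ul] : cauchy (u @ \oo).
  apply/cauchy_ballP => e /posC[e0 ->].
  have [|N HN] := Cu (complex.Re e ^+ 2); first by rewrite exprn_gt0.
  exists (u @` [set n | (N <= n)%N], u @` [set n | (N <= n)%N]) => /=.
    by split; exists N => // n /= Nn; exists n.
  move=> [x y] [/= [m Nm <-] [n Nn <-]].
  by rewrite -ball_normE /= ltn // HN.
exists l => e e0.
have /cvgrPdist_lt/(_ (Num.sqrt e)%:C) := ul.
have s0 : 0 < Num.sqrt e by rewrite sqrtr_gt0.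
rewrite ltcR => /(_ s0)[N _ HN]; exists N => n /HN /=.
by rewrite ltn // sqr_sqrtr ?ltW // sqnBC.
Qed.

(** Replaces a passage to the limit: if x > 0, the choice e = x / (2 (c + 1)) would give x <= x /
    2. *)
Lemma le_eps (x c : R) : 0 <= c -> (forall e, 0 < e -> x <= c * e) -> x <= 0.
Proof.
move=> c0 xe; rewrite leNgt; apply/negP => x0.
have c1 : 0 < 2 * (c + 1) by lra.
have := xe (x / (2 * (c + 1))); rewrite divr_gt0 // => /(_ isT).
have -> : c * (x / (2 * (c + 1))) = x * (c / (2 * (c + 1))) by field; lra.
have : c / (2 * (c + 1)) <= 1 / 2 by rewrite ler_pdivrMr //; lra.
by move=> h; have := ler_wpM2l (ltW x0) h; lra.
Qed.

Lemma inv_small (e : R) : 0 < e -> exists N, forall n, (N <= n)%N -> n.+1%:R^-1 < e.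
Proof.
by move=> e0; have [N _ HN] := near_infty_natSinv_lt (PosNum e0); exists N => n /HN.
Qed.

End InnerProduct.

(** A discriminant bound. For s > 0 take t = - X / s; for s = 0 the expression is affine in t and
    would reach -1 unless X = 0. *)
Lemma quadratic_ge0 (R : realFieldType) (X s d : R) : 0 <= s -> 0 <= d ->
  (forall t, 0 <= 2 * (t * X) + t ^+ 2 * s + d) -> X ^+ 2 <= s * d.
Proof.
move=> s0 d0 Q; have [s00|sn0] := eqVneq s 0.
  have [->|X0] := eqVneq X 0; first by rewrite expr0n mulr_ge0.
  have := Q (- (d + 1) / (2 * X)); rewrite s00 mulr0 addr0.
  have -> : 2 * (- (d + 1) / (2 * X) * X) + d = - 1 by field.
  by lra.
have sp : 0 < s by rewrite lt_def sn0.
have := Q (- (X / s)).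
have -> : 2 * (- (X / s) * X) + (- (X / s)) ^+ 2 * s + d = d - X ^+ 2 / s by field.
by rewrite subr_ge0 ler_pdivrMr // mulrC.
Qed.

Lemma ler_of_sqr (R : realFieldType) (x y : R) : 0 <= y -> x ^+ 2 <= y ^+ 2 -> x <= y.
Proof.
move=> y0 h; rewrite leNgt; apply/negP => yx.
by move: h; rewrite leNgt ltrXn2r.
Qed.

(** * Riesz representation on a domain that need not be closed *)

Section Riesz.
Context {R : realType} {H : hilbertType R}.

(** A linear map defined on a subspace, given by its graph. Single-valuedness is a consequence of
    the bounds imposed on the graph, so no representatives have to be chosen. *)
Definition lin_rel (K : lmodType R[i]) (r : set (H * K)) :=
  r (0, 0) /\ forall (a : R[i]) p q, r p -> r q ->
    r (a *: p.1 + q.1, a *: p.2 + q.2).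

(* The representing vector is the limit of the first components of a sequence
   in r minimising |u|^2 - 2 Re c. *)
Lemma riesz_rel (r : set (H * R[i]^o)) (C : R) : lin_rel r -> 0 <= C ->
  (forall p, r p -> complex.Re p.2 ^+ 2 <= C * sqn p.1) ->
  exists e, [/\ forall p, r p -> p.2 = dotp p.1 e,
    forall d, (forall p, r p -> dotp p.1 d = 0) -> dotp e d = 0 &
    sqn e <= C].
Proof.
move=> [r0 rL] C0 rC; pose q (p : H * R[i]^o) := sqn p.1 - 2 * complex.Re p.2.
have qC p : r p -> - C <= q p.
  move=> rp; rewrite /q; have := rC _ rp; have := sqn_ge0 p.1.
  set s := sqn _; set x := complex.Re _ => s0 xC.
  suff : 2 * x <= C + s by lra.
  apply: ler_of_sqr; first lra.
  have : 0 <= (C - s) ^+ 2 by rewrite sqr_ge0.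
  by move: xC; rewrite !expr2; nra.
pose m := inf [set q p | p in r].
have hi : has_inf [set q p | p in r].
  split; first by exists (q (0, 0)), (0, 0).
  by exists (- C) => _ [p rp <-]; exact: qC.
have mq p : r p -> m <= q p by move=> rp; apply: ge_inf; [case: hi | exists p].
have /choice[p Hp] n : exists p, r p /\ q p < m + n.+1%:R^-1.
  have [|_ [p rp <-] pm] := @inf_adherent _ _ n.+1%:R^-1 _ hi.
    by rewrite invr_gt0.
  by exists p.
have par i j : sqn ((p i).1 - (p j).1) <= 2 * (i.+1%:R^-1 + j.+1%:R^-1).
  have [ri qi] := Hp i; have [rj qj] := Hp j.
  (* The midpoint of two almost minimisers: the parallelogram law turns [m <= q] there into
     closeness of the first components. *)
  have rm : r (2^-1 *: ((p i).1 + (p j).1), 2^-1 *: ((p i).2 + (p j).2)).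
    have := rL 2^-1 _ (0, 0) (rL 1 _ _ ri rj) r0.
    by rewrite /= !addr0 !scale1r.
  have := mq _ rm; move: qi qj; rewrite /q /=.
  have -> : (2^-1 : R[i]) = (2^-1)%:C by rewrite fmorphV rmorphMn rmorph1.
  rewrite sqnZr ReZ ReD sqnB sqnD.
  rewrite expr2 -invfM; have -> : (2 * 2 : R)^-1 = 1 / 4 by field.
  have -> : (2 : R)^-1 = 1 / 2 by field.
  move: (sqn _) (sqn _) (complex.Re (dotp _ _)) (complex.Re _) (complex.Re _).
  by move: (i.+1%:R^-1) (j.+1%:R^-1) (m) => *; lra.
have [|e ep] := @sqn_complete _ _ (fun n => (p n).1).
  move=> e e0; have [N HN] := inv_small (divr_gt0 e0 (ltr0n R 4)).
  exists N => i j /HN hi' /HN hj; apply: le_lt_trans (par i j) _.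
  by move: (i.+1%:R^-1) (j.+1%:R^-1) hi' hj => *; lra.
(* First variation: q stays above m along p n + t a, and q (p n) is within 1/(n+1) of m, so the
   discriminant bounds the defect [X n]. *)
have key a : r a -> complex.Re a.2 = complex.Re (dotp a.1 e).
  move=> ra; pose X n := complex.Re (dotp (p n).1 a.1) - complex.Re a.2.
  have Xn n : X n ^+ 2 <= sqn a.1 * n.+1%:R^-1.
    have [rp qp] := Hp n; apply: quadratic_ge0; rewrite ?sqn_ge0 ?invr_ge0 // => t.
    have := mq _ (rL t%:C _ _ ra rp); move: qp; rewrite /q /=.
    rewrite sqnD sqnZr ReD ReZ dotZl ReZ Re_dotC /X.
    by move: (n.+1%:R^-1) (m) => *; lra.
  apply/eqP; rewrite eq_sym -subr_eq0 -sqrf_eq0 eq_le sqr_ge0 andbT.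
  apply: (@le_eps _ _ (4 * sqn a.1)) => [|d d0].
    by rewrite mulr_ge0 ?sqn_ge0.
  have [N1 H1] := ep _ d0; have [N2 H2] := inv_small d0.
  pose n := maxn N1 N2; have := Xn n; rewrite /X.
  have := H1 n (leq_maxl _ _); have := H2 n (leq_maxr _ _).
  have := sqrRe_dotp ((p n).1 - e) a.1; rewrite dotBl ReB (Re_dotC a.1 e).
  set x := complex.Re (dotp e _); set y := complex.Re _; set z := complex.Re _.
  have := sqn_ge0 a.1; set s := sqn a.1; set b := sqn _; set c := _^-1.
  move=> s0 h1 h2 h3 h4.
  have : (x - z) ^+ 2 <= 2 * (y - x) ^+ 2 + 2 * (y - z) ^+ 2.
    by have := sqr_ge0 ((y - x) + (y - z)); lra.
  by have := ler_wpM2l s0 (ltW h2); have := ler_wpM2l s0 (ltW h3); lra.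
have dense (c : R) : 0 < c -> exists2 a, r a & sqn (a.1 - e) < c.
  move=> c0; have [N HN] := ep _ c0; exists (p N); last exact: HN.
  by have [] := Hp N.
exists e; split=> [a ra|d dr|]; last 1 first.
- rewrite -subr_le0; apply: (@le_eps _ _ 1) => // c c0; rewrite mul1r.
  have [a ra ac] := dense _ c0; move: ac; rewrite sqnB -(key _ ra).
  have := rC _ ra; have := sqn_ge0 a.1; have := sqn_ge0 e.
  move: (sqn e) (sqn a.1) (complex.Re _) => s t x s0 t0 xC h.
  suff : 2 * x <= C + t by lra.
  apply: ler_of_sqr; first lra.
  have : 0 <= (C - t) ^+ 2 by rewrite sqr_ge0.
  by move: xC; rewrite !expr2; nra.
- apply: complex_eq; first exact: key.
  have := key _ (rL 'i _ _ ra r0); rewrite /= !addr0 dotZl !Re_iN.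
  by move/oppr_inj.
(* e is a limit of first components, all orthogonal to d', so the real part of <e, d'> vanishes; the
   imaginary part is obtained from - i d. *)
- have zero d' : (forall p, r p -> dotp p.1 d' = 0) -> complex.Re (dotp e d') = 0.
  move=> d'r; apply/eqP; rewrite -sqrf_eq0 eq_le sqr_ge0 andbT.
  apply: (@le_eps _ _ (sqn d')) => [|c c0]; first exact: sqn_ge0.
  have [a ra ac] := dense _ c0.
  have := sqrRe_dotp (e - a.1) d'; rewrite dotBl d'r ?subr0 //.
  by move/le_trans; apply; rewrite mulrC ler_wpM2l ?sqn_ge0 // sqnBC ltW.
apply: complex_eq; first exact: zero.
apply/eqP; rewrite -oppr_eq0; apply/eqP.
have := zero (- 'i *: d); rewrite dotZr rmorphN /= conj_i opprK Re_iN => -> //.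
by move=> a ra; rewrite dotZr dr // mulr0.
Qed.

End Riesz.

(** * Bounded operators, adjoints and projections *)

Section BoundedOperators.
Context {R : realType}.
Implicit Types E H K : hilbertType R.

(** Bounded operators between two spaces, with a real bound on squared norms; [bopE] identifies the
    case H = K with [bounded_op]. *)
Definition bop H K : set (H -> K) :=
  [set x | linear x /\ exists2 k : R, 0 <= k & forall v, sqn (x v) <= k * sqn v].

Lemma bopE H (x : H -> H) : bounded_op x <-> bop x.
Proof.
split=> -[xL]; last first.
  move=> [k k0 xk]; split => //; exists (Num.sqrt k)%:C => v.
  rewrite !norm_sqn -rmorphM lecR -sqrtrM // ler_wsqrtr //.
move=> [k xk]; split => //.
exists (complex.Re `|k| ^+ 2) => [|v]; first exact: sqr_ge0.
have kE : `|k| = (complex.Re `|k|)%:C by apply: ge0_Re.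
rewrite -lecR rmorphM rmorphXn /= -kE !sqn_norm -exprMn.
rewrite lerXn2r ?nnegrE ?mulr_ge0 //.
have h := le_trans (normr_ge0 _) (xk v).
by rewrite -[X in _ <= _ * X]normr_id -normrM ger0_norm.
Qed.

Section Linearity.
Variables (H K : hilbertType R) (x : H -> K).
Hypothesis xb : bop x.

Lemma bopD u v : x (u + v) = x u + x v.
Proof. by have [L _] := xb; rewrite -[u]scale1r L !scale1r. Qed.

Lemma bop0 : x 0 = 0.
Proof. by apply: (addrI (x 0)); rewrite -bopD !addr0. Qed.

Lemma bopZ a u : x (a *: u) = a *: x u.
Proof. by have [L _] := xb; rewrite -[_ *: u]addr0 L bop0 addr0. Qed.

End Linearity.

Lemma bop_comp E H K (y : H -> K) (x : E -> H) : bop y -> bop x -> bop (y \o x).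
Proof.
move=> yb xb; have [_ [k k0 yk]] := yb; have [_ [l l0 xl]] := xb; split=> [a u v|].
  by rewrite /= (bopD xb) (bopZ xb) (bopD yb) (bopZ yb).
exists (k * l) => [|v]; first exact: mulr_ge0.
by rewrite /= (le_trans (yk (x v))) // -mulrA ler_wpM2l.
Qed.

Lemma bop_id H : bop (idfun : H -> H).
Proof. by split=> //; exists 1 => // v; rewrite mul1r. Qed.

Lemma bop_0 H K : bop (0 : H -> K).
Proof.
by split=> [a u v|]; rewrite ?scaler0 ?addr0 //; exists 0 => // v; rewrite sqn0 mul0r.
Qed.

Lemma sqnD_le H (u v : H) : sqn (u + v) <= 2 * sqn u + 2 * sqn v.
Proof. by have := sqn_ge0 (u - v); rewrite sqnB sqnD; lra. Qed.

Lemma bop_lin H K (a : R[i]) (x y : H -> K) : bop x -> bop y -> bop (a *: x + y).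
Proof.
move=> xb yb; have [_ [k k0 xk]] := xb; have [_ [l l0 yl]] := yb; split=> [b u v|].
  rewrite !fctE (bopD xb) (bopZ xb) (bopD yb) (bopZ yb).
  by rewrite !scalerDr !scalerA mulrC addrACA.
set c := complex.Re a ^+ 2 + complex.Im a ^+ 2.
have c0 : 0 <= c by rewrite addr_ge0 ?sqr_ge0.
exists (2 * (c * k) + 2 * l) => [|v]; first by rewrite addr_ge0 ?mulr_ge0.
rewrite !fctE; have := xk v; have := yl v; have := sqnD_le (a *: x v) (y v).
rewrite sqnZ -/c => h1 h2 h3; apply: le_trans h1 _.
have := ler_wpM2l c0 h3; lra.
Qed.

(* Adjoints between different spaces; [adj] is the case [H = K]. *)
Definition hadj H K (x : H -> K) : K -> H :=
  xget 0 (@bop K H `&` [set y | forall v w, dotp (x v) w = dotp v (y w)]).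

Definition perp H (D : set H) : set H := [set d | forall a, D a -> dotp a d = 0].

Definition lin_set (V : lmodType R[i]) (D : set V) := D 0 /\
  forall (a : R[i]) u v, D u -> D v -> D (a *: u + v).

Lemma perp_lin_set H (D : set H) : lin_set (perp D).
Proof.
split=> [a _|a u v Du Dv w Dw]; first by rewrite dot0r.
by rewrite dotDr dotZr Du ?Dv // mulr0 addr0.
Qed.

(* A partially defined bounded operator, given by its graph, extended by 0 on
   the orthogonal complement of its domain. *)
Lemma adj_of_rel E K (r : set (E * K)) (C : R) : lin_rel r -> 0 <= C ->
  (forall p, r p -> sqn p.2 <= C * sqn p.1) ->
  exists y : K -> E, [/\ bop y, forall p k, r p -> dotp p.2 k = dotp p.1 (y k) &
    forall k d, perp [set p.1 | p in r] d -> dotp (y k) d = 0].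
Proof.
move=> [r0 rL] C0 rC.
(* Riesz for the functional p.1 |-> <p.2, k>. Its vector lies in the closure of the domain, hence is
   unique, and linearity in k follows from uniqueness. *)
have /choice[y Hy] (k : K) : exists e, [/\ forall p, r p -> dotp p.2 k = dotp p.1 e,
    forall d, perp [set p.1 | p in r] d -> dotp e d = 0 & sqn e <= C * sqn k].
  have [||_ [p rp ->] /=|e [e1 e2 e3]] :=
      @riesz_rel R E [set q | exists2 p, r p & q = (p.1, dotp p.2 k)] (C * sqn k).
  - split; first by exists (0, 0) => //=; rewrite dot0l.
    move=> a _ _ [p rp ->] [q rq ->]; exists (a *: p.1 + q.1, a *: p.2 + q.2).
      exact: rL.
    by rewrite /= dotDl dotZl.
  - by rewrite mulr_ge0 ?sqn_ge0.
  - apply: le_trans (sqrRe_dotp _ _) _; rewrite mulrAC ler_wpM2r ?sqn_ge0 //.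
    exact: rC.
  exists e; split=> // [p rp|d dr].
    by rewrite -(e1 (p.1, dotp p.2 k)) //; exists p.
  by apply: e2 => _ [p rp ->] /=; apply: dr; exists p.
exists y; split=> [|p k|k]; [|by have [h _ _] := Hy k; apply: h|by have [] := Hy k].
split=> [a k l|]; last by exists C => // k; have [] := Hy k.
have [k1 k2 _] := Hy k; have [l1 l2 _] := Hy l; have [s1 s2 _] := Hy (a *: k + l).
apply/eqP; rewrite -subr_eq0; apply/eqP/dotp_eq0.
set z := _ - _; have zr : perp [set p.1 | p in r] z.
  move=> _ [p rp <-]; rewrite dotBr dotDr dotZr -s1 // -k1 // -l1 //.
  by rewrite dotDr dotZr subrr.
by rewrite {1}/z dotBl dotDl dotZl s2 // k2 // l2 // mulr0 addr0 subrr.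
Qed.

Lemma hadj_ex H K (x : H -> K) : bop x ->
  exists y : K -> H, bop y /\ forall v w, dotp (x v) w = dotp v (y w).
Proof.
move=> xb; have [_ [k k0 xk]] := xb.
have [||_ [v ->]|y [yb yP _]] := @adj_of_rel H K [set p | exists v, p = (v, x v)] k.
- split; first by exists 0; rewrite (bop0 xb).
  move=> a _ _ [v ->] [w ->]; exists (a *: v + w).
  by rewrite (bopD xb) (bopZ xb).
- by [].
- exact: xk.
by exists y; split=> // v w; apply: (yP (v, x v)); exists v.
Qed.

Section Adjoint.
Variables (H K : hilbertType R) (x : H -> K).
Hypothesis xb : bop x.

Lemma hadj_bop : bop (hadj x).
Proof.
by rewrite /hadj; case: xgetP => [y _ []|] //; have [y Hy] := hadj_ex xb => /(_ y).
Qed.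

Lemma hadjP v w : dotp (x v) w = dotp v (hadj x w).
Proof.
rewrite /hadj; case: xgetP => [y _ [_ ->]|] //.
by have [y Hy] := hadj_ex xb => /(_ y).
Qed.

Lemma hadjPl v w : dotp w (x v) = dotp (hadj x w) v.
Proof. by rewrite dotC hadjP -dotC. Qed.

Lemma hadj_unique (y : K -> H) :
  (forall v w, dotp (x v) w = dotp v (y w)) -> y = hadj x.
Proof. by move=> yP; apply/funext => w; apply: dotp_extr => v; rewrite -yP hadjP. Qed.

End Adjoint.

Lemma hadjK H K (x : H -> K) : bop x -> hadj (hadj x) = x.
Proof.
move=> xb; apply/esym/hadj_unique => [|v w]; first exact: hadj_bop.
by rewrite -hadjPl.
Qed.

Lemma hadj_comp E H K (y : H -> K) (x : E -> H) : bop y -> bop x ->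
  hadj (y \o x) = hadj x \o hadj y.
Proof.
move=> yb xb; apply/esym/hadj_unique => [|v w] /=; first exact: bop_comp.
by rewrite hadjP // hadjP.
Qed.

(** [adj_of_rel] produces the adjoint of the extended operator; one more adjoint gives the extension
    itself. *)
Lemma partial_op E K (r : set (E * K)) (C : R) : lin_rel r -> 0 <= C ->
  (forall p, r p -> sqn p.2 <= C * sqn p.1) ->
  exists V : E -> K, [/\ bop V, forall p, r p -> V p.1 = p.2 &
    forall d, perp [set p.1 | p in r] d -> V d = 0].
Proof.
move=> rL C0 rC; have [y [yb y1 y2]] := adj_of_rel rL C0 rC.
exists (hadj y); split=> [|p rp|d dr]; first exact: hadj_bop.
  by apply: dotp_extr => k; rewrite -hadjP // dotC -y1 // -dotC.
by apply: dotp_extr => k; rewrite -hadjP // y2 // dot0r.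
Qed.

(** The operator of [adj_of_rel] for the identity graph on D. Closures are not formed:
    [perp (perp D)] stands for the closure of D. *)
Lemma proj_ex H (D : set H) : lin_set D -> exists P : H -> H,
  bop P /\ forall w, perp (perp D) (P w) /\ perp D (w - P w).
Proof.
move=> [D0 DL].
have [||_ [v Dv ->]|P [Pb P1 P2]] :=
  @adj_of_rel H H [set p | exists2 v, D v & p = (v, v)] 1.
- by split; [exists 0 | move=> a _ _ [u Du ->] [v Dv ->]; exists (a *: u + v); rewrite //; exact: DL].
- by [].
- by rewrite mul1r.
exists P; split=> // w; split=> [d Dd|d Dd].
  rewrite dotC P2 ?rmorph0 // => _ [p [v Dv ->] <-] /=; exact: Dd.
by rewrite dotBr -(P1 (d, d)) ?subrr //; exists d.
Qed.

(** Totality in its dual form: only 0 is orthogonal to S. *)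
Definition sep H (S : set H) := forall d, perp S d -> d = 0.

Lemma bop_ext E K (S : set E) (f g : E -> K) : bop f -> bop g -> sep S ->
  (forall s, S s -> f s = g s) -> f = g.
Proof.
move=> fb gb S0 fg; have db : bop (- 1 *: g + f) by apply: bop_lin.
apply/funext => w; apply/eqP; rewrite -subr_eq0; apply/eqP/dotp_ext => k.
have -> : f w - g w = (- 1 *: g + f) w by rewrite !fctE scaleN1r addrC.
rewrite dot0l hadjP // (S0 (hadj _ k)) ?dot0r // => s Ss.
by rewrite -hadjP // !fctE fg // scaleN1r addNr dot0l.
Qed.

Lemma proj_unique H (D : set H) (P : H -> H) w a b :
  (forall w, perp (perp D) (P w) /\ perp D (w - P w)) ->
  perp (perp D) a -> perp D b -> w = a + b -> P w = a.
Proof.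
move=> PP Da Db wE; apply/eqP; rewrite -subr_eq0; apply/eqP/dotp_eq0.
have [Pw1 Pw2] := PP w; have [_ L1] := perp_lin_set D; have [_ L2] := perp_lin_set (perp D).
have z1 : perp (perp D) (P w - a).
  by have := L2 (- 1) _ _ Da Pw1; rewrite scaleN1r addrC.
have E : b = w - a by rewrite wE addrAC subrr add0r.
apply: z1; have := L1 (- 1) _ _ Pw2 Db.
by rewrite scaleN1r opprB E addrA subrK.
Qed.

End BoundedOperators.

(** * Limits of complex sequences *)

Section ComplexLimits.
Context {R : realType}.

(** Convergence by real and imaginary parts, so that limit theorems over [R] apply; [ccvg_cvg]
    returns to the topology of [R[i]^o] in which ultraweak functionals are defined. *)
Definition ccvg (z : nat -> R[i]) (l : R[i]) :=
  (@complex.Re R \o z) @ \oo --> complex.Re l /\ (@complex.Im R \o z) @ \oo --> complex.Im l.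

Lemma ccvg_unique z l l' : ccvg z l -> ccvg z l' -> l = l'.
Proof.
move=> [r i] [r' i'].
by apply: complex_eq; [exact: (cvg_unique _ r r') | exact: (cvg_unique _ i i')].
Qed.

Lemma ccvgD z w l m : ccvg z l -> ccvg w m -> ccvg (fun n => z n + w n) (l + m).
Proof.
move=> [r i] [r' i']; split.
  have -> : @complex.Re R \o (fun n => z n + w n) = (@complex.Re R \o z) + (@complex.Re R \o w).
    by apply/funext => n /=; rewrite ReD.
  by rewrite ReD; apply: cvgD.
have ImD (a b : R[i]) : complex.Im (a + b) = complex.Im a + complex.Im b.
  by case: a; case: b.
have -> : @complex.Im R \o (fun n => z n + w n) = (@complex.Im R \o z) + (@complex.Im R \o w).
  by apply/funext => n /=; rewrite ImD.
by rewrite ImD; apply: cvgD.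
Qed.

Lemma ccvgM (a : R[i]) z l : ccvg z l -> ccvg (fun n => a * z n) (a * l).
Proof.
case: a => a b [r i]; split.
  have -> : @complex.Re R \o (fun n => (a +i* b) * z n) =
     (fun n => a * (@complex.Re R \o z) n - b * (@complex.Im R \o z) n).
    by apply/funext => n /=; case: (z n).
  have -> : complex.Re ((a +i* b) * l) = a * complex.Re l - b * complex.Im l.
    by case: (l).
  by apply: cvgB; apply: cvgM => //; apply: cvg_cst.
have -> : @complex.Im R \o (fun n => (a +i* b) * z n) =
   (fun n => a * (@complex.Im R \o z) n + b * (@complex.Re R \o z) n).
  by apply/funext => n /=; case: (z n).
have -> : complex.Im ((a +i* b) * l) = a * complex.Im l + b * complex.Re l.
  by case: (l).
by apply: cvgD; apply: cvgM => //; apply: cvg_cst.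
Qed.

Lemma ccvg_conj z l : ccvg z l -> ccvg (fun n => Num.conj (z n)) (Num.conj l).
Proof.
move=> [r i]; split.
  rewrite Re_conj; have -> // : @complex.Re R \o (fun n => Num.conj (z n)) = @complex.Re R \o z.
  by apply/funext => n /=; rewrite Re_conj.
have -> : @complex.Im R \o (fun n => Num.conj (z n)) = (fun n => - (@complex.Im R \o z) n).
  by apply/funext => n /=; case: (z n).
have -> : complex.Im (Num.conj l) = - complex.Im l by case: (l).
exact: cvgN.
Qed.

Lemma ccvg_cvg (z : nat -> R[i]^o) (l : R[i]^o) : ccvg z l -> z @ \oo --> l.
Proof.
move=> [/cvgrPdist_lt r /cvgrPdist_lt i]; apply/cvgrPdist_lt => e e0.
have eE := ge0_Re (ltW e0); set d := complex.Re e in eE.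
have d0 : 0 < d by rewrite -ltcR -eE.
have [N _ rN] := r _ (divr_gt0 d0 (ltr0n _ 2)).
have [M _ iM] := i _ (divr_gt0 d0 (ltr0n _ 2)).
exists (maxn N M) => // n /=; rewrite geq_max => /andP[Nn Mn].
have := rN _ Nn; have := iM _ Mn; rewrite eE /=.
set w := l - z n; move=> hi hr.
have -> : w = (complex.Re w)%:C + 'i * (complex.Im w)%:C by rewrite -complexE.
apply: le_lt_trans (ler_normD _ _) _; rewrite normrM.
have n1 (t : R) : `|t%:C| = `|t|%:C :> R[i].
  by rewrite normc_def /= expr0n addr0 sqrtr_sqr.
have -> : `|'i : R[i]| = 1 by rewrite normc_def /= expr0n add0r expr1n sqrtr1.
rewrite mul1r !n1 -rmorphD ltcR.
have -> : complex.Re w = complex.Re l - complex.Re (z n) by rewrite ReB.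
have -> : complex.Im w = complex.Im l - complex.Im (z n).
  by rewrite /w; case: (l); case: (z n).
by lra.
Qed.

Lemma ccvg_real (z : nat -> R) (l : R) : z @ \oo --> l -> ccvg (fun n => (z n)%:C) l%:C.
Proof. by move=> zl; split=> //=; apply: cvg_cst. Qed.

End ComplexLimits.

(** * The Hilbert space of square-summable sequences *)

Section SquareSummable.
Context {R : realType}.
Variable H : hilbertType R.
Implicit Types u v : nat -> H.

Definition l2_seq : {pred nat -> H} :=
  fun u => `[< exists c : R, forall n, \sum_(k < n) sqn (u k) <= c >].

Lemma l2_seq_submod : submod_closed l2_seq.
Proof.
split; first by apply/asboolP; exists 0 => n; rewrite big1 // => k _; rewrite sqn0.
move=> a u v /asboolP[c uc] /asboolP[d vd]; apply/asboolP.
set e := complex.Re a ^+ 2 + complex.Im a ^+ 2.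
exists (2 * (e * c) + 2 * d) => n.
apply: (@le_trans _ _ (2 * (e * \sum_(k < n) sqn (u k)) + 2 * \sum_(k < n) sqn (v k))).
  rewrite !mulr_sumr -big_split /=; apply: ler_sum => k _.
  by rewrite -sqnZ; exact: sqnD_le.
by rewrite lerD // ler_wpM2l // ler_wpM2l // addr_ge0 ?sqr_ge0.
Qed.

HB.instance Definition _ := GRing.isSubmodClosed.Build _ _ l2_seq l2_seq_submod.

(** This is l2(nat, H), made into a Hilbert space so that an ultraweak functional, a series of
    matrix coefficients, becomes one matrix coefficient of an amplification. *)
Record l2n := L2n { l2fun :> nat -> H; l2funP : l2fun \in l2_seq }.

HB.instance Definition _ := [isSub for l2fun].
HB.instance Definition _ := [Choice of l2n by <:].
HB.instance Definition _ := [SubChoice_isSubLmodule of l2n by <:].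

End SquareSummable.

Section L2Hilbert.
Context {R : realType} {H : hilbertType R}.
Implicit Types u v w : l2n H.

Definition psum u (n : nat) : R := \sum_(k < n) sqn (u k).

Lemma psum_bound u : exists c : R, forall n, psum u n <= c.
Proof. by have /asboolP[c uc] := l2funP u; exists c. Qed.

Lemma psum_cvg u : psum u @ \oo --> sup (range (psum u)).
Proof.
apply: nondecreasing_cvgn.
  apply/nondecreasing_seqP => n; rewrite /psum big_ord_recr /= lerDl; exact: sqn_ge0.
by have [c uc] := psum_bound u; exists c => _ [n _ <-].
Qed.

Lemma l2D u v k : (u + v) k = u k + v k. Proof. by []. Qed.
Lemma l2N u k : (- u) k = - u k. Proof. by []. Qed.
Lemma l2Z (a : R[i]) u k : (a *: u) k = a *: u k. Proof. by []. Qed.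
Lemma l2_0 k : (0 : l2n H) k = 0. Proof. by []. Qed.

Lemma l2_ext u v : (forall k, u k = v k) -> u = v.
Proof. by move=> E; apply: val_inj; apply/funext. Qed.

Definition dsum u v (n : nat) : R[i] := \sum_(k < n) dotp (u k) (v k).

Lemma Re_sum (I : Type) (r : seq I) (P : pred I) (F : I -> R[i]) :
  complex.Re (\sum_(i <- r | P i) F i) = \sum_(i <- r | P i) complex.Re (F i).
Proof. by elim/big_rec2: _ => // i y1 y2 _ <-; rewrite ReD. Qed.

(** Polarisation: convergence of inner products reduces to monotone bounded partial sums of squared
    norms. *)
Lemma Re_dsum u v n :
  complex.Re (dsum u v n) = 4^-1 * (psum (u + v) n - psum (u - v) n).
Proof.
rewrite /dsum Re_sum /psum -sumrB mulr_sumr; apply: eq_bigr => k _.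
by rewrite !l2D l2N sqnB sqnD; field.
Qed.

Lemma dsum_ccvg u v : exists l, ccvg (dsum u v) l.
Proof.
pose rl u v := 4^-1 * (sup (range (psum (u + v))) - sup (range (psum (u - v)))).
have rc u' v' : (fun n => complex.Re (dsum u' v' n)) @ \oo --> rl u' v'.
  have -> : (fun n => complex.Re (dsum u' v' n)) =
      (fun n => 4^-1 * (psum (u' + v') n - psum (u' - v') n)).
    by apply/funext => n; rewrite Re_dsum.
  apply: cvgM; first exact: cvg_cst.
  by apply: cvgB; exact: psum_cvg.
exists (rl u v +i* - rl ('i *: u) v); split; first exact: rc.
have -> : @complex.Im R \o dsum u v = (fun n => - complex.Re (dsum ('i *: u) v n)).
  apply/funext => n /=; rewrite /dsum.
  under [in RHS]eq_bigr do rewrite l2Z dotZl.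
  by rewrite -mulr_sumr Re_iN opprK.
by apply: cvgN; exact: rc.
Qed.

Definition l2dot u v : R[i] := xget 0 [set l | ccvg (dsum u v) l].

Lemma l2dotP u v : ccvg (dsum u v) (l2dot u v).
Proof. by rewrite /l2dot; case: xgetP => [//|]; have [l ul] := dsum_ccvg u v => /(_ l). Qed.

Lemma l2dotl a u v w : l2dot (a *: u + v) w = a * l2dot u w + l2dot v w.
Proof.
apply: ccvg_unique (l2dotP _ _) _.
have -> : dsum (a *: u + v) w = (fun n => a * dsum u w n + dsum v w n).
  apply/funext => n; rewrite /dsum mulr_sumr -big_split; apply: eq_bigr => k _.
  by rewrite l2D l2Z dotDl dotZl.
by apply: ccvgD; [apply: ccvgM|]; exact: l2dotP.
Qed.

Lemma l2dotC u v : l2dot u v = Num.conj (l2dot v u).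
Proof.
apply: ccvg_unique (l2dotP _ _) _.
have -> : dsum u v = (fun n => Num.conj (dsum v u n)).
  apply/funext => n; rewrite /dsum rmorph_sum; apply: eq_bigr => k _; exact: dotC.
by apply: ccvg_conj; exact: l2dotP.
Qed.

Definition l2sq u : R := sup (range (psum u)).

Lemma l2dot_sq u : l2dot u u = (l2sq u)%:C.
Proof.
apply: ccvg_unique (l2dotP _ _) _.
have -> : dsum u u = (fun n => (psum u n)%:C).
  apply/funext => n; rewrite /dsum /psum rmorph_sum; apply: eq_bigr => k _.
  exact: dot_sqn.
by apply: ccvg_real; exact: psum_cvg.
Qed.

Lemma psum_le u n : psum u n <= l2sq u.
Proof.
apply: sup_upper_bound; last by exists n.
split; first by exists (psum u n), n.
by have [c uc] := psum_bound u; exists c => _ [m _ <-].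
Qed.

Lemma l2sq_le u c : (forall n, psum u n <= c) -> l2sq u <= c.
Proof.
move=> uc; apply: ge_sup; first by exists (psum u 0%N), 0%N.
by move=> _ [n _ <-].
Qed.

Lemma l2sq_ge0 u : 0 <= l2sq u.
Proof. by apply: le_trans (psum_le u 0); rewrite /psum big_ord0. Qed.

Lemma sqn_le_l2sq u k : sqn (u k) <= l2sq u.
Proof.
apply: le_trans (psum_le u k.+1); rewrite /psum big_ord_recr /= lerDr.
by apply: sumr_ge0 => i _; exact: sqn_ge0.
Qed.

Lemma l2sq_eq0 u : l2sq u = 0 -> u = 0.
Proof.
move=> u0; apply: l2_ext => k; rewrite l2_0; apply: sqn_eq0.
by apply/eqP; rewrite eq_le sqn_ge0 -u0 sqn_le_l2sq.
Qed.

Lemma l2sqD u v : l2sq (u + v) = l2sq u + l2sq v + 2 * complex.Re (l2dot u v).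
Proof.
have: l2dot (u + v) (u + v) = l2dot u u + l2dot u v + (l2dot v u + l2dot v v).
  have D w x y : l2dot (w + x) y = l2dot w y + l2dot x y.
    by have := l2dotl 1 w x y; rewrite scale1r mul1r.
  by rewrite D; congr (_ + _); rewrite l2dotC D rmorphD /= -!l2dotC.
move/(congr1 (@complex.Re R)); rewrite !l2dot_sq !ReD /= (l2dotC v u) Re_conj => ->.
ring.
Qed.

Lemma l2sqZ a u : l2sq (a *: u) = (complex.Re a ^+ 2 + complex.Im a ^+ 2) * l2sq u.
Proof.
have Z b v w : l2dot (b *: v) w = b * l2dot v w.
  have := l2dotl b v 0 w; rewrite addr0 => ->.
  by have := l2dotl (- 1) v v w; rewrite scaleN1r addNr mulN1r addNr => ->; rewrite addr0.
have: l2dot (a *: u) (a *: u) = ((complex.Re a ^+ 2 + complex.Im a ^+ 2) * l2sq u)%:C.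
  rewrite Z l2dotC Z rmorphM /= -l2dotC l2dot_sq mulrA -normCK sqr_norm_Re.
  by rewrite -rmorphM.
by rewrite l2dot_sq => -[].
Qed.

Definition l2norm u : R[i] := (Num.sqrt (l2sq u))%:C.

Lemma l2_normD u v : l2norm (u + v) <= l2norm u + l2norm v.
Proof.
rewrite /l2norm -rmorphD lecR.
apply: ler_of_sqr; first by rewrite addr_ge0 ?sqrtr_ge0.
rewrite sqr_sqrtr ?l2sq_ge0 // l2sqD sqrrD !sqr_sqrtr ?l2sq_ge0 //.
suff : complex.Re (l2dot u v) <= Num.sqrt (l2sq u) * Num.sqrt (l2sq v) by lra.
apply: ler_of_sqr; first by rewrite mulr_ge0 ?sqrtr_ge0.
rewrite exprMn !sqr_sqrtr ?l2sq_ge0 // mulrC.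
apply: quadratic_ge0; rewrite ?l2sq_ge0 // => t.
have := l2sq_ge0 (t%:C *: v + u); rewrite l2sqD l2sqZ /= expr0n addr0.
have -> : l2dot (t%:C *: v) u = t%:C * l2dot v u.
  have := l2dotl t%:C v 0 u; rewrite addr0 => ->.
  by have := l2dotl (- 1) v v u; rewrite scaleN1r addNr mulN1r addNr => ->; rewrite addr0.
by rewrite ReZ (l2dotC v u) Re_conj; lra.
Qed.

Lemma l2_normZ (a : R[i]) u : l2norm (a *: u) = `|a| * l2norm u.
Proof.
by rewrite /l2norm l2sqZ sqrtrM ?addr_ge0 ?sqr_ge0 // rmorphM /= -normc_def.
Qed.

Lemma l2_norm_eq0 u : l2norm u = 0 -> u = 0.
Proof.
move=> [/eqP]; rewrite sqrtr_eq0 => u0; apply: l2sq_eq0.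
by apply/eqP; rewrite eq_le u0 l2sq_ge0.
Qed.

HB.instance Definition _ :=
  Lmodule_isNormed.Build R[i] (l2n H) l2_normD l2_normZ l2_norm_eq0.

End L2Hilbert.

Section L2Complete.
Context {R : realType} {H : hilbertType R}.
Implicit Types u v w : l2n H.

Lemma l2norm_lt u (e : R) : 0 < e -> (`|u| < e%:C) = (l2sq u < e ^+ 2).
Proof.
move=> e0; rewrite [`|u|]/(l2norm u) /l2norm ltcR -[in RHS](sqr_sqrtr (l2sq_ge0 u)).
by rewrite ltr_pXn2r ?nnegrE ?sqrtr_ge0 ?ltW.
Qed.

Lemma l2sqD_le u v : l2sq (u + v) <= 2 * l2sq u + 2 * l2sq v.
Proof.
apply: l2sq_le => n; apply: (@le_trans _ _ (2 * psum u n + 2 * psum v n)).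
  by rewrite /psum !mulr_sumr -big_split /=; apply: ler_sum => k _; exact: sqnD_le.
by rewrite lerD // ler_wpM2l // psum_le.
Qed.

Lemma l2sqBC u v : l2sq (u - v) = l2sq (v - u).
Proof. by rewrite -opprB -scaleN1r l2sqZ /= oppr0 expr0n addr0 sqrrN expr1n mul1r. Qed.

(** Limits are taken coordinatewise. Membership and convergence come from a Fatou argument: in the
    first K coordinates u m is replaced by its limit with an error at most 2 K d, for arbitrary d >
    0. *)
Lemma l2_seq_complete (u : nat -> l2n H) :
  (forall e : R, 0 < e -> exists N, forall m n, (N <= m)%N -> (N <= n)%N ->
     l2sq (u m - u n) < e) ->
  exists l, forall e : R, 0 < e -> exists N, forall n, (N <= n)%N ->
     l2sq (u n - l) < e.
Proof.
move=> Cu.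
have /choice[l ul] k : exists l, forall e : R, 0 < e -> exists N, forall n, (N <= n)%N ->
     sqn (u n k - l) < e.
  apply: sqn_complete => e /Cu[N HN]; exists N => m n Nm Nn.
  exact: le_lt_trans (sqn_le_l2sq (u m - u n) k) (HN _ _ Nm Nn).
have ule (K : nat) (d : R) : 0 < d -> exists M, forall m, (M <= m)%N ->
    forall k, (k < K)%N -> sqn (u m k - l k) < d.
  move=> d0; elim: K => [|K [M HM]]; first by exists 0%N.
  have [N HN] := ul K _ d0; exists (maxn M N) => m; rewrite geq_max => /andP[Mm Nm] k.
  by rewrite ltnS leq_eqVlt => /predU1P[->|kK]; [exact: HN|exact: HM].
have fatou (e : R) : 0 < e -> exists N, forall n, (N <= n)%N -> forall K,
    \sum_(k < K) sqn (u n k - l k) <= 2 * e.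
  move=> e0; have [N HN] := Cu _ e0; exists N => n Nn K.
  rewrite -subr_le0; apply: (@le_eps _ _ (2 * K%:R)) => [|d d0].
    by rewrite mulr_ge0.
  have [M HM] := ule K d d0; pose m := maxn M N.
  rewrite lerBlDl; apply: (@le_trans _ _ (\sum_(k < K)
      (2 * sqn ((u n - u m) k) + 2 * sqn (u m k - l k)))).
    apply: ler_sum => k _; rewrite l2D l2N; apply: le_trans (sqnD_le _ _).
    by rewrite addrA subrK.
  rewrite big_split /= -!mulr_sumr; apply: lerD.
    rewrite ler_wpM2l //; apply: le_trans (psum_le (u n - u m) K) _.
    by rewrite ltW // HN // leq_maxr.
  rewrite -mulrA ler_wpM2l //.
  have -> : K%:R * d = \sum_(k < K) d by rewrite sumr_const card_ord mulr_natl.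
  by apply: ler_sum => k _; rewrite ltW // HM // leq_maxl.
have lP : l \in @l2_seq R H.
  have [N HN] := fatou 1 ltr01; have [c uc] := psum_bound (u N).
  apply/asboolP; exists (2 * c + 2 * (2 * 1)) => n.
  apply: (@le_trans _ _ (2 * psum (u N) n + 2 * \sum_(k < n) sqn (u N k - l k))).
    rewrite /psum !mulr_sumr -big_split /=; apply: ler_sum => k _.
    rewrite (sqnBC (u N k)); apply: le_trans (sqnD_le _ _).
    by rewrite addrC subrK.
  by rewrite lerD // ler_wpM2l // HN.
exists (L2n lP) => e e0; have [N HN] := fatou (e / 4) (divr_gt0 e0 (ltr0n _ 4)).
exists N => n Nn; apply: (@le_lt_trans _ _ (2 * (e / 4))); last lra.
by apply: l2sq_le => K; exact: HN.
Qed.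

(** Centres x n of balls of radius 1/(n+1) belonging to the filter form a Cauchy sequence, because
    any two members of the filter meet; the filter converges to the limit of this sequence. *)
Lemma l2_complete (F : set_system (l2n H)) : ProperFilter F -> cauchy F -> cvg F.
Proof.
move=> FF /cauchyP CF.
have /choice[x Fx] n : exists x, F (ball x (n.+1%:R^-1 : R)%:C).
  by apply: CF; rewrite ltcR invr_gt0.
have ballE (y z : l2n H) (e : R) : 0 < e -> ball y e%:C z -> l2sq (y - z) < e ^+ 2.
  by move=> e0; rewrite -ball_normE /= l2norm_lt.
have [|l xl] := @l2_seq_complete x.
  (* Radii below d <= 1 have squares below d <= e / 4. *)
  move=> e e0; pose d := Num.min 1 (e / 4).
  have d0 : 0 < d by rewrite lt_min ltr01 divr_gt0.
  have [N HN] := inv_small d0; exists N => m n Nm Nn.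
  have [z [/ballE mz /ballE nz]] := filter_ex (filterI (Fx m) (Fx n)).
  have h k : (N <= k)%N -> (k.+1%:R^-1 : R) ^+ 2 < e / 4.
    move=> Nk; have k0 : 0 < k.+1%:R^-1 :> R by rewrite invr_gt0.
    have k1 := HN _ Nk; apply: (@lt_le_trans _ _ (d * 1)).
      rewrite expr2; apply: ltr_pM => //; try exact: ltW.
      by apply: lt_le_trans k1 _; rewrite ge_min lexx.
    by rewrite mulr1 ge_min lexx orbT.
  have := l2sqD_le (x m - z) (z - x n); rewrite addrA subrK (l2sqBC z).
  have i0 k : 0 < k.+1%:R^-1 :> R by rewrite invr_gt0.
  move: (mz (i0 m)) (nz (i0 n)) (h m Nm) (h n Nn).
  move: (l2sq _) (l2sq _) (l2sq _) (_ ^+ 2) (_ ^+ 2) => a b c f g *; lra.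
apply/cvg_ex; exists l; apply/cvgrPdist_lt => e e0.
have eE := ge0_Re (ltW e0); set d := complex.Re e in eE.
have d0 : 0 < d by rewrite -ltcR -eE.
have d2 : 0 < d ^+ 2 / 4 by rewrite divr_gt0 // exprn_gt0.
have [N1 H1] := xl _ d2.
have [N2 H2] := inv_small (divr_gt0 d0 (ltr0n _ 2)).
pose n := maxn N1 N2; near=> y.
have : ball (x n) (n.+1%:R^-1 : R)%:C y by near: y; exact: Fx.
move/ballE; rewrite invr_gt0 => /(_ (ltr0n _ _)) yn.
rewrite eE l2norm_lt //.
have := l2sqD_le (l - x n) (x n - y); rewrite addrA subrK => h; apply: le_lt_trans h _.
rewrite l2sqBC; have := H1 n (leq_maxl _ _).
have : (n.+1%:R^-1 : R) ^+ 2 <= (d / 2) ^+ 2.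
  by rewrite ler_pXn2r ?nnegrE ?divr_ge0 ?invr_ge0 ?ltW // H2 // leq_maxr.
move: yn; rewrite expr_div_n; move: (_ ^+ 2) (l2sq _) (l2sq _) (d ^+ 2) => a b c f h1 h2 h3.
have -> : f = 2 * (f / 4) + 2 * (f / 4) by field.
have e4 : (2 ^+ 2 : R) = 4 by rewrite expr2; lra.
by move: h2; rewrite e4 => h2; lra.
Unshelve. all: by end_near. Qed.

HB.instance Definition _ := Uniform_isComplete.Build (l2n H) l2_complete.

Lemma l2dot_linl v : linear_for *%R (fun u => l2dot u v).
Proof. by move=> a x y; rewrite l2dotl. Qed.

Lemma l2dot_linr u : linear_for (Num.conj \; *%R) (l2dot u).
Proof. by move=> a x y; rewrite /= l2dotC l2dotl rmorphD rmorphM /= -!l2dotC. Qed.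

HB.instance Definition _ :=
  bilinear_isBilinear.Build _ _ _ _ _ _ (@l2dot R H) (l2dot_linl, l2dot_linr).

Lemma l2dot_herm u v : l2dot u v = (- 1) ^+ false * Num.conj (l2dot v u).
Proof. by rewrite expr0 mul1r -l2dotC. Qed.

HB.instance Definition _ :=
  isHermitianSesquilinear.Build _ _ false (@Num.conj R[i]) (@l2dot R H) l2dot_herm.

Lemma l2dot_pos u : u != 0 -> 0 < l2dot u u.
Proof.
move=> u0; rewrite l2dot_sq ltcR lt_def l2sq_ge0 andbT.
by apply: contra u0 => /eqP/l2sq_eq0 ->.
Qed.

HB.instance Definition _ := isDotProduct.Build _ _ (@l2dot R H) l2dot_pos.

Lemma l2dot_norm u : l2dot u u = `|u| ^+ 2.
Proof.
by rewrite l2dot_sq [`|u|]/(l2norm u) /l2norm -rmorphXn /= sqr_sqrtr ?l2sq_ge0.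
Qed.

HB.instance Definition _ := isHilbert.Build R (l2n H) (l2dot_norm : forall x, (@l2dot R H : {dot _ for (@Num.conj R[i])}) x x = `|x| ^+ 2).

End L2Complete.

(** * Amplifications and ultraweak functionals *)

Section L2Operators.
Context {R : realType}.
Implicit Types E H K : hilbertType R.

Lemma sqn_l2 H (u : l2n H) : sqn u = l2sq u.
Proof. by have E : dotp u u = (l2sq u)%:C := l2dot_sq u; rewrite /sqn E. Qed.

Lemma dotp_l2 H (u v : l2n H) : ccvg (dsum u v) (dotp u v).
Proof. exact: l2dotP. Qed.

Lemma l2_seq_in H (n : nat) (h : H) :
  (fun k => if k == n then h else 0) \in @l2_seq R H.
Proof.
apply/asboolP; exists (sqn h) => m.
have [nm|mn] := ltnP n m; last first.
  rewrite big1 ?sqn_ge0 // => k _; rewrite ifN ?sqn0 //.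
  by rewrite neq_ltn (leq_trans (ltn_ord k)).
rewrite (bigD1 (Ordinal nm)) //= eqxx big1 ?addr0 // => k kn.
by rewrite ifN ?sqn0 //; apply: contra kn => /eqP kn; apply/eqP/val_inj.
Qed.

Definition l2in H (n : nat) (h : H) : l2n H := L2n (l2_seq_in n h).

Lemma l2inE H n (h : H) k : l2in n h k = if k == n then h else 0.
Proof. by []. Qed.

Lemma dotp_l2in H (u : l2n H) n h : dotp u (l2in n h) = dotp (u n) h.
Proof.
apply: ccvg_unique (dotp_l2 _ _) _.
have E m : (n < m)%N -> dsum u (l2in n h) m = dotp (u n) h.
  move=> nm; rewrite /dsum (bigD1 (Ordinal nm)) //= eqxx big1 ?addr0 // => k kn.
  rewrite ifN ?dot0r //; apply: contra kn => /eqP kn; apply/eqP/val_inj; exact: kn.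
split; apply: cvg_near_cst; exists n.+1 => //= m nm; by rewrite E.
Qed.

Lemma l2in_bop H n : bop (@l2in H n).
Proof.
split=> [a u v|].
  apply: l2_ext => k; rewrite l2D l2Z !l2inE; case: ifP => //.
  by rewrite scaler0 addr0.
exists 1 => // v; rewrite mul1r sqn_l2 /l2sq; apply: l2sq_le => m.
have /asboolP := l2_seq_in n v.
have [nm|mn] := ltnP n m; last first.
  rewrite /psum big1 ?sqn_ge0 // => k _; rewrite l2inE ifN ?sqn0 //.
  by rewrite neq_ltn (leq_trans (ltn_ord k)).
rewrite /psum (bigD1 (Ordinal nm)) //= eqxx big1 ?addr0 // => k kn.
by rewrite ifN ?sqn0 //; apply: contra kn => /eqP kn; apply/eqP/val_inj.
Qed.

Definition l2pr H (n : nat) (u : l2n H) : H := u n.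

Lemma l2pr_bop H n : bop (@l2pr H n).
Proof.
split=> [a u v|]; first by rewrite /l2pr l2D l2Z.
by exists 1 => // v; rewrite mul1r sqn_l2 sqn_le_l2sq.
Qed.

Lemma dotp_l2in_l H (u : l2n H) n h : dotp (l2in n h) u = dotp h (l2pr n u).
Proof. by rewrite dotC dotp_l2in -dotC. Qed.

Lemma l2_in_total H (u : l2n H) : (forall n h, dotp (l2in n h) u = 0) -> u = 0.
Proof.
move=> u0; apply: l2_ext => n; rewrite l2_0; apply: dotp_eq0.
by rewrite -[X in dotp _ X]/(l2pr n u) -dotp_l2in_l u0.
Qed.

(** The amplification of x to l2(nat, H), acting coordinatewise. The default 0 is taken only where
    the image sequence is not square summable, which cannot happen for bounded x. *)
Definition hat H K (x : H -> K) (u : l2n H) : l2n K :=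
  xget 0 [set v : l2n K | forall k, v k = x (u k)].

Lemma hatE H K (x : H -> K) u k : bop x -> hat x u k = x (u k).
Proof.
move=> [_ [c c0 xc]]; rewrite /hat; case: xgetP => [v _ -> //|].
have xu : (fun k => x (u k)) \in @l2_seq R K.
  apply/asboolP; exists (c * l2sq u) => n.
  apply: (@le_trans _ _ (c * psum u n)); last by rewrite ler_wpM2l ?psum_le.
  by rewrite /psum mulr_sumr; apply: ler_sum => i _; exact: xc.
by move/(_ (L2n xu)) => /(_ (fun=> erefl)).
Qed.

Lemma hat_bop H K (x : H -> K) : bop x -> bop (hat x).
Proof.
move=> xb; split=> [a u v|].
  by apply: l2_ext => k; rewrite l2D l2Z !hatE // l2D l2Z bopD // bopZ.
have [_ [c c0 xc]] := xb; exists c => // v; rewrite !sqn_l2; apply: l2sq_le => n.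
apply: (@le_trans _ _ (c * psum v n)); last by rewrite ler_wpM2l ?psum_le.
by rewrite /psum mulr_sumr; apply: ler_sum => k _; rewrite hatE.
Qed.

Lemma hat_adj H K (x : H -> K) u v : bop x -> dotp (hat x u) v = dotp u (hat (hadj x) v).
Proof.
move=> xb; have yb := hadj_bop xb; apply: ccvg_unique (dotp_l2 _ _) _.
have -> : dsum (hat x u) v = dsum u (hat (hadj x) v); last exact: dotp_l2.
by apply/funext => n; apply: eq_bigr => k _; rewrite !hatE // hadjP.
Qed.

Lemma hat_comp H K E (y : K -> E) (x : H -> K) u : bop y -> bop x ->
  hat (y \o x) u = hat y (hat x u).
Proof.
by move=> yb xb; apply: l2_ext => k; rewrite !hatE //=; exact: bop_comp.
Qed.

Lemma hat_id H (u : l2n H) : hat idfun u = u.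
Proof. by apply: l2_ext => k; rewrite hatE //; exact: bop_id. Qed.

Lemma hat_lin H K (a : R[i]) (x y : H -> K) u : bop x -> bop y ->
  hat (a *: x + y) u = a *: hat x u + hat y u.
Proof.
move=> xb yb; apply: l2_ext => k; rewrite l2D l2Z !hatE //; exact: bop_lin.
Qed.

Lemma hat_in H K (x : H -> K) n h : bop x -> hat x (l2in n h) = l2in n (x h).
Proof. by move=> xb; apply: l2_ext => k; rewrite hatE // !l2inE; case: ifP => // _; rewrite bop0. Qed.

Lemma square_summable_l2 H (u : nat -> H) : square_summable u <-> u \in @l2_seq R H.
Proof.
have E n : \sum_(k < n) `|u k| ^+ 2 = (\sum_(k < n) sqn (u k))%:C :> R[i].
  by rewrite rmorph_sum; apply: eq_bigr => k _; exact: esym (sqn_norm _).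
split=> [[c uc]|/asboolP[c uc]]; last by exists c%:C => n; rewrite E lecR.
apply/asboolP; exists (complex.Re c) => n.
by have := uc n; rewrite E lecE => /andP[].
Qed.

Lemma uw_functional_hat H (u v : l2n H) :
  ultraweak_functional (fun x : H -> H => dotp (hat x u) v).
Proof.
exists u, v; split; try exact/square_summable_l2/l2funP.
move=> x /bopE xb; apply: ccvg_cvg; have := dotp_l2 (hat x u) v.
congr (ccvg _ _); apply/funext => n; rewrite /dsum /series /= big_mkord.
by apply: eq_bigr => k _; rewrite hatE.
Qed.

(** With [uw_functional_hat] this shows that, on bounded operators, ultraweak functionals are
    exactly the coefficients x |-> <hat x u, v>. Normality is handled in this form from here on. *)
Lemma uw_functionalP H (w : (H -> H) -> R[i]^o) : ultraweak_functional w ->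
  exists u v : l2n H, forall x, bop x -> w x = dotp (hat x u) v.
Proof.
move=> [u [v [/square_summable_l2 ul /square_summable_l2 vl wP]]].
exists (L2n ul), (L2n vl) => x xb.
have h1 := wP x (proj2 (bopE x) xb).
have h2 : series (fun n => dotp (x (u n)) (v n) : R[i]^o) @ \oo -->
    (dotp (hat x (L2n ul)) (L2n vl) : R[i]^o).
  apply: ccvg_cvg; have := dotp_l2 (hat x (L2n ul)) (L2n vl).
  congr (ccvg _ _); apply/funext => n; rewrite /dsum /series /= big_mkord.
  by apply: eq_bigr => k _; rewrite hatE.
by apply: cvg_unique h1 h2.
Qed.

Lemma uw_vector H (h h' : H) : ultraweak_functional (fun x : H -> H => dotp (x h) h').
Proof.
have [u [v [us vs wP]]] := uw_functional_hat (l2in 0 h) (l2in 0 h').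
exists u, v; split; [exact: us | exact: vs | move=> x xb].
have E : dotp (hat x (l2in 0 h)) (l2in 0 h') = dotp (x h) h'.
  by rewrite hat_in; [exact: dotp_l2in | exact/bopE].
by rewrite -E; exact: wP.
Qed.

End L2Operators.

(** * Commutants and von Neumann algebras *)

Section Commutants.
Context {R : realType} {H : hilbertType R}.
Implicit Types (A S : set (H -> H)) (x y : H -> H).

Lemma adjE x : bop x -> adj x = hadj x.
Proof.
move=> xb; rewrite /adj /the_op; case: xgetP => [y _ [_ yP]|].
  exact: hadj_unique.
move/(_ (hadj x)); case; split; first exact/bopE/hadj_bop.
by move=> v w; exact: hadjP.
Qed.

Local Opaque adj hadj hat.

Lemma adj_bop x : bop x -> bop (adj x).
Proof. by move=> xb; rewrite adjE //; exact: hadj_bop. Qed.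

Lemma adjP x v w : bop x -> dotp (x v) w = dotp v (adj x w).
Proof. by move=> xb; rewrite adjE // hadjP. Qed.

Lemma adjPl x v w : bop x -> dotp w (x v) = dotp (adj x w) v.
Proof. by move=> xb; rewrite adjE // hadjPl. Qed.

Lemma adjK x : bop x -> adj (adj x) = x.
Proof. by move=> xb; rewrite (adjE xb) (adjE (hadj_bop xb)) hadjK. Qed.

Lemma adj_unique x y : bop x -> (forall v w, dotp (x v) w = dotp v (y w)) -> y = adj x.
Proof. by move=> xb yP; rewrite adjE //; exact: hadj_unique. Qed.

Lemma adj_comp x y : bop x -> bop y -> adj (x \o y) = adj y \o adj x.
Proof. by move=> xb yb; rewrite (adjE (bop_comp xb yb)) (adjE xb) (adjE yb) hadj_comp. Qed.

Lemma adj_id : adj (idfun : H -> H) = idfun.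
Proof. by apply/esym/adj_unique => //; exact: bop_id. Qed.

Lemma adj_lin (a : R[i]) x y : bop x -> bop y ->
  adj (a *: x + y) = Num.conj a *: adj x + adj y.
Proof.
move=> xb yb; apply/esym/adj_unique; first exact: bop_lin.
by move=> v w; rewrite !fctE dotDl dotZl dotDr dotZr conjCK !(adjP _ _ xb) !(adjP _ _ yb).
Qed.

(** Unital and stable under adjoints, but not closed in any topology: the algebras from which
    density arguments start are of this kind. *)
Definition star_algebra A := [/\ A `<=` @bop R H H, A idfun,
  forall (a : R[i]) x y, A x -> A y -> A (a *: x + y),
  forall x y, A x -> A y -> A (x \o y) & forall x, A x -> A (adj x)].

Lemma star_algebra_lin A : star_algebra A -> lin_set A.
Proof.
move=> [_ A1 AL _ _]; split=> //; have := AL (- 1) _ _ A1 A1.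
by rewrite scaleN1r addNr.
Qed.

Lemma commutant_bop S : commutant S `<=` @bop R H H.
Proof. by move=> x [/bopE]. Qed.

Lemma commutantS S S' : S `<=` S' -> commutant S' `<=` commutant S.
Proof. by move=> SS' x [xb xS]; split=> // y /SS'; exact: xS. Qed.

Lemma sub_bicommutant S : S `<=` @bop R H H -> S `<=` bicommutant S.
Proof. by move=> Sb x Sx; split; [exact/bopE/Sb | move=> y [_ ->]]. Qed.

Lemma commutant_bicommutant S : S `<=` @bop R H H ->
  commutant (bicommutant S) = commutant S.
Proof.
move=> Sb; apply/seteqP; split; first exact/commutantS/sub_bicommutant.
by apply: sub_bicommutant; exact: commutant_bop.
Qed.

Lemma bicommutantS S S' : S `<=` S' -> bicommutant S `<=` bicommutant S'.
Proof. by move=> SS'; do 2 apply: commutantS. Qed.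

Lemma bicommutantK S : S `<=` @bop R H H -> bicommutant (bicommutant S) = bicommutant S.
Proof. by move=> Sb; rewrite {1}/bicommutant commutant_bicommutant. Qed.

Lemma commutant_star S : S `<=` @bop R H H -> (forall x, S x -> S (adj x)) ->
  star_algebra (commutant S).
Proof.
move=> Sb Sadj; split.
- exact: commutant_bop.
- by split=> //; exact/bopE/bop_id.
- move=> a x y [/bopE xb xS] [/bopE yb yS]; split; first exact/bopE/bop_lin.
  move=> z Sz; have zb := Sb _ Sz; apply/funext => v; rewrite /= !fctE.
  have := congr1 (@^~ v) (xS _ Sz); have := congr1 (@^~ v) (yS _ Sz).
  by rewrite /= => -> ->; rewrite bopD // bopZ.
- move=> x y [/bopE xb xS] [/bopE yb yS]; split; first exact/bopE/bop_comp.
  by move=> z Sz; rewrite -compA yS // compA xS.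
- move=> x [/bopE xb xS]; split; first exact/bopE/adj_bop.
  move=> z Sz; have zb := Sb _ Sz; have := xS _ (Sadj _ Sz).
  move/(congr1 (@adj R H)); by rewrite (adj_comp xb (adj_bop zb)) (adj_comp (adj_bop zb) xb) (adjK zb).
Qed.

Lemma bicommutant_vN S : S `<=` @bop R H H -> (forall x, S x -> S (adj x)) ->
  von_neumann_algebra (bicommutant S).
Proof.
move=> Sb Sadj; split; last exact: bicommutantK.
  by move=> x /commutant_bop/bopE.
have [_ _ _ _ cadj] := commutant_star Sb Sadj.
by have [_ _ _ _] := commutant_star (@commutant_bop S) cadj.
Qed.

Lemma vN_bop A : von_neumann_algebra A -> A `<=` @bop R H H.
Proof. by move=> [Ab _ _] x /Ab/bopE. Qed.

Lemma vN_star A : von_neumann_algebra A -> star_algebra A.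
Proof.
move=> AN; have Ab := vN_bop AN; have [_ Aadj <-] := AN.
have [_ _ _ _ cadj] := commutant_star Ab Aadj.
exact: commutant_star (@commutant_bop A) cadj.
Qed.

End Commutants.

Local Opaque adj hadj hat.

(** * Density of a *-algebra in its bicommutant *)

Section Density.
Context {R : realType} {H : hilbertType R}.
Implicit Types (A S : set (H -> H)) (x y : H -> H) (u v : l2n H).

Lemma l2in_sep : sep [set w : l2n H | exists n h, w = l2in n h].
Proof.
by move=> d dP; apply: l2_in_total => n h; apply: dP; exists n, h.
Qed.

(* The projection onto the closure of {hat a u | a in A} has matrix entries in
   the commutant of A. *)
Lemma density A u v : star_algebra A -> (forall a, A a -> dotp (hat a u) v = 0) ->
  forall x, bicommutant A x -> dotp (hat x u) v = 0.
Proof.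
move=> AA; have [Ab A1 AL AM Aadj] := AA => uv x [/bopE xb xA].
pose D := [set hat a u | a in A].
have DL : lin_set D.
  have [A0 _] := star_algebra_lin AA.
  split; first by exists 0 => //; apply: l2_ext => k; rewrite hatE //; exact: bop_0.
  move=> a _ _ [y Ay <-] [z Az <-]; exists (a *: y + z); first exact: AL.
  by rewrite hat_lin //; exact: Ab.
have [P [Pb PP]] := proj_ex DL.
have Dhat a : A a -> forall w, D w -> D (hat a w).
  move=> Aa _ [y Ay <-]; exists (a \o y); first exact: AM.
  by rewrite hat_comp //; exact: Ab.
have pD a : A a -> forall w, perp D w -> perp D (hat a w).
  move=> Aa w Dw d Dd; have ab := Ab _ Aa.
  rewrite dotC hat_adj // -adjE // -dotC Dw //; apply: Dhat => //; exact: Aadj.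
have ppD a : A a -> forall w, perp (perp D) w -> perp (perp D) (hat a w).
  move=> Aa w Dw d Dd; have ab := Ab _ Aa.
  rewrite dotC hat_adj // -adjE // -dotC Dw //; apply: pD => //; exact: Aadj.
have Pa a w : A a -> P (hat a w) = hat a (P w).
  move=> Aa; have [w1 w2] := PP w; have hb := hat_bop (Ab _ Aa).
  apply: (proj_unique PP (ppD _ Aa _ w1) (pD _ Aa _ w2)).
  by rewrite -bopD // addrC subrK.
have Pnm n m : commutant A (@l2pr R H n \o P \o @l2in R H m).
  have lb := @l2in_bop R H m; have rb := @l2pr_bop R H n.
  split; first by apply/bopE; do 2 apply: bop_comp => //.
  move=> a Aa; have ab := Ab _ Aa; apply/funext => h /=.
  by rewrite -hat_in // Pa // /l2pr hatE.
(* x commutes with all matrix entries of P, so its amplification commutes with P and preserves the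
   closure of D, to which u belongs. *)
have xP : hat x \o P = P \o hat x.
  have hb := hat_bop xb.
  apply: (bop_ext _ _ l2in_sep); try exact: bop_comp.
  move=> _ [m [h ->]]; apply: l2_ext => n /=; rewrite hatE // hat_in //.
  exact: (congr1 (@^~ h) (xA _ (Pnm n m))).
have Du : D u by exists idfun => //; exact: hat_id.
have Pu : P u = u.
  apply: (proj_unique PP (b := 0)) => //; last by rewrite addr0.
    by move=> d Dd; rewrite dotC Dd // rmorph0.
  by have [] := perp_lin_set D.
rewrite -Pu -[hat x (P u)]/((hat x \o P) u) xP /=.
have [h _] := PP (hat x u); rewrite dotC h ?rmorph0 //.
by move=> _ [a Aa <-]; exact: uv.
Qed.

(** Interleaving makes the sum <hat x u, u'> + <hat x v, v'> a single coefficient, so that these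
    functionals form a linear space. *)
Definition shuffle u v (k : nat) : H := if odd k then v k./2 else u k./2.

Lemma big_shuffle (V : nmodType) (F : H -> H -> V) u v u' v' n :
  \sum_(k < n.*2) F (shuffle u v k) (shuffle u' v' k) =
  \sum_(k < n) F (u k) (u' k) + \sum_(k < n) F (v k) (v' k).
Proof.
elim: n => [|n IH]; first by rewrite !big_ord0 addr0.
rewrite doubleS !big_ord_recr /= IH /shuffle /= odd_double /= uphalf_double doubleK.
by rewrite -addrA addrACA.
Qed.

Lemma shuffle_l2 u v : shuffle u v \in @l2_seq R H.
Proof.
apply/asboolP; exists (l2sq u + l2sq v) => n.
apply: (@le_trans _ _ (\sum_(k < n.*2) sqn (shuffle u v k))).
  rewrite -addnn big_split_ord /= lerDl; apply: sumr_ge0 => k _; exact: sqn_ge0.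
rewrite (@big_shuffle _ (fun h _ => sqn h) u v u v).
by apply: lerD; exact: psum_le.
Qed.

Lemma hat_shuffle u v u' v' x : bop x ->
  dotp (hat x (L2n (shuffle_l2 u v))) (L2n (shuffle_l2 u' v')) =
  dotp (hat x u) u' + dotp (hat x v) v'.
Proof.
move=> xb; set U := L2n _; set V := L2n _.
have c1 := dotp_l2 (hat x U) V.
(* Partial sums over an even range split exactly into the two given partial sums, and the limit may
   be taken along even indices. *)
have c2 : ccvg (fun n => dsum (hat x U) V n.*2) (dotp (hat x U) V).
  have d2 : (fun n => n.*2) @ \oo --> \oo.
    move=> B [N _ NB]; exists N => // n /= Nn; apply: NB => /=.
    by rewrite -addnn (leq_trans Nn) ?leq_addr.
  have [r i] := c1; by split; [exact: (cvg_comp _ _ d2 r) | exact: (cvg_comp _ _ d2 i)].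
apply: ccvg_unique c2 _.
have -> : (fun n => dsum (hat x U) V n.*2) =
    (fun n => dsum (hat x u) u' n + dsum (hat x v) v' n).
  apply/funext => n; rewrite /dsum.
  under eq_bigr do rewrite hatE //.
  rewrite (@big_shuffle _ (fun h h' => dotp (x h) h') u v u' v').
  by congr (_ + _); apply: eq_bigr => k _; rewrite hatE.
by apply: ccvgD; exact: dotp_l2.
Qed.

End Density.

(** * Spans and common kernels of linear functionals *)

Section LinearFunctionals.
Context {R : realType} {V : lmodType R[i]}.
Implicit Types (A : set V) (f : V -> R[i]).

Definition lin_on A f :=
  forall (a : R[i]) (x y : V), A x -> A y -> f (a *: x + y) = a * f x + f y.

Lemma lin_on0 A f : lin_set A -> lin_on A f -> f 0 = 0.
Proof.
move=> [A0 _] fL; have := fL 1 _ _ A0 A0; rewrite scale1r addr0 mul1r => /eqP.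
by rewrite -subr_eq subrr eq_sym => /eqP.
Qed.

(** An intersection rather than a set of finite sums, so that [lin_span_min] is the induction
    principle. *)
Definition lin_span (S : set V) : set V :=
  [set x | forall W : set V, lin_set W -> S `<=` W -> W x].

Lemma sub_lin_span S : S `<=` lin_span S.
Proof. by move=> x Sx W _; apply. Qed.

Lemma lin_span_min S W : lin_set W -> S `<=` W -> lin_span S `<=` W.
Proof. by move=> WL SW x; apply. Qed.

Lemma lin_span_lin S : lin_set (lin_span S).
Proof.
split; first by move=> W [].
by move=> a x y xS yS W WL SW; apply: WL.2; [exact: xS|exact: yS].
Qed.

(** If w n is nonzero at some b in A, pass to its kernel in A and correct the functional found there
    by the multiple of w n that matches f at b. The class W is abstract so that callers can carry
    further conditions along. *)
Lemma ker_comb (W : set (V -> R[i])) (n : nat) :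
  W (fun=> 0) -> (forall (a : R[i]) w w', W w -> W w' -> W (fun x => a * w x + w' x)) ->
  forall A (w : nat -> V -> R[i]) f, lin_set A -> (forall w, W w -> lin_on A w) ->
  (forall i, (i < n)%N -> W (w i)) -> lin_on A f ->
  (forall x, A x -> (forall i, (i < n)%N -> w i x = 0) -> f x = 0) ->
  exists2 g, W g & forall x, A x -> f x = g x.
Proof.
move=> W0 WD; elim: n => [|n IH] A w f AL WL wW fL fw.
  by exists (fun=> 0) => // x Ax; exact: fw.
have Wn := wW n (ltnSn n); have nL := WL _ Wn; have [A0 AD] := AL.
have [[b [Ab wb]]|nb] := pselect (exists b, A b /\ w n b <> 0); last first.
  apply: (IH A w f) => // [i ni|x Ax wx]; first exact: wW (ltnW ni).
  apply: fw => // i; rewrite ltnS leq_eqVlt => /predU1P[->|]; last exact: wx.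
  by apply: contrapT => h; apply: nb; exists x.
pose A1 := [set x | A x /\ w n x = 0].
have A1L : lin_set A1.
  split; first by split=> //; exact: lin_on0 nL.
  move=> a x y [Ax x0] [Ay y0]; split; first exact: AD.
  by rewrite nL // x0 y0 mulr0 addr0.
have [g Wg gE] : exists2 g, W g & forall x, A1 x -> f x = g x.
  apply: (IH A1 w f) => //.
  - by move=> h /WL hL a x y [Ax _] [Ay _]; exact: hL.
  - by move=> i ni; exact: wW (ltnW ni).
  - by move=> a x y [Ax _] [Ay _]; exact: fL.
  - move=> x [Ax xn] xw; apply: fw => // i; rewrite ltnS leq_eqVlt => /predU1P[->|] //.
    exact: xw.
exists (fun x => (f b - g b) / w n b * w n x + g x); first exact: WD.
move=> x Ax; pose t := - (w n x / w n b); have gL := WL _ Wg.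
have /gE : A1 (t *: b + x).
  split; first exact: AD.
  by rewrite nL // /t mulNr divfK ?addNr //; exact/eqP.
rewrite gL // fL // /t !mulNr => h.
have -> : f x = w n x / w n b * f b + (- (w n x / w n b * f b) + f x) by ring.
by rewrite h; field; exact/eqP.
Qed.

End LinearFunctionals.

(** * Exact density and normal functionals *)

Section Normality.
Context {R : realType} {H : hilbertType R}.
Implicit Types (A S : set (H -> H)) (x y : H -> H).

Lemma hat_lin_on A u v : A `<=` @bop R H H ->
  lin_on (V := H -> H) A (fun x => dotp (hat x u) v).
Proof.
move=> Ab a x y /Ab xb /Ab yb.
by rewrite (hat_lin _ _ xb yb) dotDl dotZl.
Qed.

(** The filter is generated by the sets of a in A agreeing exactly with x on finitely many
    coefficients. An ultraweak functional is one coefficient, so it is eventually constant along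
    this filter. *)
Lemma uw_filter A x : A `<=` @bop R H H -> bop x ->
  (forall n (u v : nat -> l2n H), exists2 a, A a &
     forall i, (i < n)%N -> dotp (hat a (u i)) (v i) = dotp (hat x (u i)) (v i)) ->
  exists F : set_system (H -> H), [/\ ProperFilter F, F A & ultraweak_cvg F x].
Proof.
move=> Ab xb Ax.
pose B n (u v : nat -> l2n H) := [set a | A a /\
  forall i, (i < n)%N -> dotp (hat a (u i)) (v i) = dotp (hat x (u i)) (v i)].
pose F : set_system (H -> H) := [set C | exists n u v, B n u v `<=` C].
exists F; split.
- apply: Build_ProperFilter_ex.
    move=> C [n [u [v BC]]]; have [a Aa ax] := Ax n u v.
    by exists a; apply: BC.
  split.
  + by exists 0%N, (fun=> 0), (fun=> 0).
  + move=> C D [n [u [v BC]]] [m [u' [v' BD]]].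
    exists (n + m)%N, (fun i => if (i < n)%N then u i else u' (i - n)%N),
      (fun i => if (i < n)%N then v i else v' (i - n)%N).
    move=> a [Aa ai]; split; [apply: BC|apply: BD]; split=> // i ni.
      by have := ai i (ltn_addr m ni); rewrite ni.
    have := ai (n + i)%N; rewrite ltn_add2l ni ltnNge leq_addr /= addKn; exact.
  + by move=> C D CD [n [u [v BC]]]; exists n, u, v; apply: subset_trans CD.
- by exists 0%N, (fun=> 0), (fun=> 0) => a [].
- move=> w /uw_functionalP[u [v wE]] C /= wC.
  exists 1%N, (fun=> u), (fun=> v) => a [Aa /(_ 0%N (ltnSn 0)) ax] /=.
  rewrite wE; last exact: Ab.
  by rewrite ax -wE //; exact: nbhs_singleton.
Qed.

Lemma shuffle_comb A u v u' v' (a : R[i]) : exists u'' v'', forall x, bop x ->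
  dotp (hat x u'') v'' = a * dotp (hat x u) v + dotp (hat x u') v'.
Proof.
exists (L2n (shuffle_l2 (a *: u) u')), (L2n (shuffle_l2 v v')) => x xb.
by rewrite hat_shuffle // (bopZ (hat_bop xb)) dotZl.
Qed.

(** Let a be correct for the first n coefficients. Either some b in A changes the last one without
    disturbing these, or by [ker_comb] the last one is, on A, a combination of the others, and
    [density] extends this relation to x. *)
Lemma density_exact A x : star_algebra A -> bicommutant A x ->
  forall n (u v : nat -> l2n H), exists2 a, A a &
   forall i, (i < n)%N -> dotp (hat a (u i)) (v i) = dotp (hat x (u i)) (v i).
Proof.
move=> AA xA n u v; have [Ab A1 AL AM Aadj] := AA; have xb := commutant_bop xA.
have AV := star_algebra_lin AA; have [A0 _] := AV.
have hL (i : nat) : lin_on (V := H -> H) A (fun y => dotp (hat y (u i)) (v i)).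
  exact: hat_lin_on.
elim: n => [|n [a Aa an]]; first by exists idfun.
have [[b [Ab' bi bn]]|nb] := pselect (exists b, [/\ A b,
    forall i, (i < n)%N -> dotp (hat b (u i)) (v i) = 0 & dotp (hat b (u n)) (v n) <> 0]).
  pose t := (dotp (hat x (u n)) (v n) - dotp (hat a (u n)) (v n)) / dotp (hat b (u n)) (v n).
  exists (t *: b + a) => [|i]; first exact: AL.
  rewrite (hL i) // ltnS leq_eqVlt => /predU1P[->|ni].
    by rewrite divfK ?subrK //; exact/eqP.
  by rewrite bi // mulr0 add0r an.
exists a => // i; rewrite ltnS leq_eqVlt => /predU1P[->|]; last exact: an.
(* The condition w x = w a survives linear combinations, so the functional returned by [ker_comb]
   agrees at x and a, and with it the last coefficient. *)
pose W : set ((H -> H) -> R[i]) := [set w | w x = w a /\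
  exists u v, forall y, bop y -> w y = dotp (hat y u) v].
have [|||||||g [gx [u' [v' gE]]] g'] := @ker_comb R (H -> H) W n _ _ A
    (fun i y => dotp (hat y (u i)) (v i)) (fun y => dotp (hat y (u n)) (v n)).
- by split=> //; exists 0, 0 => y yb; rewrite dot0r.
- move=> c w w' [wx [u1 [v1 w1]]] [wx' [u2 [v2 w2]]]; split; first by rewrite wx wx'.
  have [u3 [v3 E]] := shuffle_comb A u1 v1 u2 v2 c; exists u3, v3 => y yb.
  by rewrite E // w1 // w2.
- exact: AV.
- move=> w [_ [u1 [v1 w1]]] c y z Ay Az.
  have yb := Ab _ Ay; have zb := Ab _ Az.
  rewrite !w1 //; first exact: (hat_lin_on u1 v1 Ab).
  exact: bop_lin.
- by move=> j jn; split; [rewrite an | exists (u j), (v j)].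
- exact: hL.
- move=> y Ay yi; apply: contrapT => h; apply: nb; exists y; split=> //.
have ab := Ab _ Aa.
have [u3 [v3 E]] := shuffle_comb A u' v' (u n) (v n) (- 1).
have : dotp (hat x u3) v3 = 0.
  apply: (density AA) xA => y Ay; rewrite E; last exact: Ab.
  by rewrite -gE; [rewrite -g' // mulN1r addNr | exact: Ab].
rewrite E // -gE // gx -(g' a) // mulN1r => /eqP.
by rewrite addrC subr_eq0 eq_sym => /eqP.
Qed.

Lemma density_filter A x : star_algebra A -> bicommutant A x ->
  exists F : set_system (H -> H), [/\ ProperFilter F, F A & ultraweak_cvg F x].
Proof.
move=> AA xA; apply: uw_filter; [by case: AA | exact: commutant_bop xA|].
by move=> n u v; exact: density_exact.
Qed.

(* Normality is only used through this principle. *)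
Lemma normal_zero A S (f : (H -> H) -> R[i]^o) : star_algebra A -> A `<=` S ->
  normal_functional S f -> (forall a, A a -> f a = 0) ->
  forall x, bicommutant A x -> S x -> f x = 0.
Proof.
move=> AA AS fN fA x xA Sx; have [F [FF FA Fx]] := density_filter AA xA.
have FS : F S by apply: filterS FA.
have h1 := fN F x FF FS Sx Fx.
have h2 : f @ F --> (0 : R[i]^o).
  by apply: cvg_near_cst; apply: filterS FA => a /fA.
by apply: cvg_unique h1 h2.
Qed.

(** If f vanishes on the common kernel in A of finitely many coefficients, it is a combination of
    them. Otherwise every such kernel contains an element with f = 1; these generate a filter
    tending ultraweakly to 0, against normality. *)
Lemma normal_functional_hat A (f : (H -> H) -> R[i]^o) :
  A `<=` @bop R H H -> lin_set (V := H -> H) A -> lin_on (V := H -> H) A f ->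
  normal_functional A f ->
  exists u v, forall x, A x -> f x = dotp (hat x u) v.
Proof.
move=> Ab AL fL fN; have [A0 AD] := AL; have f0 := lin_on0 AL fL.
have [[n [u [v H1]]]|nex] := pselect (exists n (u v : nat -> l2n H), forall x, A x ->
    (forall i, (i < n)%N -> dotp (hat x (u i)) (v i) = 0) -> f x = 0).
  pose W : set ((H -> H) -> R[i]) :=
    [set w | exists u v, forall y, bop y -> w y = dotp (hat y u) v].
  have [|||||||g [u' [v' gE]] g'] := @ker_comb R (H -> H) W n _ _ A
    (fun i y => dotp (hat y (u i)) (v i)) f; last first.
  - by exists u', v' => x Ax; rewrite g' // gE //; exact: Ab.
  - exact: H1.
  - exact: fL.
  - by move=> j jn; exists (u j), (v j).
  - move=> w [u1 [v1 w1]] c y z Ay Az.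
    have yb := Ab _ Ay; have zb := Ab _ Az.
    rewrite !w1 //; first exact: (hat_lin_on u1 v1 Ab).
    exact: bop_lin.
  - exact: AL.
  - move=> c w w' [u1 [v1 w1]] [u2 [v2 w2]].
    have [u3 [v3 E]] := shuffle_comb A u1 v1 u2 v2 c; exists u3, v3 => y yb.
    by rewrite E // w1 // w2.
  - by exists 0, 0 => y yb; rewrite dot0r.
exfalso; pose C := [set x | A x /\ f x = 1].
have Cb : C `<=` @bop R H H by move=> x [/Ab].
have [||F [FF FC F0]] := @uw_filter C 0 Cb.
- exact: bop_0.
- move=> n u v; apply: contrapT => h; apply: nex; exists n, u, v => x Ax xi.
  apply: contrapT => /eqP fx; apply: h; exists ((f x)^-1 *: x).
    have := AD (f x)^-1 _ _ Ax A0; rewrite addr0 => Ax'; split=> //.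
    by have := fL (f x)^-1 _ _ Ax A0; rewrite addr0 f0 addr0 mulVf.
  move=> i ni; have := hat_lin_on (u i) (v i) Ab (f x)^-1 Ax A0.
  by rewrite addr0 xi // mulr0 add0r.
have FA : F A by apply: filterS FC => x [].
have h1 := fN F 0 FF FA A0 F0.
have h2 : f @ F --> (1 : R[i]^o).
  by apply: cvg_near_cst; apply: filterS FC => a [_ ->].
have : f 0 = 1 by apply: cvg_unique h1 h2.
rewrite f0 => /eqP; rewrite eq_sym; exact/negP/oner_neq0.
Qed.

Lemma normal_functionalB A (f g : (H -> H) -> R[i]^o) : normal_functional A f ->
  normal_functional A g -> normal_functional A (fun x => f x - g x : R[i]^o).
Proof.
move=> fN gN F x FF FA Ax Fx.
exact: cvgB (fN F x FF FA Ax Fx) (gN F x FF FA Ax Fx).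
Qed.

Lemma normal_functionalS A S (f : (H -> H) -> R[i]^o) : A `<=` S ->
  normal_functional S f -> normal_functional A f.
Proof. by move=> AS fN F x FF FA /AS; apply: fN => //; exact: filterS FA. Qed.

Lemma normal_map_vector (K : hilbertType R) A (f : (H -> H) -> (K -> K)) k k' :
  normal_map A f -> normal_functional A (fun x => dotp (f x k) k' : R[i]^o).
Proof.
move=> fN F x FF FA Ax Fx; have := fN F x FF FA Ax Fx _ (uw_vector k k').
exact.
Qed.

Lemma normal_map_hat (K : hilbertType R) A (f : (H -> H) -> (K -> K)) (u v : l2n K) :
  normal_map A f -> normal_functional A (fun x => dotp (hat (f x) u) v : R[i]^o).
Proof.
move=> fN F x FF FA Ax Fx; have := fN F x FF FA Ax Fx _ (uw_functional_hat u v).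
exact.
Qed.

End Normality.

(** * Bounded extension along a family of maps *)

(** Amounts to B^(1/2^j) -> 1, done by Bernoulli: if X / k = 1 + d with d > 0, then 1 + 2^j d <= B
    for all j, which fails once j > B / d. *)
Lemma power_growth (R : realType) (X k B : R) : 0 <= X -> 0 <= k ->
  (forall j, X ^+ (2 ^ j) <= B * k ^+ (2 ^ j)) -> X <= k.
Proof.
move=> X0 k0 XB; rewrite leNgt; apply/negP => kX.
have Xp : 0 < X by apply: le_lt_trans kX.
have [kz|kn] := eqVneq k 0.
  by have := XB 0%N; rewrite kz !expr1 mulr0 leNgt Xp.
have kp : 0 < k by rewrite lt_def kn.
pose d := X / k - 1; have d0 : 0 < d by rewrite subr_gt0 ltr_pdivlMr // mul1r.
have XE : X / k = 1 + d by rewrite /d addrC subrK.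
have bern n : 1 + n%:R * d <= (X / k) ^+ n.
  elim: n => [|n IH]; first by rewrite expr0 mul0r addr0.
  rewrite exprS; apply: (@le_trans _ _ ((1 + d) * (1 + n%:R * d))).
    rewrite -natr1; have : 0 <= n%:R * d * d by rewrite !mulr_ge0 // ltW.
    by move: (n%:R) => m h; lra.
  by rewrite XE in IH *; rewrite ler_wpM2l // addr_ge0 // ltW.
pose j := (Num.trunc (B / d)).+1; have := XB j.
rewrite -ler_pdivrMr ?exprn_gt0 // -expr_div_n => XkB.
have := le_trans (bern (2 ^ j)%N) XkB; rewrite leNgt => /negP; apply.
apply: (@lt_le_trans _ _ (j%:R * d)); first by rewrite -ltr_pdivrMr // truncnS_gt.
apply: (@le_trans _ _ ((2 ^ j)%N%:R * d)); last by rewrite lerDr.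
by rewrite ler_pM2r // ler_nat ltnW // ltn_expl.
Qed.

(** b is meant to be a moment sequence m |-> <w^m v, v> with w symmetric. After division by b 0 it
    satisfies X(m)^2 <= X(2m); along powers of 2 this gives (X(1)^2)^(2^j) <= X(2^(j+1)) <= (B / b
    0) k^(2^j), and [power_growth] removes the constant. *)
Lemma log_convex_le (R : realType) (b : nat -> R) (k B : R) :
  0 <= k -> 0 <= b 0%N -> (forall m, b m ^+ 2 <= b 0%N * b (m + m)%N) ->
  (forall m, b (m + m)%N <= B * k ^+ m) -> b 1%N ^+ 2 <= k * b 0%N ^+ 2.
Proof.
move=> k0 b0 bb bB; have [bz|bn] := eqVneq (b 0%N) 0.
  by have := bb 1%N; rewrite bz mul0r expr0n /= mulr0.
have bp : 0 < b 0%N by rewrite lt_def bn.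
rewrite -ler_pdivrMr ?exprn_gt0 // -expr_div_n.
pose X m := b m / b 0%N.
have XX m : X m ^+ 2 <= X (m + m)%N.
  rewrite /X expr_div_n ler_pdivrMr ?exprn_gt0 // [b 0%N ^+ 2]expr2 mulrA divfK //.
  by rewrite mulrC.
have key j : (X 1%N ^+ 2) ^+ (2 ^ j) <= X (2 ^ j.+1)%N.
  elim: j => [|j IH]; first by rewrite expr1; exact: XX 1%N.
  rewrite expnS mulnC exprM; apply: (@le_trans _ _ (X (2 ^ j.+1)%N ^+ 2)).
    have p0 : 0 <= (X 1%N ^+ 2) ^+ (2 ^ j) by apply: exprn_ge0; exact: sqr_ge0.
    by rewrite ler_pXn2r ?nnegrE //; exact: le_trans IH.
  by rewrite (expnS 2 j.+1) mul2n -addnn; exact: XX.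
apply: (@power_growth _ _ _ (B / b 0%N)) => // [|j]; first exact: sqr_ge0.
apply: le_trans (key j) _; rewrite /X expnS.
by rewrite mulrAC ler_pM2r ?invr_gt0 // mul2n -addnn; exact: bB.
Qed.

Section CommutingExtension.
Context {R : realType} {I : eqType}.
Implicit Types H K : hilbertType R.

(** The value of a formal sum of pairs (i, h). Formal sums are kept because a vector may be such a
    sum in many ways. *)
Definition fsum H K (J : I -> H -> K) (s : seq (I * H)) : K := \sum_(p <- s) J p.1 p.2.

Definition fmap (H H' : Type) (f : H -> H') (s : seq (I * H)) := [seq (p.1, f p.2) | p <- s].

Definition fin (H : eqType) (S : set I) (s : seq (I * H)) := forall p, p \in s -> S p.1.

(* The inequality |sum J'_i x h_i|^2 <= c |sum J_i h_i|^2 is obtained by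
   iterating the Cauchy-Schwarz inequality. *)
Lemma commuting_ext H K H' K' (S : set I) (J : I -> H -> K) (J' : I -> H' -> K')
    (x : H -> H') (y : H' -> H) :
  (forall i, S i -> bop (J i)) -> (forall i, S i -> bop (J' i)) -> bop x -> bop y ->
  (forall i j h h', S i -> S j ->
     dotp (J' i (x h)) (J' j h') = dotp (J i h) (J j (y h'))) ->
  exists z : K -> K', bop z /\ forall i h, S i -> z (J i h) = J' i (x h).
Proof.
move=> JB JB' xb yb xy.
have fmapS (F F' : eqType) (f : F -> F') s : fin S s -> fin S (fmap f s).
  by move=> sS _ /mapP[p ps ->] /=; exact: sS.
(* w stands in for x^* x with respect to the form <J_i h, J_j h'>: it is symmetric for this form,
   and [b m] below is its m-th moment at the formal sum s. *)
pose w := y \o x; have wb : bop w by exact: bop_comp.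
have ww h h' i j : S i -> S j -> dotp (J i (w h)) (J j h') = dotp (J i h) (J j (w h')).
  by move=> Si Sj; rewrite dotC /w /= -!xy // -dotC.
have [_ [k k0 wk]] := wb.
have main s : fin S s -> sqn (fsum J' (fmap x s)) <= Num.sqrt k * sqn (fsum J s).
  move=> sS; pose b m := complex.Re (dotp (fsum J (fmap (iter m w) s)) (fsum J s)).
  have fmap_comp f g t : fmap f (fmap g t) = fmap (f \o g) t :> seq (I * H).
    by rewrite /fmap -map_comp.
  have fmap_id (t : seq (I * H)) : fmap id t = t.
    by rewrite /fmap -[RHS]map_id; apply: eq_map; case.
  have swap t t' : fin S t -> fin S t' ->
      dotp (fsum J (fmap w t)) (fsum J t') = dotp (fsum J t) (fsum J (fmap w t')).
    move=> tS t'S; rewrite /fsum !big_map !dot_suml /=.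
    apply: eq_big_seq => p ps; rewrite !dot_sumr; apply: eq_big_seq => q qs /=.
    by apply: ww; [exact: tS|exact: t'S].
  have bD m n : b (m + n)%N =
      complex.Re (dotp (fsum J (fmap (iter m w) s)) (fsum J (fmap (iter n w) s))).
    elim: n m => [|n IH] m; first by rewrite addn0 fmap_id.
    rewrite addnS -addSn IH; congr (complex.Re _).
    have E i : fmap (iter i.+1 w) s = fmap w (fmap (iter i w) s) by rewrite fmap_comp.
    by rewrite !E swap //; exact: fmapS.
  have b0 : b 0%N = sqn (fsum J s) by rewrite /b fmap_id.
  have b1 : b 1%N = sqn (fsum J' (fmap x s)).
    rewrite /b /sqn; congr (complex.Re _); rewrite (swap s s) // /fsum !big_map !dot_suml.
    apply: eq_big_seq => p ps; rewrite !dot_sumr; apply: eq_big_seq => q qs /=.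
    by rewrite xy //; exact: sS.
  (* B depends on the formal sum s, the rate k only on w; this is the growth hypothesis of
     [log_convex_le]. *)
  have [B HB] : exists B, forall m, sqn (fsum J (fmap (iter m w) s)) <= B * k ^+ m.
    elim: s sS {b bD b0 b1} => [|p s IH] sS.
      by exists 0 => m; rewrite /fsum big_nil sqn0 mul0r.
    have [q qs|B HB] := IH; first by apply: sS; rewrite in_cons qs orbT.
    have /JB[_ [c c0 pc]] : S p.1 by apply: sS; rewrite mem_head.
    exists (2 * (c * sqn p.2) + 2 * B) => m.
    rewrite /fsum /fmap /= big_cons /=; apply: le_trans (sqnD_le _ _) _.
    have h1 : sqn (J p.1 (iter m w p.2)) <= c * (k ^+ m * sqn p.2).
      apply: le_trans (pc _) _; rewrite ler_wpM2l //.
      elim: m => [|m IHm]; first by rewrite expr0 mul1r.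
      by rewrite iterS exprS -mulrA; apply: le_trans (wk _) _; rewrite ler_wpM2l.
    by have := HB m; rewrite /fsum /fmap; lra.
  have : b 1%N ^+ 2 <= k * b 0%N ^+ 2.
    apply: (@log_convex_le _ b k B) => // [|m|m].
    - by rewrite b0 sqn_ge0.
    - by rewrite bD b0 mulrC; exact: sqrRe_dotp.
    - by rewrite bD; exact: HB.
  rewrite b1 b0 => h; apply: ler_of_sqr.
    by rewrite mulr_ge0 ?sqrtr_ge0 ?sqn_ge0.
  by rewrite exprMn sqr_sqrtr.
pose r : set (K * K') :=
  [set p | exists2 s, fin S s & p = (fsum J s, fsum J' (fmap x s))].
have [||_ [s sS ->]|z [zb zr _]] := @partial_op R K K' r (Num.sqrt k).
- split; first by exists [::] => //; rewrite /fsum !big_nil.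
  move=> a _ _ [s sS ->] [t tS ->]; exists (fmap ( *:%R a) s ++ t).
    by move=> p; rewrite mem_cat => /orP[/(fmapS _ _ _ _ sS)//|/tS].
  congr (_, _); rewrite /fsum /fmap ?map_cat big_cat /= !big_map; congr (_ + _).
    by rewrite scaler_sumr; apply: eq_big_seq => p /sS/JB pb; rewrite /= (bopZ pb).
  rewrite scaler_sumr; apply: eq_big_seq => p /sS/JB' pb.
  by rewrite /= (bopZ xb) (bopZ pb).
- exact: sqrtr_ge0.
- exact: main.
exists z; split=> // i h Si; have := zr (J i h, J' i (x h)); apply.
exists [:: (i, h)]; first by move=> p; rewrite mem_seq1 => /eqP ->.
by rewrite /fsum /= !big_seq1.
Qed.

End CommutingExtension.

(** * Operators determined by Gram matrices *)

Section GramUnitary.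
Context {R : realType}.
Implicit Types E K : hilbertType R.

Definition unitary E K (U : E -> K) :=
  [/\ bop U, U \o hadj U = idfun & hadj U \o U = idfun].

(** Equal Gram matrices give equal norms of corresponding combinations, so the graph spanned by the
    pairs (s i, t i) is bounded by 1. *)
Lemma gram_op E K (I : Type) (s : I -> E) (t : I -> K) :
  (forall i j, dotp (t i) (t j) = dotp (s i) (s j)) ->
  exists V : E -> K, bop V /\ forall i, V (s i) = t i.
Proof.
move=> st; pose sumv (F : hilbertType R) (f : I -> F) (l : seq (R[i] * I)) :=
  \sum_(p <- l) p.1 *: f p.2.
pose r : set (E * K) := [set q | exists l, q = (sumv E s l, sumv K t l)].
have [|||V [Vb Vr _]] := @partial_op R E K r 1.
- split; first by exists [::]; rewrite /sumv !big_nil.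
  move=> a _ _ [l ->] [m ->]; exists ([seq (a * p.1, p.2) | p <- l] ++ m).
  rewrite /sumv !big_cat !big_map /=; congr (_ + _, _ + _); rewrite scaler_sumr.
    by apply: eq_bigr => p _; rewrite scalerA.
  by apply: eq_bigr => p _; rewrite scalerA.
- exact: ler01.
- move=> _ [l ->] /=; rewrite mul1r /sqn /sumv !dot_suml.
  rewrite le_eqVlt; apply/orP; left; apply/eqP; congr (complex.Re _).
  apply: eq_bigr => p _; rewrite !dot_sumr; apply: eq_bigr => q _.
  by rewrite !dotZl !dotZr st.
exists V; split=> // i; have := Vr (s i, t i); apply.
by exists [:: (1, i)]; rewrite /sumv !big_seq1 /= !scale1r.
Qed.

Lemma gram_unitary E K (I : Type) (s : I -> E) (t : I -> K) :
  (forall i j, dotp (t i) (t j) = dotp (s i) (s j)) ->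
  sep (range s) -> sep (range t) ->
  exists U : E -> K, unitary U /\ forall i, U (s i) = t i.
Proof.
move=> st s0 t0; have [V [Vb Vs]] := gram_op st.
have [V' [V'b V't]] := gram_op (fun i j => esym (st i j)).
have VE : hadj V = V'.
  apply: (bop_ext (hadj_bop Vb) V'b t0) => _ [j _ <-].
  apply/eqP; rewrite -subr_eq0; apply/eqP/s0 => _ [i _ <-].
  by rewrite dotBr -hadjP // Vs V't st subrr.
exists V; split=> //; split=> //; rewrite VE.
  by apply: (bop_ext (bop_comp Vb V'b) (bop_id _) t0) => _ [j _ <-] /=; rewrite V't Vs.
by apply: (bop_ext (bop_comp V'b Vb) (bop_id _) s0) => _ [j _ <-] /=; rewrite Vs V't.
Qed.

End GramUnitary.

(** * Intertwiners and quasi-equivalence *)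

Section Intertwiners.
Context {R : realType}.
Implicit Types H K : hilbertType R.

Definition ranges H K (JJ : set (H -> K)) : set K :=
  [set k | exists J h, JJ J /\ k = J h].

Definition intertwiners H K (I : Type) (S : set I) (a : I -> H -> H) (b : I -> K -> K)
    : set (H -> K) :=
  [set J | bop J /\ forall i, S i -> b i \o J = J \o a i].

Section OneSided.
Variables (H K : hilbertType R) (I : Type) (S : set I) (a : I -> H -> H)
  (b : I -> K -> K) (st : I -> I).
Hypothesis aB : forall i, S i -> bop (a i).
Hypothesis bB : forall i, S i -> bop (b i).
Hypothesis aS : forall i, S i -> S (st i) /\ a (st i) = adj (a i).
Hypothesis bS : forall i, S i -> b (st i) = adj (b i).
Let JJ := intertwiners S a b.
Hypothesis JJ_sep : sep (ranges JJ).

Let JJb J : JJ J -> bop J. Proof. by case. Qed.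

Let itw J i h : JJ J -> S i -> b i (J h) = J (a i h).
Proof. by move=> [_ Ji] /Ji E; have := congr1 (@^~ h) E. Qed.

(** [st i] indexes the adjoint of the i-th generator, so the adjoint of the relation at [st i] is
    the relation at i. *)
Lemma hadj_intertwiner J : JJ J -> intertwiners S b a (hadj J).
Proof.
move=> [Jb JJi]; split; first exact: hadj_bop.
move=> i Si; have [Sst aE] := aS Si; have bE := bS Si.
have := congr1 (@hadj R H K) (JJi _ Sst).
have ab := aB Si; have bb := bB Si.
have ast : bop (a (st i)) by rewrite aE; exact: adj_bop.
have bst : bop (b (st i)) by rewrite bE; exact: adj_bop.
rewrite (hadj_comp bst Jb) (hadj_comp Jb ast) -(adjE ast) -(adjE bst) aE bE.
by rewrite (adjK ab) (adjK bb).
Qed.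

Let A := bicommutant (a @` S).
Let B := bicommutant (b @` S).

Let A_star : star_algebra A.
Proof.
apply: commutant_star; first exact: commutant_bop.
have h : a @` S `<=` @bop R H H by move=> _ [i Si <-]; exact: aB.
have [|_ _ _ _] := commutant_star h; last by [].
by move=> _ [i Si <-]; have [? <-] := aS Si; exists (st i).
Qed.

Let Abop x : A x -> bop x. Proof. by move/commutant_bop. Qed.

(** [hadj J2 \o J1] commutes with the generators a i, hence with x in their bicommutant. This is the
    symmetry that [commuting_ext] asks for. *)
Let compat x : A x -> forall J1 J2 h h', JJ J1 -> JJ J2 ->
  dotp (J1 (x h)) (J2 h') = dotp (J1 h) (J2 (adj x h')).
Proof.
move=> Ax J1 J2 h h' j1 j2; have xb := Abop Ax; have b1 := JJb j1; have b2 := JJb j2.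
have [_ i2] := hadj_intertwiner j2.
have c : commutant (a @` S) (hadj J2 \o J1).
  split; first exact/bopE/(bop_comp (hadj_bop b2) b1).
  move=> _ [i Si <-]; apply/funext => v /=; rewrite -(itw _ j1 Si).
  by have := congr1 (@^~ (J1 v)) (i2 _ Si) => /= ->.
have [_ /(_ _ c)/(congr1 (@^~ h)) /= xE] := Ax.
by rewrite !(hadjPl b2) -(adjP _ _ xb) xE.
Qed.

Let Phi_spec x z := bop z /\ forall J h, JJ J -> z (J h) = J (x h).

(** The counterpart of x on K, prescribed on the ranges of all intertwiners; these are total, so it
    is unique. *)
Definition transport (x : H -> H) : K -> K := xget 0 (Phi_spec x).

Lemma transportP x : A x -> bop (transport x) /\
  forall J h, JJ J -> transport x (J h) = J (x h).
Proof.
move=> Ax; have xb := Abop Ax.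
have [z Hz] := @commuting_ext R (H -> K) _ _ _ _ JJ id id _ _ JJb JJb xb (adj_bop xb)
  (fun J1 J2 h h' j1 j2 => compat Ax h h' j1 j2).
by rewrite /transport; case: xgetP => [y _ //|/(_ z)].
Qed.

Let Phib x : A x -> bop (transport x). Proof. by move/transportP => []. Qed.

Lemma transport_unique x z : A x -> bop z -> (forall J h, JJ J -> z (J h) = J (x h)) ->
  z = transport x.
Proof.
move=> Ax zb zJ; have [Pb PJ] := transportP Ax.
by apply: (bop_ext zb Pb JJ_sep) => _ [J [h [j ->]]]; rewrite zJ // PJ.
Qed.

Lemma transport_adj x : A x -> transport (adj x) = adj (transport x).
Proof.
move=> Ax; have [Pb PJ] := transportP Ax; have xb := Abop Ax.
apply/esym/transport_unique; [by case: A_star => _ _ _ _; apply | exact: adj_bop|].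
move=> J h j; apply/eqP; rewrite -subr_eq0; apply/eqP/JJ_sep => _ [J' [h' [j' ->]]].
by rewrite dotBr -(adjP _ _ Pb) PJ // (@compat _ Ax J' J h' h j' j) subrr.
Qed.

Lemma transport_gen i : S i -> transport (a i) = b i.
Proof.
move=> Si; apply/esym/transport_unique; [|exact: bB|by move=> J h j; exact: itw].
by apply: sub_bicommutant; [move=> _ [k Sk <-]; exact: aB | exists i].
Qed.

Lemma transport_hom : star_hom A B transport.
Proof.
have [_ A1 AL AM Aadj] := A_star.
split.
- move=> x Ax; have [Pb PJ] := transportP Ax; split; first exact/bopE.
  move=> T [/bopE Tb Tc]; apply: (bop_ext _ _ JJ_sep); [exact: bop_comp|exact: bop_comp|].
  move=> _ [J [h [j ->]]] /=.
  (* T in the commutant of the b i turns intertwiners into intertwiners, so [transport x] commutes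
     with T on the ranges and therefore lies in B. *)
  have jT : JJ (T \o J).
    split; first exact: bop_comp (JJb j).
    move=> i Si; apply/funext => v /=; rewrite -(itw _ j Si).
    by have := congr1 (@^~ (J v)) (Tc (b i) (ex_intro2 _ _ i Si erefl)).
  by rewrite PJ // -[T (J h)]/((T \o J) h) PJ.
- by apply/esym/transport_unique => //; exact: bop_id.
- move=> c x y Ax Ay; have [xb xJ] := transportP Ax; have [yb yJ] := transportP Ay.
  apply/esym/transport_unique; [exact: AL|exact: bop_lin|].
  by move=> J h j; rewrite !fctE xJ // yJ // (bopD (JJb j)) (bopZ (JJb j)).
- move=> x y Ax Ay; have [xb xJ] := transportP Ax; have [yb yJ] := transportP Ay.
  apply/esym/transport_unique; [exact: AM|exact: bop_comp|].
  by move=> J h j /=; rewrite yJ // xJ.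
- exact: transport_adj.
Qed.

End OneSided.

(** Adjoints of intertwiners go in the opposite direction, and this makes the two transports
    mutually inverse. Surjectivity onto the bicommutant of the b i is supplied by the backward
    transport. *)
Lemma quasi_equivalence H K (I : Type) (S : set I) (a : I -> H -> H)
    (b : I -> K -> K) (st : I -> I) :
  (forall i, S i -> bop (a i)) -> (forall i, S i -> bop (b i)) ->
  (forall i, S i -> [/\ S (st i), a (st i) = adj (a i) & b (st i) = adj (b i)]) ->
  sep (ranges (intertwiners S a b)) -> sep (ranges (intertwiners S b a)) ->
  exists Phi, [/\ vn_iso (bicommutant (a @` S)) (bicommutant (b @` S)) Phi,
    forall i, S i -> Phi (a i) = b i &
    forall x J h, bicommutant (a @` S) x -> intertwiners S a b J ->
      Phi x (J h) = J (x h)].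
Proof.
move=> aB bB abS s1 s2.
have aS i : S i -> S (st i) /\ a (st i) = adj (a i) by move=> /abS[].
have bS i : S i -> S (st i) /\ b (st i) = adj (b i) by move=> /abS[].
have aS' i : S i -> a (st i) = adj (a i) by move=> /abS[].
have bS' i : S i -> b (st i) = adj (b i) by move=> /abS[].
pose P := transport S a b; pose Q := transport S b a.
have hP := transport_hom aB bB aS bS' s1.
have hQ := transport_hom bB aB bS aS' s2.
have tP := transportP aB bB aS bS'.
have tQ := transportP bB aB bS aS'.
have inv (H' K' : hilbertType R) (a' : I -> H' -> H') (b' : I -> K' -> K') :
  (forall i, S i -> bop (a' i)) -> (forall i, S i -> bop (b' i)) ->
  (forall i, S i -> S (st i) /\ a' (st i) = adj (a' i)) ->
  (forall i, S i -> S (st i) /\ b' (st i) = adj (b' i)) ->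
  sep (ranges (intertwiners S a' b')) -> sep (ranges (intertwiners S b' a')) ->
  forall x, bicommutant (a' @` S) x -> transport S b' a' (transport S a' b' x) = x.
  move=> aB' bB' aS1 bS1 s1' s2' x Ax.
  have aS2 i : S i -> a' (st i) = adj (a' i) by move=> /aS1[].
  have bS2 i : S i -> b' (st i) = adj (b' i) by move=> /bS1[].
  have hT := transport_hom aB' bB' aS1 bS2 s1'.
  have [hB _ _ _ hadjT] := hT.
  have xb := commutant_bop Ax.
  apply/esym/(transport_unique bB' aB' bS1 aS2 s2'); [exact: hB|exact: xb|].
  move=> J h j; have Jb : bop J by case: j.
  have j' := hadj_intertwiner bB' aB' bS1 aS2 j.
  have [Tb TJ] := transportP aB' bB' aS1 bS2 Ax.
  apply: dotp_extr => w; rewrite (adjPl _ _ xb) dotC (hadjP Jb) -dotC.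
  have [_ _ _ _ Aadj] : star_algebra (bicommutant (a' @` S)).
    apply: commutant_star; first exact: commutant_bop.
    have [||_ _ _ _] := @commutant_star _ _ (a' @` S); last by [].
    + by move=> _ [i Si <-]; exact: aB'.
    + by move=> _ [i Si <-]; have [? <-] := aS1 _ Si; exists (st i).
  have [Tb' TJ'] := transportP aB' bB' aS1 bS2 (Aadj _ Ax).
  by rewrite -(TJ' _ _ j') hadjT // -(adjPl _ _ Tb) -(hadjPl Jb).
exists P; split.
- split=> //; have [h1 _ _ _ _] := hP; have [h2 _ _ _ _] := hQ; split=> //.
    move=> x y; rewrite !inE => Ax Ay Pxy.
    rewrite -(inv _ _ _ _ aB bB aS bS s1 s2 x Ax) -(inv _ _ _ _ aB bB aS bS s1 s2 y Ay).
    by congr (transport S b a _).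
  move=> z Bz; exists (Q z); first exact: h2.
  exact: (inv _ _ _ _ bB aB bS aS s2 s1 z Bz).
- by move=> i Si; exact: (transport_gen aB bB aS bS' s1 Si).
- by move=> x J h Ax j; have [_] := tP x Ax; apply.
Qed.

End Intertwiners.

(** * Intertwiners from normality and from a faithful state *)

Section NormalRepresentations.
Context {R : realType}.
Implicit Types E F H K : hilbertType R.

(** The difference is |(u - v) / 2|^2. At squares this dominates the functional <hat x u, v> by the
    vector functional of (u + v) / 2, which is the origin of [eta] below. *)
Lemma Re_dotp_half H (u v : H) : complex.Re (dotp u v) <= sqn (2^-1 *: (u + v)).
Proof.
have -> : (2^-1 : R[i]) = (2^-1)%:C by rewrite fmorphV rmorphMn rmorph1.
rewrite sqnZr sqnD; have := sqn_ge0 (u - v); rewrite sqnB.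
have -> : (2^-1 ^+ 2 : R) = 1 / 4 by field.
by move: (sqn _) (sqn _) (complex.Re _) => a b c; lra.
Qed.

(** The equations are pointwise so that amplified maps x |-> hat (f x) are covered along with
    homomorphisms of operator algebras. *)
Definition star_rep H E (A : set (H -> H)) (f : (H -> H) -> (E -> E)) :=
  [/\ forall x, A x -> bop (f x),
    forall (a : R[i]) x y w, A x -> A y -> f (a *: x + y) w = a *: f x w + f y w,
    forall x y w, A x -> A y -> f (x \o y) w = f x (f y w),
    forall x v w, A x -> dotp (f x v) w = dotp v (f (adj x) w) &
    forall w, f idfun w = w].

Lemma star_hom_rep H E (A : set (H -> H)) (B : set (E -> E)) f :
  B `<=` @bop R E E -> star_hom A B f -> star_rep A f.
Proof.
move=> BB [fB f1 fL fM fS]; split.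
- by move=> x /fB/BB.
- by move=> a x y w Ax Ay; rewrite fL.
- by move=> x y w Ax Ay; rewrite fM.
- by move=> x v w Ax; rewrite fS // adjP //; exact/BB/fB.
- by move=> w; rewrite f1.
Qed.

Lemma hat_rep H E (A : set (H -> H)) f : @star_algebra R H A -> @star_rep H E A f ->
  star_rep A (fun x => hat (f x)).
Proof.
move=> [Ab A1 AL AM Aadj] [fb fL fM fS f1].
have fb1 : bop (f idfun) by exact: fb.
split.
- by move=> x Ax; exact: hat_bop (fb _ Ax).
- move=> a x y w Ax Ay; apply: l2_ext => k.
  have b1 := fb _ Ax; have b2 := fb _ Ay; have b3 := fb _ (AL a _ _ Ax Ay).
  by rewrite l2D l2Z (hatE _ _ b1) (hatE _ _ b2) (hatE _ _ b3) fL.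
- move=> x y w Ax Ay; apply: l2_ext => k.
  have b1 := fb _ Ax; have b2 := fb _ Ay; have b3 := fb _ (AM _ _ Ax Ay).
  by rewrite (hatE _ _ b1) (hatE _ _ b2) (hatE _ _ b3) fM.
- move=> x v w Ax; have b1 := fb _ Ax; have b2 := fb _ (Aadj _ Ax).
  rewrite (hat_adj _ _ b1); congr (dotp _ _); apply: l2_ext => k.
  rewrite (hatE _ _ (hadj_bop b1)) (hatE _ _ b2); apply: dotp_extr => u.
  by rewrite -(hadjP b1) fS.
- by move=> w; apply: l2_ext => k; rewrite (hatE _ _ fb1) f1.
Qed.

Lemma sep_perp H (D : set H) : sep (D `|` perp D).
Proof.
move=> d dD; have Dd : perp D d by move=> a Da; apply: dD; left.
by apply: dotp_eq0; apply: dD; right.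
Qed.

Section Cyclic.
Variables (H E F : hilbertType R) (A : set (H -> H)).
Variables (p : (H -> H) -> (E -> E)) (q : (H -> H) -> (F -> F)).
Hypothesis AA : star_algebra A.
Hypothesis pR : star_rep A p.
Hypothesis qR : star_rep A q.

(* The intertwiner sending p x eta to t x. *)
Lemma cyclic_intertwiner (eta : E) (t : (H -> H) -> F) :
  (forall (a : R[i]) x y, A x -> A y -> t (a *: x + y) = a *: t x + t y) ->
  (forall x, A x -> sqn (t x) <= sqn (p x eta)) ->
  (forall x y, A x -> A y -> q x (t y) = t (x \o y)) ->
  exists V : E -> F, [/\ bop V, forall x, A x -> V (p x eta) = t x &
    forall x w, A x -> V (p x w) = q x (V w)].
Proof.
move=> tL tp tq; have [Ab A1 AL AM Aadj] := AA.
have [pb pL pM pS p1] := pR; have [qb _ _ _ _] := qR.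
pose r : set (E * F) := [set z | exists2 x, A x & z = (p x eta, t x)].
have [A0 _] := star_algebra_lin AA.
have [|||V [Vb Vr V0]] := @partial_op R E F r 1.
- split.
    exists 0 => //; congr (_, _).
      have := pL (- 1) _ _ eta A1 A1; rewrite !scaleN1r !addNr => ->.
      by [].
    by have := tL (- 1) _ _ A1 A1; rewrite !scaleN1r !addNr.
  move=> a _ _ [x Ax ->] [y Ay ->]; exists (a *: x + y); first exact: AL.
  by rewrite pL // tL.
- exact: ler01.
- by move=> _ [x Ax ->]; rewrite mul1r; exact: tp.
have Vt x : A x -> V (p x eta) = t x.
  by move=> Ax; have := Vr (p x eta, t x); apply; exists x.
exists V; split=> // x w Ax.
have xb := pb _ Ax; have qxb := qb _ Ax.
pose D := [set z.1 | z in r].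
suff : V \o p x = q x \o V by move/(congr1 (@^~ w)).
apply: (bop_ext (bop_comp Vb xb) (bop_comp qxb Vb) (@sep_perp E D)) => d [].
  move=> [_ [y Ay ->] <-] /=; rewrite -pM // !Vt ?tq //; exact: AM.
(* V is 0 on the orthogonal complement of the cyclic space, and p x preserves this complement
   because p (adj x) preserves the cyclic space. *)
move=> Dd /=; rewrite (V0 d Dd) (bop0 qxb) V0 // => _ [_ [y Ay ->] <-] /=.
have Axs := Aadj _ Ax.
have h : D (p (adj x \o y) eta).
  by exists (p (adj x \o y) eta, t (adj x \o y)) => //; exists (adj x \o y) => //; exact: AM.
have := Dd _ h; rewrite pM // pS // adjK //; exact: Ab.
Qed.

End Cyclic.

Section Sep.
Variables (H K : hilbertType R) (A : set (H -> H)) (f : (H -> H) -> (K -> K)).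
Hypothesis AN : von_neumann_algebra A.
Hypothesis fR : star_rep A f.
Hypothesis fN : normal_map A f.

Let AA : star_algebra A := vN_star AN.
Let Ab : A `<=` @bop R H H := vN_bop AN.
Let AV : lin_set (V := H -> H) A := star_algebra_lin AA.

Lemma id_rep : star_rep A (fun x : H -> H => x).
Proof.
by split=> // x v w /Ab xb; exact: adjP.
Qed.

Let hat_id_rep : star_rep A (@hat R H H) := hat_rep AA id_rep.

(** For k orthogonal to all ranges, x |-> <f x k, k> is normal, hence a coefficient of hat x, and |f
    x k| <= |hat x eta|. So hat x eta |-> f x k extends to an intertwiner V with V eta = k. Its
    restrictions to the copies of H are intertwiners from H, whence V^* k = 0 and |k|^2 = <V eta, k>
    = 0. *)
Lemma normal_rep_sep : sep (ranges (intertwiners A id f)).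
Proof.
have [_ A1 AL AM Aadj] := AA; have [fb fL fM fS f1] := fR.
have [_ hL hM hS h1] := hat_id_rep.
move=> k kJ.
pose g x : R[i]^o := dotp (f x k) k.
have [u [v uv]] : exists u v, forall x, A x -> g x = dotp (hat x u) v.
  apply: (normal_functional_hat Ab AV); last exact: normal_map_vector.
  by move=> a x y Ax Ay; rewrite /g fL // dotDl dotZl.
pose eta := 2^-1 *: (u + v).
have tle x : A x -> sqn (f x k) <= sqn (hat x eta).
  move=> Ax; have Axs := Aadj _ Ax; have xb := Ab Ax.
  have E : sqn (f x k) = complex.Re (g (adj x \o x)).
    by rewrite /g fM // fS // adjK.
  rewrite E uv; last exact: AM.
  rewrite hM // hS // adjK //; apply: le_trans (Re_dotp_half _ _) _.
  by rewrite /eta (bopZ (hat_bop xb)) (bopD (hat_bop xb)).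
have [|||V [Vb Vt VI]] := @cyclic_intertwiner _ _ _ A _ _ AA hat_id_rep fR eta
  (fun x => f x k).
- by move=> a x y Ax Ay; exact: fL.
- exact: tle.
- by move=> x y Ax Ay; rewrite fM.
have ke : k = V eta by rewrite -[eta]h1 Vt // f1.
have Vk : hadj V k = 0.
  apply: l2_in_total => n h; rewrite -(hadjP Vb); apply: kJ.
  exists (V \o @l2in R H n), h; split=> //; split.
    exact: bop_comp Vb (@l2in_bop R H n).
  move=> x Ax; apply/funext => w /=.
  by rewrite -VI // hat_in //; exact: Ab.
by apply: dotp_eq0; rewrite {1}ke (hadjP Vb) Vk dot0r.
Qed.

Section Faithful.
Variables (phi : (H -> H) -> R[i]) (U V : l2n K).
Hypothesis phiF : faithful_normal_state A phi.
Hypothesis phif : forall x, A x -> phi x = dotp (hat (f x) U) V.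

Let phiL (a : R[i]) x y : A x -> A y -> phi (a *: x + y) = a * phi x + phi y.
Proof. by have [[h _ _ _] _] := phiF; exact: h. Qed.

Let phi_ge0 x : A x -> 0 <= phi (adj x \o x).
Proof. by have [[_ _ h _] _] := phiF; exact: h. Qed.

Let phiD x y : A x -> A y -> phi (x + y) = phi x + phi y.
Proof. by move=> Ax Ay; have := phiL 1 Ax Ay; rewrite scale1r mul1r. Qed.

Let phi0 : phi 0 = 0.
Proof. by apply: (lin_on0 AV (f := phi)) => a x y; exact: phiL. Qed.

Let phiZ (a : R[i]) x : A x -> phi (a *: x) = a * phi x.
Proof. by move=> Ax; have := phiL a Ax AV.1; rewrite !addr0 phi0 addr0. Qed.

Let phi_expand (a : R[i]) x y : A x -> A y ->
  phi (adj (a *: x + y) \o (a *: x + y)) =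
  Num.conj a * a * phi (adj x \o x) + Num.conj a * phi (adj x \o y) +
  a * phi (adj y \o x) + phi (adj y \o y).
Proof.
move=> Ax Ay; have [_ A1 AL AM Aadj] := AA; have xb := Ab Ax; have yb := Ab Ay.
have Axs := Aadj _ Ax; have Ays := Aadj _ Ay.
have -> : adj (a *: x + y) \o (a *: x + y) =
    (Num.conj a * a) *: (adj x \o x) + (Num.conj a *: (adj x \o y) +
      (a *: (adj y \o x) + (adj y \o y))).
  rewrite adj_lin //; apply/funext => w; rewrite /= !fctE.
  have xsb := adj_bop xb; have ysb := adj_bop yb.
  rewrite !(bopD xsb) !(bopD ysb) !(bopZ xsb) !(bopZ ysb).
  by rewrite scalerDr scalerA -!addrA.
have AZ (c : R[i]) z : A z -> A (c *: z).
  by move=> Az; have := AL c _ _ Az AV.1; rewrite addr0.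
have AD z w : A z -> A w -> A (z + w).
  by move=> Az Aw; have := AL 1 _ _ Az Aw; rewrite scale1r.
have m x' y' : A x' -> A y' -> A (x' \o y') by exact: AM.
have k1 := AZ (Num.conj a * a) _ (m _ _ Axs Ax).
have k2 := AZ (Num.conj a) _ (m _ _ Axs Ay).
have k3 := AZ a _ (m _ _ Ays Ax).
have k4 := m _ _ Ays Ay.
rewrite (phiD k1 (AD _ _ k2 (AD _ _ k3 k4))) (phiD k2 (AD _ _ k3 k4)) (phiD k3 k4).
rewrite (phiZ _ (m _ _ Axs Ax)) (phiZ _ (m _ _ Axs Ay)) (phiZ _ (m _ _ Ays Ax)).
by rewrite !addrA.
Qed.

(** Positivity makes phi real at the squares of a x + y; the imaginary parts for a = 1 and a = i
    give the two components. *)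
Let phi_herm x y : A x -> A y -> phi (adj y \o x) = Num.conj (phi (adj x \o y)).
Proof.
move=> Ax Ay; have [_ A1 AL AM Aadj] := AA.
have Rx := ger0_Im (phi_ge0 Ax); have Ry := ger0_Im (phi_ge0 Ay).
have Im1 (a : R[i]) : complex.Im (Num.conj a * phi (adj x \o y) + a * phi (adj y \o x)) =
    complex.Im (- (Num.conj a * a * phi (adj x \o x))).
  have AL' : A (a *: x + y) by exact: AL.
  have := ger0_Im (phi_ge0 AL'); rewrite phi_expand // -addrA -addrA.
  move: Ry; case: (phi (adj y \o y)) => c d /= ->.
  move: (_ * _) (_ * _) (_ * _) => [z1 z2] [z3 z4] [z5 z6] /=; lra.
have := Im1 1; have := Im1 'i.
rewrite conj_i rmorph1 !mul1r; move: Rx.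
case: (phi (adj x \o x)) => c d /= ->; case: (phi (adj x \o y)) => z1 z2.
case: (phi (adj y \o x)) => z3 z4 /= h1 h2.
by apply: complex_eq => /=; move: h1 h2; lra.
Qed.

Let phi_CS x y : A x -> A y ->
  complex.Re (phi (adj x \o y)) ^+ 2 <= complex.Re (phi (adj x \o x)) * complex.Re (phi (adj y \o y)).
Proof.
move=> Ax Ay; have [_ A1 AL AM Aadj] := AA.
apply: quadratic_ge0; try exact/ge0_Re_ge0/phi_ge0.
move=> t; have AL' : A (t%:C *: x + y) by exact: AL.
have := ge0_Re_ge0 (phi_ge0 AL'); rewrite phi_expand // conj_real.
rewrite !ReD -rmorphM !ReZ (phi_herm Ax Ay) Re_conj expr2.
by move: (complex.Re _) (complex.Re _) (complex.Re _) => b c d; lra.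
Qed.

(* For x in A, [t x] is the vector of l2(K) representing y |-> phi (x^* y) on
   the cyclic space of hat (f y) etaK; intertwining hat x etaH |-> t x stands
   for the map from H to K through the GNS space of phi. *)
Lemma faithful_sep : sep (ranges (intertwiners A f id)).
Proof.
have [_ A1 AL AM Aadj] := AA.
have [_ hL hM hS h1] := hat_id_rep.
have fhat := hat_rep AA fR; have [fhb fhL fhM fhS fh1] := fhat.
have fhSr x v w : A x -> dotp v (hat (f x) w) = dotp (hat (f (adj x)) v) w.
  by move=> Ax; rewrite dotC fhS // -dotC.
have phiN : normal_functional A phi by have [[_ _ _ h] _] := phiF.
have [u [v uv]] : exists u v, forall x, A x -> phi x = dotp (hat x u) v.
  by apply: (normal_functional_hat Ab AV) => // a x y; exact: phiL.
pose eta := 2^-1 *: (u + v); pose etaK := 2^-1 *: (U + V).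
have leH x : A x -> complex.Re (phi (adj x \o x)) <= sqn (hat x eta).
  move=> Ax; have Axs := Aadj _ Ax; have xb := Ab Ax.
  rewrite uv; last exact: AM.
  rewrite hM // hS // adjK //; apply: le_trans (Re_dotp_half _ _) _.
  by rewrite /eta (bopZ (hat_bop xb)) (bopD (hat_bop xb)).
have leK x : A x -> complex.Re (phi (adj x \o x)) <= sqn (hat (f x) etaK).
  move=> Ax; have Axs := Aadj _ Ax; have xb := Ab Ax; have hb := fhb _ Ax.
  rewrite phif; last exact: AM.
  rewrite fhM // fhS // adjK //; apply: le_trans (Re_dotp_half _ _) _.
  by rewrite /etaK (bopZ hb) (bopD hb).
pose D := [set hat (f y) etaK | y in A].
have phi_lr x : A x -> forall (a : R[i]) y z, A y -> A z ->
    phi (adj x \o (a *: y + z)) = a * phi (adj x \o y) + phi (adj x \o z).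
  move=> Ax a y z Ay Az; have xsb := adj_bop (Ab Ax); have Axs := Aadj _ Ax.
  rewrite -phiL; [|exact: AM|exact: AM].
  by congr (phi _); apply/funext => w; rewrite /= !fctE (bopD xsb) (bopZ xsb).
(* Existence by Riesz, the bound being Cauchy-Schwarz for phi followed by [leK]. Keeping the vector
   in the closed cyclic space makes it unique, and hence t linear and equivariant. *)
have /choice[t Ht] x : exists t, A x -> [/\ forall y, A y ->
    phi (adj x \o y) = dotp (hat (f y) etaK) t,
    forall d, perp D d -> dotp t d = 0 & sqn t <= complex.Re (phi (adj x \o x))].
  have [Ax|nAx] := pselect (A x); last by exists 0.
  have [|||e [e1 e2 e3]] := @riesz_rel R (l2n K)
      [set z | exists2 y, A y & z = (hat (f y) etaK, phi (adj x \o y))]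
      (complex.Re (phi (adj x \o x))).
  - split.
      exists 0; first by case: AV.
      congr (_, _).
        have := fhL (- 1) _ _ etaK A1 A1; rewrite !scaleN1r !addNr => ->.
        by [].
      by have := phi_lr _ Ax (- 1) _ _ A1 A1; rewrite !scaleN1r !mulN1r !addNr.
    move=> a _ _ [y Ay ->] [z Az ->]; exists (a *: y + z); first exact: AL.
    by rewrite /= fhL // phi_lr.
  - exact/ge0_Re_ge0/phi_ge0.
  - move=> _ [y Ay ->] /=; apply: le_trans (phi_CS Ax Ay) _.
    by rewrite ler_wpM2l ?leK //; exact/ge0_Re_ge0/phi_ge0.
  exists e => _; split=> // [y Ay|d Dd].
    by have := e1 (hat (f y) etaK, phi (adj x \o y)); apply; exists y.
  by apply: e2 => _ [y Ay ->] /=; apply: Dd; exists y.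
have t_unique x w : A x -> (forall y, A y ->
    phi (adj x \o y) = dotp (hat (f y) etaK) w) ->
    (forall d, perp D d -> dotp w d = 0) -> w = t x.
  move=> Ax w1 w2; have [t1 t2 _] := Ht x Ax.
  apply/eqP; rewrite -subr_eq0; apply/eqP/dotp_eq0; set z := w - t x.
  have zD : perp D z by move=> _ [y Ay <-]; rewrite dotBr -w1 // -t1 // subrr.
  by rewrite {1}/z dotBl w2 // t2 // subrr.
have [|||W [Wb Wt WI]] := @cyclic_intertwiner _ _ _ A _ _ AA hat_id_rep fhat eta t.
- move=> a x y Ax Ay; have [x1 x2 _] := Ht x Ax; have [y1 y2 _] := Ht y Ay.
  apply/esym/t_unique; first exact: AL.
    move=> z Az; rewrite dotDr dotZr -x1 // -y1 //.
    have xb := Ab Ax; have yb := Ab Ay; rewrite adj_lin //.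
    rewrite -phiL; [|by apply: AM => //; exact: Aadj|by apply: AM => //; exact: Aadj].
    by congr (phi _); apply/funext => w; rewrite /= !fctE.
  by move=> d Dd; rewrite dotDl dotZl x2 // y2 // mulr0 addr0.
- by move=> x Ax; have [_ _ tx] := Ht x Ax; exact: le_trans tx (leH _ Ax).
- move=> x y Ax Ay; have [y1 y2 _] := Ht y Ay; have Axs := Aadj _ Ax.
  apply: t_unique; first exact: AM.
    move=> z Az; have xb := Ab Ax; have yb := Ab Ay.
    rewrite adj_comp // fhSr // -fhM // -y1 //; exact: AM.
  move=> d Dd; rewrite fhS //; apply: y2 => _ [z Az <-].
  rewrite fhSr // (adjK (Ab Ax)) -fhM //; apply: Dd.
  by exists (x \o z) => //; exact: AM.
pose JJ := intertwiners A f id; pose D1 := ranges JJ.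
(* P projects onto the complement of the ranges. These are stable under the commutant of A, so P
   lies in A. By adjoints every intertwiner from [id] to f kills the range of P, hence so does W
   entry by entry, and t P = 0. Then phi (adj P \o P) = 0 and faithfulness gives P = 0. *)
have [P [Pb PP]] := proj_ex (perp_lin_set D1).
have TD T w : commutant A T -> D1 w -> D1 (T w).
  move=> [/bopE Tb TA] [J [k [[Jb JI] ->]]]; exists (T \o J), k; split=> //; split.
    exact: bop_comp.
  move=> x Ax; apply/funext => z; have E1 := congr1 (@^~ z) (JI x Ax).
  by have E2 := congr1 (@^~ (J z)) (TA x Ax); rewrite /= in E1 E2 *; rewrite -E2 E1.
have [_ _ _ _ Cadj] := commutant_star Ab Aadj.
have perpT (D' : set H) T w : bop T -> (forall w, D' w -> D' (adj T w)) ->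
    perp D' w -> perp D' (T w).
  by move=> Tb TD' Dw d Dd; rewrite (adjPl _ _ Tb); apply/Dw/TD'.
have p1 T w : commutant A T -> perp D1 w -> perp D1 (T w).
  move=> TA; apply: perpT; first exact: commutant_bop TA.
  by move=> d; apply/TD/Cadj.
have p2 T w : commutant A T -> perp (perp D1) w -> perp (perp D1) (T w).
  move=> TA; apply: perpT; first exact: commutant_bop TA.
  by move=> d; apply/p1/Cadj.
have p3 T w : commutant A T -> perp (perp (perp D1)) w -> perp (perp (perp D1)) (T w).
  move=> TA; apply: perpT; first exact: commutant_bop TA.
  by move=> d; apply/p2/Cadj.
have AP : A P.
  have [_ _ <-] := AN; split; first exact/bopE.
  move=> T TA; apply/funext => w /=; have Tb := commutant_bop TA.
  have [w1 w2] := PP w; apply: (proj_unique PP (p3 _ _ TA w1) (p2 _ _ TA w2)).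
  by rewrite -(bopD Tb) addrC subrK.
have Pperp w : perp D1 (P w).
  by have [w1 _] := PP w => d Dd; apply: w1 => a Da; rewrite dotC Da // rmorph0.
have JP J h : intertwiners A id f J -> J (P h) = 0.
  move=> j; have Jb : bop J by case: j.
  apply: dotp_ext => k; rewrite dot0l (hadjP Jb) dotC; rewrite (Pperp h) ?rmorph0 //.
  exists (hadj J), k; split=> //.
  apply: (@hadj_intertwiner _ _ _ _ A id f (@adj R H)) => //.
  - by move=> x Ax; have [fb _ _ _ _] := fR; exact: fb.
  - by move=> x Ax; split=> //; exact: Aadj.
  - move=> x Ax; have [fb _ _ fS _] := fR; apply: adj_unique; first exact: fb.
    by move=> a b; exact: fS.
have WP : W \o hat P = 0.
  apply: (bop_ext (bop_comp Wb (hat_bop (Ab AP))) (bop_0 _ _) (@l2in_sep R H)).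
  move=> _ [m [h ->]] /=; rewrite hat_in; last exact: Ab.
  apply: l2_ext => n; rewrite l2_0.
  apply: (JP (@l2pr R K n \o W \o @l2in R H m) h); split.
    exact: bop_comp (bop_comp (@l2pr_bop R K n) Wb) (@l2in_bop R H m).
  move=> x Ax; apply/funext => w /=; have [fb _ _ _ _] := fR.
  by rewrite -(hat_in _ _ (Ab Ax)) WI // /l2pr (hatE _ _ (fb _ Ax)).
have tP0 : t P = 0 by rewrite -Wt //; exact: (congr1 (@^~ eta) WP).
have P0 : P = 0.
  have [_ h] := phiF; apply: h => //; have [t1 _ _] := Ht P AP.
  by rewrite t1 // tP0 dot0r.
move=> d Dd; have <- : P d = d.
  apply: (proj_unique PP (b := 0)); [|by have [] := perp_lin_set (perp D1)|by rewrite addr0].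
  by move=> a Da; rewrite dotC Da // rmorph0.
by rewrite P0.
Qed.

End Faithful.

End Sep.

End NormalRepresentations.

(** * Operators on Hilbert space tensor products *)

Section TensorOperators.
Context {R : realType}.
Implicit Types H K : hilbertType R.

Lemma total_sep H (S : set H) : Defs.total S -> sep S.
Proof.
move=> St d dS; apply: sqn_eq0; apply/eqP; rewrite eq_le sqn_ge0 andbT.
apply: (@le_eps _ _ 1) => // e e0; rewrite mul1r.
have s0 : 0 < Num.sqrt e by rewrite sqrtr_gt0.
have [||w [dw [n [a [s [Ss wE]]]]]] := St (ball d (Num.sqrt e)%:C).
- by exists d; apply: ballxx; rewrite ltcR.
- by apply: ball_open; rewrite ltcR.
move: dw; rewrite -ball_normE /=.
have dw : dotp w d = 0.
  by rewrite wE dot_suml big1 // => k _; rewrite dotZl dS // mulr0.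
rewrite norm_sqn ltcR ltr_sqrt // sqnB dotC dw rmorph0 mulr0 subr0.
by have := sqn_ge0 w; lra.
Qed.

Section Tens.
Variables (H K : hilbertType R) (T : tensor_space H K).

Lemma sqn_tens u v : sqn (tens T u v) = sqn u * sqn v.
Proof.
have : (sqn (tens T u v))%:C = (sqn u * sqn v)%:C by rewrite -dot_sqn tens_dotp !dot_sqn rmorphM.
by case.
Qed.

Lemma tens_bopl v : bop (fun u => tens T u v).
Proof.
split; first exact: tens_linearl.
by exists (sqn v) => [|u]; rewrite ?sqn_ge0 // sqn_tens mulrC.
Qed.

Lemma tens_bopr u : bop (tens T u).
Proof.
split; first exact: tens_linearr.
by exists (sqn u) => [|v]; rewrite ?sqn_ge0 // sqn_tens.
Qed.

Lemma tens_sep : sep [set w | exists u v, w = tens T u v].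
Proof. exact/total_sep/tens_total. Qed.

Lemma tens_ext H' (f g : T -> H') : bop f -> bop g ->
  (forall u v, f (tens T u v) = g (tens T u v)) -> f = g.
Proof. by move=> fb gb fg; apply: (bop_ext fb gb tens_sep) => _ [u [v ->]]. Qed.

End Tens.

(** An instance of [commuting_ext] for the maps u |-> u (x) v, indexed by v, and the pair x,
    [hadj x]; boundedness of x (x) 1 on sums of elementary tensors is the estimate proved there. *)
Lemma tens_map_ex H H' K (T : tensor_space H K) (T' : tensor_space H' K) (x : H -> H') :
  bop x -> exists z : T -> T', bop z /\ forall u v, z (tens T u v) = tens T' (x u) v.
Proof.
move=> xb.
have [z [zb zP]] := @commuting_ext R K H T H' T' setT (fun v u => tens T u v)
  (fun v u => tens T' u v) x (hadj x) (fun v _ => tens_bopl T v) (fun v _ => tens_bopl T' v)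
  xb (hadj_bop xb) (fun v w u u' _ _ => ltac:(rewrite !tens_dotp (hadjP xb); reflexivity)).
by exists z; split=> // u v; exact: zP.
Qed.

Section TensOp.
Variables (H K : hilbertType R) (T : tensor_space H K).

Lemma tens_op_ex (x : H -> H) (y : K -> K) : bop x -> bop y ->
  exists z : T -> T, bop z /\ forall u v, z (tens T u v) = tens T (x u) (y v).
Proof.
move=> xb yb; have [z [zb zP]] := tens_map_ex T T xb.
have [z' [zb' zP']] := @commuting_ext R H K T K T setT (fun u v => tens T u v)
  (fun u v => tens T u v) y (hadj y) (fun v _ => tens_bopr T v) (fun v _ => tens_bopr T v)
  yb (hadj_bop yb) (fun v w u u' _ _ => ltac:(rewrite !tens_dotp (hadjP yb); reflexivity)).
by exists (z \o z'); split=> [|u v] /=; [exact: bop_comp | rewrite zP' // zP].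
Qed.

Lemma tens_opP x y : bop x -> bop y -> bop (tens_op T x y) /\
  forall u v, tens_op T x y (tens T u v) = tens T (x u) (y v).
Proof.
move=> xb yb; have [z [zb zP]] := tens_op_ex xb yb.
rewrite /tens_op /the_op; case: xgetP => [w _ [/bopE wb wP]|]; first by split.
by move/(_ z); case; split=> //; exact/bopE.
Qed.

Lemma tens_op_bop x y : bop x -> bop y -> bop (tens_op T x y).
Proof. by move=> xb yb; have [] := tens_opP xb yb. Qed.

Lemma tens_opE x y u v : bop x -> bop y -> tens_op T x y (tens T u v) = tens T (x u) (y v).
Proof. by move=> xb yb; have [_] := tens_opP xb yb; apply. Qed.

Lemma tens_op_unique x y z : bop x -> bop y -> bop z ->
  (forall u v, z (tens T u v) = tens T (x u) (y v)) -> z = tens_op T x y.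
Proof.
move=> xb yb zb zP; have [wb wP] := tens_opP xb yb.
by apply: (tens_ext zb wb) => u v; rewrite zP wP.
Qed.

Lemma tens_op_bopW x y : bop (tens_op T x y).
Proof.
rewrite /tens_op /the_op; case: xgetP => [w _ [/bopE //]|_]; exact: bop_0.
Qed.

Local Opaque tens_op.

Lemma tens_op_comp x y x' y' : bop x -> bop y -> bop x' -> bop y' ->
  tens_op T x y \o tens_op T x' y' = tens_op T (x \o x') (y \o y').
Proof.
move=> xb yb xb' yb'; apply: tens_op_unique.
- exact: bop_comp.
- exact: bop_comp.
- exact: bop_comp (tens_op_bop xb yb) (tens_op_bop xb' yb').
- by move=> u v /=; rewrite (tens_opE _ _ xb' yb') (tens_opE _ _ xb yb).
Qed.

Lemma tens_op_id : tens_op T idfun idfun = idfun.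
Proof. by apply/esym/tens_op_unique => //; exact: bop_id. Qed.

Lemma tens_op_adj x y : bop x -> bop y -> adj (tens_op T x y) = tens_op T (adj x) (adj y).
Proof.
move=> xb yb; have zb := tens_op_bop xb yb.
apply: tens_op_unique; [exact: adj_bop|exact: adj_bop|exact: adj_bop|].
move=> u v; apply/eqP; rewrite -subr_eq0; apply/eqP/(@tens_sep H K T) => _ [u' [v' ->]].
rewrite dotBr -(adjP _ _ zb) (tens_opE _ _ xb yb) !tens_dotp.
by rewrite (adjP _ _ xb) (adjP _ _ yb) subrr.
Qed.

Lemma tens_op_linl (a : R[i]) x x' y : bop x -> bop x' -> bop y ->
  tens_op T (a *: x + x') y = a *: tens_op T x y + tens_op T x' y.
Proof.
move=> xb xb' yb; apply/esym/tens_op_unique; [exact: bop_lin|exact: yb| |].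
  exact: bop_lin (tens_op_bop xb yb) (tens_op_bop xb' yb).
move=> u v; rewrite !fctE (tens_opE _ _ xb yb) (tens_opE _ _ xb' yb).
by rewrite (bopD (tens_bopl T _)) (bopZ (tens_bopl T _)).
Qed.

End TensOp.

End TensorOperators.

Local Opaque tens_op.

(** * The left regular representation and coordinates in H (x) l2(G) *)

Section L2Group.
Context {R : realType} {G : groupType} (L : l2_space R G).

Lemma delta_sep : sep (range (delta L)).
Proof. exact/total_sep/delta_total. Qed.

Lemma lambda_ex g : exists U : L -> L, unitary U /\ forall h, U (delta L h) = delta L (g * h)%g.
Proof.
apply: gram_unitary; [|exact: delta_sep|].
  by move=> h k; rewrite !delta_orthonormal (inj_eq (mulgI g)).
move=> d dP; apply: delta_sep => _ [h _ <-]; apply: dP.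
by exists (g^-1 * h)%g => //; rewrite mulVKg.
Qed.

Lemma lambdaP g : bop (lambda L g) /\ forall h, lambda L g (delta L h) = delta L (g * h)%g.
Proof.
have [U [[Ub _ _] UP]] := lambda_ex g.
rewrite /lambda /the_op; case: xgetP => [w _ [/bopE wb wP]|]; first by split.
by move/(_ U); case; split=> //; exact/bopE.
Qed.

Lemma lambda_bop g : bop (lambda L g). Proof. by case: (lambdaP g). Qed.

Lemma lambdaE g h : lambda L g (delta L h) = delta L (g * h)%g.
Proof. by case: (lambdaP g). Qed.

Lemma delta_ext (K : hilbertType R) (f g : L -> K) : bop f -> bop g ->
  (forall h, f (delta L h) = g (delta L h)) -> f = g.
Proof. by move=> fb gb fg; apply: (bop_ext fb gb delta_sep) => _ [h _ <-]. Qed.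

Local Opaque lambda.

Lemma lambda1 : lambda L 1%g = idfun.
Proof.
by apply: (delta_ext (lambda_bop _) (bop_id _)) => h; rewrite lambdaE mul1g.
Qed.

Lemma lambdaM g h : lambda L g \o lambda L h = lambda L (g * h)%g.
Proof.
apply: (delta_ext (bop_comp (lambda_bop _) (lambda_bop _)) (lambda_bop _)) => k /=.
by rewrite !lambdaE mulgA.
Qed.

Lemma adj_lambda g : adj (lambda L g) = lambda L g^-1%g.
Proof.
have gb := lambda_bop g; have vb := lambda_bop g^-1%g.
apply: (delta_ext (adj_bop gb) vb) => k.
apply/eqP; rewrite -subr_eq0; apply/eqP/delta_sep => _ [h _ <-].
rewrite dotBr -(adjP _ _ gb) !lambdaE !delta_orthonormal.
by rewrite -{1}(mulVKg g k) (inj_eq (mulgI g)) subrr.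
Qed.

Lemma group_trace_lambda g : group_trace L (lambda L g) = (g == 1%g)%:R.
Proof. by rewrite /group_trace lambdaE mulg1 delta_orthonormal. Qed.

Lemma lambda_group_vna g : group_vna L (lambda L g).
Proof. by apply: sub_bicommutant; [move=> _ [h _ <-]; exact: lambda_bop | exists g]. Qed.

Lemma group_vna_vN : von_neumann_algebra (group_vna L).
Proof.
apply: bicommutant_vN; first by move=> _ [h _ <-]; exact: lambda_bop.
by move=> _ [h _ <-]; exists h^-1%g => //; rewrite adj_lambda.
Qed.

Section TensL2.
Variables (H : hilbertType R) (T : tensor_space H L).

Lemma tens_delta_sep : sep [set w | exists u h, w = tens T u (delta L h)].
Proof.
move=> d dP; apply: tens_sep => _ [u [v ->]].
rewrite (hadjP (tens_bopr T u)).
rewrite (delta_sep (d := hadj (tens T u) d)) ?dot0r // => _ [h _ <-].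
by rewrite -(hadjP (tens_bopr T u)); apply: dP; exists u, h.
Qed.

Lemma tens_delta_ext (K : hilbertType R) (f g : T -> K) : bop f -> bop g ->
  (forall u h, f (tens T u (delta L h)) = g (tens T u (delta L h))) -> f = g.
Proof. by move=> fb gb fg; apply: (bop_ext fb gb tens_delta_sep) => _ [u [h ->]]. Qed.

Lemma dotp_tens_delta u v g h :
  dotp (tens T u (delta L g)) (tens T v (delta L h)) = dotp u v * (g == h)%:R.
Proof. by rewrite tens_dotp delta_orthonormal. Qed.

(* The component of a vector of H (x) l2(G) along [delta g]. *)
Definition coord (g : G) : T -> H := hadj (fun u => tens T u (delta L g)).

Lemma coord_bop g : bop (coord g).
Proof. exact: hadj_bop (tens_bopl T _). Qed.

Lemma coordP g u t : dotp (tens T u (delta L g)) t = dotp u (coord g t).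
Proof. by rewrite (hadjP (tens_bopl T (delta L g))). Qed.

Lemma coord_tens g u h : coord g (tens T u (delta L h)) = (g == h)%:R *: u.
Proof.
apply: dotp_extr => v; rewrite -coordP dotp_tens_delta dotZr rmorph_nat.
by rewrite mulrC.
Qed.

End TensL2.

End L2Group.

Local Opaque lambda.

(** * Normality of conjugations and of amplification by l2(G) *)

Section NormalMaps.
Context {R : realType}.
Implicit Types H K E : hilbertType R.

(** The condition is a preadjoint on coefficients: composing an ultraweak functional with f gives an
    ultraweak functional on A. *)
Lemma normal_map_uw H K (A : set (H -> H)) (f : (H -> H) -> (K -> K)) :
  A `<=` @bop R H H -> (forall x, A x -> bop (f x)) ->
  (forall U V : l2n K, exists U' V' : l2n H, forall x, A x ->
     dotp (hat (f x) U) V = dotp (hat x U') V') -> normal_map A f.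
Proof.
move=> Ab fb fUV F x FF FA Ax Fx w wU; have [U [V wE]] := uw_functionalP wU.
have [U' [V' UV]] := fUV U V.
rewrite wE; last exact: fb.
rewrite UV //.
have h := Fx _ (uw_functional_hat U' V').
move=> C /h hC; suff : F [set y | C (w (f y))] by [].
have hC' : F [set y | C (dotp (hat y U') V')] := hC.
have FC : F (A `&` [set y | C (dotp (hat y U') V')]) by apply: filterI.
apply: filterS FC => y [Ay /= Cy] /=.
by rewrite wE ?UV //; exact: fb.
Qed.

Lemma normal_map_comp H K E (A : set (H -> H)) (B : set (K -> K))
    (f : (H -> H) -> (K -> K)) (g : (K -> K) -> (E -> E)) :
  set_fun A B f -> normal_map A f -> normal_map B g -> normal_map A (g \o f).
Proof.
move=> fAB fN gN F x FF FA Ax Fx.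
have FB : F (f @^-1` B) by apply: filterS FA => y; exact: fAB.
exact: (gN (f @ F) (f x) (fmap_proper_filter f FF) FB (fAB _ Ax) (fN F x FF FA Ax Fx)).
Qed.

Lemma normal_map_conj H K (A : set (H -> H)) (u : H -> K) (v : K -> H) :
  A `<=` @bop R H H -> bop u -> bop v -> normal_map A (fun x => u \o x \o v).
Proof.
move=> Ab ub vb; apply: normal_map_uw => //.
  by move=> x /Ab xb; exact: bop_comp (bop_comp ub xb) vb.
move=> U V; exists (hat v U), (hat (hadj u) V) => x /Ab xb.
by rewrite (hat_comp _ (bop_comp ub xb) vb) (hat_comp _ ub xb) (hat_adj _ _ ub).
Qed.

Lemma dotp_l2in2 H n m (a b : H) : dotp (l2in n a) (l2in m b) = (n == m)%:R * dotp a b.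
Proof. by rewrite dotp_l2in l2inE eq_sym; case: eqP => _; rewrite ?mul1r // mul0r dot0l. Qed.

(* A countable orthonormal basis of l2(G) embeds l2(nat, H (x) l2(G))
   isometrically in l2(nat, H), intertwining the amplifications. *)
Lemma normal_amplification (G : groupType) (L : l2_space R G) H (T : tensor_space H L)
    (A : set (H -> H)) : countable [set: G] -> A `<=` @bop R H H ->
  normal_map A (fun x => tens_op T x idfun).
Proof.
move=> /countable_injP[e einj] Ab.
have idb := @bop_id R L.
pose s (i : nat * H * G) : l2n T := l2in i.1.1 (tens T i.1.2 (delta L i.2)).
(* The delta_g component of the n-th entry is stored at position c n g; e injects G into [nat] and
   [pickle] codes the pair. *)
pose c (n : nat) (g : G) : nat := pickle (n, e g).
have cinj n g m h : (c n g == c m h) = (n == m) && (g == h).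
  rewrite (inj_eq (pcan_inj pickleK)) xpair_eqE; congr (_ && _).
  by apply/eqP/eqP => [/einj -> //|->//]; rewrite inE.
pose t (i : nat * H * G) : l2n H := l2in (c i.1.1 i.2) i.1.2.
have st i j : dotp (t i) (t j) = dotp (s i) (s j).
  case: i => [[n u] g]; case: j => [[m v] h]; rewrite /s /t /= !dotp_l2in2 cinj.
  by rewrite dotp_tens_delta; case: (n == m) => /=; rewrite ?mul0r // mul1r mulrC.
have s_sep : sep (range s).
  move=> d ds; apply: l2_in_total => n t'.
  rewrite dotp_l2in_l; suff -> : l2pr n d = 0 by rewrite dot0r.
  apply: (tens_delta_sep (T := T)) => _ [u [g ->]].
  by rewrite -dotp_l2in_l; apply: ds; exists (n, u, g).
have [F [Fb Fs]] := gram_op st.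
have FF : hadj F \o F = idfun.
  apply: (bop_ext (bop_comp (hadj_bop Fb) Fb) (bop_id _) s_sep) => _ [j _ <-] /=.
  apply/eqP; rewrite -subr_eq0; apply/eqP/s_sep => _ [i _ <-].
  by rewrite dotBr -(hadjP Fb) !Fs st subrr.
apply: normal_map_uw => // [x Ax|U V]; first exact: tens_op_bopW.
exists (F U), (F V) => x /Ab xb.
have xTb := tens_op_bop T xb idb.
have Fx : F \o hat (tens_op T x idfun) = hat x \o F.
  apply: (bop_ext (bop_comp Fb (hat_bop xTb)) (bop_comp (hat_bop xb) Fb) s_sep).
  move=> _ [[[n u] g] _ <-]; rewrite /= Fs /s /t /= (hat_in _ _ xTb) (hat_in _ _ xb).
  rewrite (tens_opE _ _ _ xb idb); exact: (Fs (n, x u, g)).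
have E1 : F (hat (tens_op T x idfun) U) = hat x (F U) := congr1 (@^~ U) Fx.
have E2 : hadj F (F (hat (tens_op T x idfun) U)) = hat (tens_op T x idfun) U :=
  congr1 (@^~ _) FF.
by rewrite -E1 (hadjPl Fb) E2.
Qed.

End NormalMaps.

(** * Reduced words and freeness *)

Section ReducedWords.
Context {R : realType} {H : hilbertType R} {I : Type}.
Variables (B : I -> set (H -> H)) (phi : (H -> H) -> R[i]).

(** The index is the component of the first letter, which makes alternation a local condition on
    each new letter. *)
Inductive redword : I -> (H -> H) -> Prop :=
| redword1 o x : B o x -> phi x = 0 -> redword o x
| redwordS o o' x y : B o x -> phi x = 0 -> o <> o' -> redword o' y -> redword o (x \o y).

Lemma free_redword : freely_independent B phi ->
  forall o y, redword o y -> phi y = 0.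
Proof.
move=> free o y yW.
have [n [i [x [xB ii io ->]]]] : exists n (i : nat -> I) (x : nat -> H -> H),
    [/\ forall k, (k <= n)%N -> B (i k) (x k) /\ phi (x k) = 0,
        forall k, (k < n)%N -> i k <> i k.+1, i 0%N = o &
        y = \big[(fun f g : H -> H => f \o g)/idfun]_(k < n.+1) x k].
  elim: yW => {o y} [ o x ox x0|o o' x y ox x0 oo' _ [n [i [z [zB ii io ->]]]]].
    exists 0%N, (fun=> o), (fun=> x); split=> //.
    by rewrite big_ord_recl big_ord0.
  exists n.+1, (fun k => if k is k'.+1 then i k' else o),
    (fun k => if k is k'.+1 then z k' else x); split=> //.
  - by move=> [|k] kn; [split | exact: zB].
  - by case=> [_|k kn]; [rewrite io | exact: ii].
  - by rewrite [RHS]big_ord_recl.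
exact: (free n i x xB ii).
Qed.

Lemma redword_free : (forall o y, redword o y -> phi y = 0) -> freely_independent B phi.
Proof.
move=> Wd n i x xB ii.
suff h : redword (i 0%N) (\big[(fun f g : H -> H => f \o g)/idfun]_(k < n.+1) x k).
  exact: Wd h.
elim: n i x xB ii => [|n IH] i x xB ii.
  by rewrite big_ord_recl big_ord0; have [? ?] := xB 0%N isT; exact: redword1.
rewrite big_ord_recl; have [x0 p0] := xB 0%N isT.
apply: (@redwordS _ (i 1%N)) => //; first exact: ii.
apply: (IH (fun k => i k.+1) (fun k => x k.+1)) => k kn; [exact: xB|exact: ii].
Qed.

Definition word_span : set (H -> H) :=
  lin_span [set y : H -> H | y = idfun \/ exists o, redword o y].

Lemma word_span_id : word_span idfun.
Proof. by apply: sub_lin_span; left. Qed.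

Lemma word_span_word o w : redword o w -> word_span w.
Proof. by move=> ow; apply: sub_lin_span; right; exists o. Qed.

Hypothesis BB : forall o, B o `<=` @bop R H H.
Hypothesis B1 : forall o, B o idfun.
Hypothesis BL : forall o (a : R[i]) x y, B o x -> B o y -> B o (a *: x + y).
Hypothesis BM : forall o x y, B o x -> B o y -> B o (x \o y).
Hypothesis phi1 : phi idfun = 1.
Hypothesis phiL : forall o (a : R[i]) x y, B o x -> B o y ->
  phi (a *: x + y) = a * phi x + phi y.

Let center o x : B o x -> exists x0, [/\ B o x0, phi x0 = 0 & x = phi x *: idfun + x0].
Proof.
move=> ox; exists (- phi x *: idfun + x); split; first exact: BL.
  by rewrite (phiL _ (B1 o) ox) phi1 mulr1 addNr.
by rewrite scaleNr addrA subrr add0r.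
Qed.

Let spanL (a : R[i]) x y : word_span x -> word_span y -> word_span (a *: x + y).
Proof. exact: (lin_span_lin _).2. Qed.

(** Write a as a scalar plus a centred letter. Before a word that starts in another component the
    centred part lengthens the word; before a letter of the same component the two are multiplied
    and the product is centred again. *)
Lemma word_span_mull o a y : B o a -> word_span y -> word_span (a \o y).
Proof.
move=> oa; apply: (lin_span_min (W := [set z : H -> H | word_span (a \o z)])).
  split.
    have a0 : a \o (0 : H -> H) = 0 by apply/funext => v; exact: (bop0 (BB oa)).
    have : word_span (a \o (0 : H -> H)) by rewrite a0; exact: (lin_span_lin _).1.
    by [].
  move=> c x z xS zS; have E : a \o (c *: x + z) = c *: (a \o x) + (a \o z).
    by apply/funext => v; rewrite /= !fctE /= (bopD (BB oa)) (bopZ (BB oa)).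
  have : word_span (a \o (c *: x + z)) by rewrite E; exact: spanL.
  by [].
move=> w [->|[i oW]].
  suff : word_span a by []; have [a0 [oa0 z0 ->]] := center oa.
  by apply: spanL; [exact: word_span_id | apply: word_span_word (redword1 oa0 z0)].
have [|oo'] := pselect (o = i); last first.
  have [a0 [oa0 z0 aE]] := center oa.
  have E : a \o w = phi a *: w + (a0 \o w) by rewrite {1}aE.
  suff : word_span (a \o w) by [].
  by rewrite E; apply: spanL; apply: word_span_word; [exact: oW|exact: redwordS oo' oW].
case: oW => {i w} [ o' x o'x x0|o' o'' x z o'x x0 oo z''] E.
  have ox : B o x by rewrite E.
  suff : word_span (a \o x) by []; have [b [ob b0 ->]] := center (BM oa ox).
  by apply: spanL; [exact: word_span_id | apply: word_span_word (redword1 ob b0)].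
have ox : B o x by rewrite E.
have [b [ob b0 bE]] := center (BM oa ox).
suff : word_span ((a \o x) \o z) by [].
have -> : (a \o x) \o z = phi (a \o x) *: z + (b \o z) by rewrite {1}bE.
apply: spanL; first exact: word_span_word z''.
by rewrite E in ob; apply: word_span_word (redwordS ob b0 oo z'').
Qed.

End ReducedWords.

(** * Freeness of P and the conjugates of Q *)

Section GroupFreeness.
Context {R : realType} {H : hilbertType R} {G : groupType}.
(** [pl p g] stands for the image of p (x) lambda_g, [lam g] for that of 1 (x) lambda_g, and C for
    that of P (x) L(G). *)
Variables (phi : (H -> H) -> R[i]) (C Q : set (H -> H)) (P : Type) (PP : set P).
Variables (pl : P -> G -> H -> H) (lam : G -> H -> H) (phiP : P -> R[i]).
Hypothesis lamM : forall g h, lam g \o lam h = lam (g * h)%g.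
Hypothesis lam1 : lam 1%g = idfun.
Hypothesis lamC : forall g, C (lam g).
Hypothesis phi_lam : forall g, g <> 1%g -> phi (lam g) = 0.
Hypothesis plC : forall p g, PP p -> C (pl p g).
Hypothesis phi_pl : forall p g, PP p -> phiP p = 0 -> phi (pl p g) = 0.
Hypothesis pl_lam : forall p g h k, PP p -> lam g \o pl p h \o lam k = pl p (g * h * k)%g.
Hypothesis free : freely_independent (fun b : bool => if b then C else Q) phi.

Let fam (o : option G) : set (H -> H) := if o is Some g
  then [set lam g \o q \o lam g^-1%g | q in Q] else [set pl p 1%g | p in PP].

Hypothesis phi_conj : forall g q, Q q -> phi (lam g \o q \o lam g^-1%g) = phi q.
Hypothesis phi_pl1 : forall p, PP p -> phi (pl p 1%g) = phiP p.

Let W2 := redword (fun b : bool => if b then C else Q) phi.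

Let lam_word g z : W2 false z -> W2 false (lam g \o z) \/ W2 true (lam g \o z).
Proof.
move=> zW; have [->|/eqP g1] := eqVneq g 1%g; first by left; rewrite lam1.
by right; apply: (@redwordS _ _ _ _ _ true false) => //; exact: phi_lam.
Qed.

(* A reduced word in P and the lam g Q lam g^-1, times lam k, is lam g times a
   reduced word in C and Q, or has a first letter pl p h. *)
Let decompose o w : redword fam phi o w -> forall k,
  if o is Some g then exists2 z, W2 false z & w \o lam k = lam g \o z
  else exists p h, [/\ PP p, phiP p = 0 &
    w \o lam k = pl p h \/ exists2 z, W2 false z & w \o lam k = pl p h \o z].
Proof.
have qW q h : Q q -> phi q = 0 -> W2 false (q \o lam h).
  move=> Qq q0; have [->|/eqP h1] := eqVneq h 1%g.
    by rewrite lam1; exact: (@redword1 _ _ _ _ _ false).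
  apply: (@redwordS _ _ _ _ _ false true) => //.
  by apply: redword1; [exact: lamC | exact: phi_lam].
elim=> {o w} [[g|] x|[g|] [h|] x y].
- move=> [q Qq <-]; rewrite phi_conj // => q0 k.
  by exists (q \o lam (g^-1 * k)%g); [exact: qW | rewrite -lamM].
- move=> [p Pp <-]; rewrite phi_pl1 // => p0 k; exists p, k; split=> //; left.
  have := pl_lam 1%g 1%g k Pp; rewrite lam1 !mul1g => <-; by [].
(* The unitaries between q and the next letter merge to lam (g^-1 h), which is centred because g <>
   h. *)
- move=> [q Qq <-]; rewrite phi_conj // => q0 gh _ IH k; have [z zW zE] := IH k.
  exists (q \o (lam (g^-1 * h)%g \o z)).
    apply: (@redwordS _ _ _ _ _ false true) => //.
    apply: (@redwordS _ _ _ _ _ true false) => //; apply: phi_lam => E.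
    by apply: gh; congr Some; rewrite -[LHS]mulg1 -E mulVKg.
  by rewrite -lamM -[_ \o y \o lam k]/(_ \o (y \o lam k)) zE.
(* Before a letter of P the unitary is absorbed: [lam g^-1 \o pl p h] is one letter of C, still
   centred since phiP p = 0. *)
- move=> [q Qq <-]; rewrite phi_conj // => q0 _ _ IH k.
  have [p [h [Pp p0 E]]] := IH k.
  have pE : lam g^-1%g \o pl p h = pl p (g^-1 * h)%g.
    by have := pl_lam g^-1%g h 1%g Pp; rewrite lam1 mulg1 => <-.
  have pW := plC (g^-1 * h)%g Pp; have pW0 := phi_pl (g^-1 * h)%g Pp p0.
  case: E => [E|[z zW E]].
    exists (q \o pl p (g^-1 * h)%g); last first.
      by rewrite -[_ \o y \o lam k]/(_ \o (y \o lam k)) E -pE.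
    by apply: (@redwordS _ _ _ _ _ false true) => //; exact: redword1.
  exists (q \o (pl p (g^-1 * h)%g \o z)); last first.
    by rewrite -[_ \o y \o lam k]/(_ \o (y \o lam k)) E -pE.
  apply: (@redwordS _ _ _ _ _ false true) => //.
  exact: (@redwordS _ _ _ _ _ true false).
- move=> [p Pp <-]; rewrite phi_pl1 // => p0 _ _ IH k; have [z zW zE] := IH k.
  exists p, h; split=> //; right; exists z => //.
  rewrite -[_ \o y \o lam k]/(_ \o (y \o lam k)) zE.
  by have := pl_lam 1%g 1%g h Pp; rewrite lam1 !mul1g => <-.
- by [].
Qed.

(** The trailing unitary is left arbitrary because both cases serve: k = 1 is freeness of the
    family, and k <> 1 leads to phi (n lam k) = 0 for n in N. *)
Lemma redword_lam0 o w k : redword fam phi o w -> phi (w \o lam k) = 0.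
Proof.
move=> ow; have := decompose ow k; case: o ow => [g|] ow.
  move=> [z zW ->]; case: (lam_word g zW) => h; exact: free_redword h.
move=> [p [h [Pp p0 [->|[z zW ->]]]]]; first exact: phi_pl.
apply: (@free_redword _ _ _ _ _ free true).
apply: (@redwordS _ _ _ _ _ true false) => //; [exact: plC|exact: phi_pl].
Qed.

Lemma conj_family_free : freely_independent fam phi.
Proof.
apply: redword_free => o y oy.
by have := redword_lam0 1%g oy; rewrite lam1.
Qed.

End GroupFreeness.

(** * Generators of von Neumann algebras and normal homomorphisms *)

Section VonNeumannAlgebras.
Context {R : realType}.
Implicit Types H K : hilbertType R.

Lemma the_op_eq H (S : set (H -> H)) z : bop z -> S z ->
  (forall w, bop w -> S w -> w = z) -> the_op S = z.
Proof.
move=> zb Sz Su; rewrite /the_op; case: xgetP => [w _ [/bopE wb Sw]|]; first exact: Su.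
by move/(_ z); case; split=> //; exact/bopE.
Qed.

Lemma the_op_bop H (S : set (H -> H)) : bop (the_op S).
Proof. by rewrite /the_op; case: xgetP => [w _ [/bopE //]|_]; exact: bop_0. Qed.

Lemma bop_lin_set H : lin_set (V := H -> H) (@bop R H H).
Proof. by split; [exact: bop_0 | move=> a x y; exact: bop_lin]. Qed.

Lemma lin_span_star H (S : set (H -> H)) : S `<=` @bop R H H -> S idfun ->
  (forall x y, S x -> S y -> S (x \o y)) -> (forall x, S x -> S (adj x)) ->
  star_algebra (lin_span S).
Proof.
move=> Sb S1 SM Sadj; have [l0 lL] := lin_span_lin S.
have lb := lin_span_min (@bop_lin_set H) Sb.
split; [exact: lb | exact: sub_lin_span | exact: lL | |].
- have ML x : S x -> lin_span S `<=` [set y : H -> H | lin_span S (x \o y)].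
    move=> Sx; have xb := Sb _ Sx; apply: lin_span_min.
      split; first by suff : lin_span S (x \o 0) by []; rewrite (_ : x \o 0 = 0) //;
        apply/funext => v; exact: bop0 xb.
      move=> a y z yS zS; suff : lin_span S (x \o (a *: y + z)) by [].
      rewrite (_ : x \o (a *: y + z) = a *: (x \o y) + (x \o z)); first exact: lL.
      by apply/funext => v; rewrite /= !fctE /= (bopD xb) (bopZ xb).
    by move=> y Sy; apply: sub_lin_span; exact: SM.
  move=> x y xS yS; have : lin_span S `<=` [set z : H -> H | lin_span S (z \o y)].
    apply: lin_span_min; last by move=> z Sz; exact: (ML _ Sz _ yS).
    by split=> // a z w zS wS; exact: (lL a _ _ zS wS).
  by move=> h; exact: (h _ xS).
- have : lin_span S `<=` [set x : H -> H | bop x /\ lin_span S (adj x)].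
    apply: lin_span_min; last first.
      by move=> x Sx; split; [exact: Sb | apply: sub_lin_span; exact: Sadj].
    split; first split; first exact: bop_0.
      rewrite (_ : adj 0 = 0) //; apply/esym/adj_unique; first exact: bop_0.
      by move=> v w; rewrite dot0l dot0r.
    move=> a x y [xb xS] [yb yS]; split; first exact: bop_lin.
    by rewrite adj_lin //; exact: lL.
  by move=> h x /h[].
Qed.

(** The x in A with f x in C form a *-algebra containing B. Membership of f x in C = C'' is tested
    by the normal functionals y |-> <[f y, T] k, k'> with T in the commutant of C, so it passes to
    the bicommutant. *)
Lemma vN_preimage H K (A B : set (H -> H)) (C C' : set (K -> K)) f :
  von_neumann_algebra A -> von_neumann_algebra C -> C' `<=` @bop R K K ->
  normal_star_hom A C' f -> B `<=` A -> (forall x, B x -> C (f x)) ->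
  forall x, bicommutant B x -> C (f x).
Proof.
move=> AN CN C'b [fH fN] BA BC.
have AA := vN_star AN; have CA := vN_star CN; have [Ab A1 AL AM Aadj] := AA.
have [Cb C1 CL CM Cadj] := CA; have [fC f1 fL fM fS] := fH.
have fb x : A x -> bop (f x) by move=> /fC/C'b.
pose D := [set x | A x /\ C (f x)].
have DA : D `<=` A by move=> x [].
have DD : star_algebra D.
  split.
  - by move=> x [/Ab].
  - by split=> //; rewrite f1.
  - by move=> a x y [Ax Cx] [Ay Cy]; split; [exact: AL | rewrite fL //; exact: CL].
  - by move=> x y [Ax Cx] [Ay Cy]; split; [exact: AM | rewrite fM //; exact: CM].
  - by move=> x [Ax Cx]; split; [exact: Aadj | rewrite fS //; exact: Cadj].
have BD : B `<=` D by move=> x Bx; split; [exact: BA | exact: BC].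
move=> x /(bicommutantS BD) xD.
have Ax : A x by have [_ _ <-] := AN; exact: bicommutantS DA _ xD.
have [_ _ <-] := CN; split; first exact/bopE/fb.
move=> T TC; have Tb := commutant_bop TC; have fxb := fb _ Ax.
apply/funext => k; apply: dotp_ext => k' /=.
pose g y : R[i]^o := dotp (f y (T k)) k' - dotp (f y k) (adj T k').
have gN : normal_functional A g.
  by apply: normal_functionalB; exact: normal_map_vector.
have g0 y : D y -> g y = 0.
  move=> [Ay Cy]; have [_ /(_ _ Cy) E] := TC.
  have E' : T (f y k) = f y (T k) := congr1 (@^~ k) E.
  by rewrite /g -E' (adjP _ _ Tb) subrr.
have /eqP := normal_zero DD DA gN g0 xD Ax.
by rewrite subr_eq0 => /eqP ->; rewrite (adjP _ _ Tb).
Qed.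

Lemma vn_tensor_gens_bop H K (T : tensor_space H K) (A : set (H -> H)) (B : set (K -> K)) :
  [set z | exists x y, [/\ A x, B y & z = tens_op T x y]] `<=` @bop R T T.
Proof. by move=> _ [x [y [_ _ ->]]]; exact: tens_op_bopW. Qed.

Lemma vn_tensor_gen H K (T : tensor_space H K) A B x y :
  A x -> B y -> vn_tensor T A B (tens_op T x y).
Proof.
by move=> Ax By; apply: sub_bicommutant; [exact: vn_tensor_gens_bop | exists x, y].
Qed.

Lemma vn_tensor_vN H K (T : tensor_space H K) A B :
  @star_algebra R H A -> @star_algebra R K B -> von_neumann_algebra (vn_tensor T A B).
Proof.
move=> [Ab _ _ _ Aadj] [Bb _ _ _ Badj]; apply: bicommutant_vN.
  exact: vn_tensor_gens_bop.
move=> _ [x [y [Ax By ->]]]; exists (adj x), (adj y).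
by split; [exact: Aadj|exact: Badj|rewrite tens_op_adj //; [exact: Ab|exact: Bb]].
Qed.

(* P (x) L(G) is generated by P (x) 1 and 1 (x) lambda_g. *)
Lemma vn_tensor_group (G : groupType) (L : l2_space R G) H (T : tensor_space H L)
    (P : set (H -> H)) : star_algebra P ->
  vn_tensor T P (group_vna L) `<=` bicommutant
    ([set tens_op T x idfun | x in P] `|` range (fun g => tens_op T idfun (lambda L g))).
Proof.
move=> PA; have [Pb P1 _ _ _] := PA; set S := _ `|` _.
have Sb : S `<=` @bop R T T.
  by move=> _ [[x _ <-]|[g _ <-]]; exact: tens_op_bopW.
have SadjP x : S x -> S (adj x).
  move=> [[y Py <-]|[g _ <-]].
    by left; exists (adj y); [case: PA => _ _ _ _; apply | rewrite tens_op_adj ?adj_id //; [exact: Pb|exact: bop_id]].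
  right; exists g^-1%g => //; rewrite tens_op_adj ?adj_id ?adj_lambda //.
    exact: bop_id.
  exact: lambda_bop.
have SN := bicommutant_vN Sb SadjP; have [_ _ _ SM _] := vN_star SN.
rewrite -[X in _ `<=` X](bicommutantK Sb); apply: bicommutantS.
move=> _ [x [y [Px Ly ->]]]; have xb := Pb _ Px; have yb := commutant_bop Ly.
have idb := @bop_id R H; have idL := @bop_id R L.
have -> : tens_op T x y = tens_op T x idfun \o tens_op T idfun y.
  by rewrite tens_op_comp.
apply: SM; first by apply: sub_bicommutant => //; left; exists x.
split; first exact/bopE/tens_op_bopW.
move=> X XS; have Xb := commutant_bop XS.
have yTb := tens_op_bop T idb yb.
apply: (tens_ext (bop_comp yTb Xb) (bop_comp Xb yTb)) => u v /=.
apply/eqP; rewrite -subr_eq0; apply/eqP/(@tens_sep _ _ _ T) => _ [u' [v' ->]].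
rewrite dotBr.
have Jb := tens_bopr T u; have J'b := tens_bopr T u'.
(* The slice of X between u and u' in the first factor commutes with every lambda_g, hence with y;
   slices determine X. *)
pose Z := hadj (tens T u') \o X \o tens T u.
have Zb : bop Z by exact: bop_comp (bop_comp (hadj_bop J'b) Xb) Jb.
have ZL : commutant (range (lambda L)) Z.
  split; first exact/bopE.
  move=> _ [g _ <-]; have gb := lambda_bop L g.
  apply/funext => k; apply: dotp_extr => k'; rewrite /= /Z /=.
  have XE : X (tens_op T idfun (lambda L g) (tens T u k)) =
      tens_op T idfun (lambda L g) (X (tens T u k)).
    have [_ h] := XS; have := h (tens_op T idfun (lambda L g)).
    by move=> /(_ (or_intror (ex_intro2 _ _ g I erefl))) /(congr1 (@^~ (tens T u k))).
  rewrite (tens_opE _ _ _ idb gb) in XE.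
  rewrite -(hadjP J'b) XE (adjPl _ _ (tens_op_bop T idb gb)) tens_op_adj // adj_id.
  by rewrite (tens_opE _ _ _ idb (adj_bop gb)) (hadjP J'b) -(adjPl _ _ gb).
have ZE : y (Z v) = Z (y v) by have [_ /(_ _ ZL) h] := Ly; have := congr1 (@^~ v) h.
have Xy : X (tens_op T idfun y (tens T u v)) = X (tens T u (y v)).
  by rewrite (tens_opE _ _ _ idb yb).
have E1 : dotp (tens T u' v') (X (tens T u (y v))) = dotp v' (Z (y v)).
  by rewrite (hadjP J'b).
have E2 : dotp (tens T u' v') (tens_op T idfun y (X (tens T u v))) = dotp v' (y (Z v)).
  rewrite (adjPl _ _ yTb) tens_op_adj // adj_id (tens_opE _ _ _ idb (adj_bop yb)).
  by rewrite (hadjP J'b) -(adjPl _ _ yb).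
by rewrite Xy E1 E2 ZE subrr.
Qed.

Lemma normal_functional_comp H K (A : set (H -> H)) (B : set (K -> K))
    (f : (H -> H) -> (K -> K)) (g : (K -> K) -> R[i]^o) :
  set_fun A B f -> normal_map A f -> normal_functional B g ->
  normal_functional A (g \o f).
Proof.
move=> fAB fN gN F x FF FA Ax Fx.
have FB : F (f @^-1` B) by apply: filterS FA => y; exact: fAB.
exact: (gN (f @ F) (f x) (fmap_proper_filter f FF) FB (fAB _ Ax) (fN F x FF FA Ax Fx)).
Qed.

End VonNeumannAlgebras.

(** * Unitary conjugation, amplified intertwiners and matrix units *)

Section UnitaryConjugation.
Context {R : realType}.
Implicit Types H K : hilbertType R.

Lemma commutant_vN H (S : set (H -> H)) : S `<=` @bop R H H ->
  (forall x, S x -> S (adj x)) -> von_neumann_algebra (commutant S).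
Proof.
move=> Sb Sadj; have [cb _ _ _ cadj] := commutant_star Sb Sadj.
split; [by move=> x /cb/bopE | exact: cadj|].
by rewrite {1}/bicommutant -[commutant (commutant S)]/(bicommutant S) commutant_bicommutant.
Qed.

Lemma conj_commutant H K (U : H -> K) (V : K -> H) (S : set (K -> K)) x :
  bop U -> bop V -> cancel V U -> commutant S x ->
  commutant [set V \o y \o U | y in S] (V \o x \o U).
Proof.
move=> Ub Vb UV [/bopE xb xS]; split; first exact/bopE/(bop_comp (bop_comp Vb xb) Ub).
move=> _ [y Sy <-]; apply/funext => h /=; rewrite !UV.
by congr V; exact: (congr1 (@^~ (U h)) (xS _ Sy)).
Qed.

Lemma conj_bicommutant H K (U : H -> K) (V : K -> H) (S : set (K -> K)) x :
  bop U -> bop V -> cancel V U -> cancel U V -> bicommutant S x ->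
  bicommutant [set V \o y \o U | y in S] (V \o x \o U).
Proof.
move=> Ub Vb UV VU [/bopE xb xS]; split; first exact/bopE/(bop_comp (bop_comp Vb xb) Ub).
move=> T TS; have := conj_commutant Vb Ub VU TS.
have -> : [set U \o y \o V | y in [set V \o y \o U | y in S]] = S.
  apply/seteqP; split=> [_ [_ [y Sy <-] <-]|y Sy].
    by rewrite (_ : U \o (V \o y \o U) \o V = y) //; apply/funext => k /=; rewrite !UV.
  exists (V \o y \o U); first by exists y.
  by apply/funext => k /=; rewrite !UV.
move=> /xS E; apply/funext => h /=.
have := congr1 V (congr1 (@^~ (U h)) E); by rewrite /= !VU.
Qed.

(* Amplifying intertwiners keeps their ranges total. *)
Lemma tens_intertwiners_sep H H' K (T : tensor_space H K) (T' : tensor_space H' K)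
    (I : Type) (S : set I) (a : I -> H -> H) (b : I -> H' -> H') (B : set (K -> K)) :
  (forall i, S i -> bop (a i)) -> (forall i, S i -> bop (b i)) -> B `<=` @bop R K K ->
  sep (ranges (intertwiners S a b)) ->
  sep (ranges (intertwiners [set p : I * (K -> K) | S p.1 /\ B p.2]
    (fun p => tens_op T (a p.1) p.2) (fun p => tens_op T' (b p.1) p.2))).
Proof.
move=> aB bB BB sab d dP; apply: (@tens_sep _ _ _ T') => _ [u [v ->]].
rewrite (hadjP (tens_bopl T' v)).
rewrite (sab (hadj (fun u => tens T' u v) d)) ?dot0r // => _ [J [h [[Jb JI] ->]]].
rewrite -(hadjP (tens_bopl T' v)).
have [z [zb zE]] := tens_map_ex T T' Jb.
apply: dP; exists z, (tens T h v); split; last by rewrite zE.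
split=> // -[i y] /= [Si By]; have ab := aB _ Si; have bb := bB _ Si; have yb := BB _ By.
apply: (tens_ext (bop_comp (tens_op_bopW _ _ _) zb) (bop_comp zb (tens_op_bopW _ _ _))) => u' v' /=.
rewrite zE (tens_opE _ _ _ bb yb) (tens_opE _ _ _ ab yb) zE.
by congr (tens T' _ _); exact: (congr1 (@^~ u') (JI _ Si)).
Qed.

Section L2Operators.
Variables (G : groupType) (L : l2_space R G) (H : hilbertType R) (T : tensor_space H L).

Lemma tens_delta2_sep (TT : tensor_space T L) :
  sep [set w | exists u h k, w = tens TT (tens T u (delta L h)) (delta L k)].
Proof.
move=> d dP; apply: tens_delta_sep => _ [t [k ->]].
rewrite coordP (_ : coord k d = 0) ?dot0r //.
apply: (@tens_delta_sep R G L H T) => _ [u [h ->]].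
by rewrite -coordP; apply: dP; exists u, h, k.
Qed.

(** The rank-one projection onto delta_1; with the translations lambda_g it yields matrix units of
    B(l2(G)). *)
Definition unit_proj : L -> L := fun l => dotp l (delta L 1%g) *: delta L 1%g.

Lemma unit_proj_bop : bop unit_proj.
Proof.
have s1 : sqn (delta L 1%g) = 1 by rewrite /sqn delta_orthonormal eqxx.
split; first by move=> a u v; rewrite /unit_proj dotDl dotZl scalerDl scalerA.
(* The bound is 2 because |<l, delta_1>|^2 is the sum of the squared real parts at l and at i l,
   each at most |l|^2. *)
exists 2 => // l; rewrite /unit_proj sqnZ s1 mulr1.
have h1 := sqrRe_dotp l (delta L 1%g); have h2 := sqrRe_dotp ('i *: l) (delta L 1%g).
rewrite s1 mulr1 in h1; rewrite s1 mulr1 sqnZ dotZl Re_iN sqrrN /= in h2.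
rewrite expr0n expr1n add0r mul1r in h2.
by move: h1 h2; lra.
Qed.

Lemma unit_proj_linfty : linfty L unit_proj.
Proof.
exists (fun g => (g == 1%g)%:R); split.
  by exists 1 => g; case: (g == 1%g); rewrite ?normr1 // normr0.
apply/esym/the_op_eq; first exact: unit_proj_bop.
  move=> g; rewrite /unit_proj delta_orthonormal.
  by case: eqP => [->|_] //; rewrite !scale0r.
move=> w wb wE; apply: (delta_ext wb unit_proj_bop) => g.
rewrite wE /unit_proj delta_orthonormal.
by case: eqP => [->|_] //; rewrite !scale0r.
Qed.

(** Either [mult_op c] meets its specification or it is the default 0; both are diagonal. *)
Lemma linfty_diag y : linfty L y -> bop y /\ exists c, forall g, y (delta L g) = c g *: delta L g.
Proof.
move=> [c [_ ->]]; split; first exact: the_op_bop.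
rewrite /mult_op /the_op; case: xgetP => [w _ [_ wP]|_]; first by exists c.
by exists (fun=> 0) => g; rewrite scale0r.
Qed.

Lemma tens_unit_proj t : tens_op T idfun unit_proj t = tens T (coord 1%g t) (delta L 1%g).
Proof.
have idb := @bop_id R H.
suff : tens_op T idfun unit_proj =
    (fun u => tens T u (delta L 1%g)) \o coord 1%g by move/(congr1 (@^~ t)).
apply: (tens_delta_ext (tens_op_bop T idb unit_proj_bop)).
  exact: (bop_comp (tens_bopl T (delta L 1%g)) (@coord_bop R G L H T 1%g)).
move=> u h /=; rewrite (tens_opE _ _ _ idb unit_proj_bop) coord_tens /unit_proj.
rewrite delta_orthonormal eq_sym; case: eqP => _; rewrite ?scale1r // !scale0r.
by rewrite (bop0 (tens_bopl T _)) (bop0 (tens_bopr T _)).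
Qed.

(* The commutant of 1 (x) B(l2(G)) is B(H) (x) 1. *)
Lemma commute_matrix_units (X : T -> T) : bop X ->
  (forall t, X (tens_op T idfun unit_proj t) = tens_op T idfun unit_proj (X t)) ->
  (forall h t, X (tens_op T idfun (lambda L h) t) = tens_op T idfun (lambda L h) (X t)) ->
  exists2 y, bop y & X = tens_op T y idfun.
Proof.
move=> Xb Xe Xl; have idb := @bop_id R H; have idL := @bop_id R L.
pose J u := tens T u (delta L 1%g); have Jb : bop J by exact: tens_bopl.
(* y is the corner of X at delta_1. Commuting with the projection keeps X (u (x) delta_1) in that
   corner, and lambda_h carries it to delta_h. *)
pose y := coord 1%g \o X \o J.
have yb : bop y by exact: (bop_comp (bop_comp (@coord_bop R G L H T 1%g) Xb) Jb).
exists y => //; apply: (tens_delta_ext Xb (tens_op_bop T yb idL)) => u h.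
rewrite (tens_opE _ _ _ yb idL).
have lE v : tens T v (delta L h) = tens_op T idfun (lambda L h) (J v).
  by rewrite (tens_opE _ _ _ idb (lambda_bop L h)) lambdaE mulg1.
have JE : J u = tens_op T idfun unit_proj (J u).
  by rewrite tens_unit_proj coord_tens eqxx scale1r.
by rewrite !lE Xl JE Xe tens_unit_proj.
Qed.

End L2Operators.

End UnitaryConjugation.

(** * The free product M, the algebra N and the action by conjugation *)

Section CoactionTheorem.
Context {R : realType} {G : groupType} (L : l2_space R G).
Variables (HP HQ HM : hilbertType R).
Variables (P : set (HP -> HP)) (phiP : (HP -> HP) -> R[i]).
Variables (Q : set (HQ -> HQ)) (phiQ : (HQ -> HQ) -> R[i]).
Variables (TP : tensor_space HP L) (psi : (TP -> TP) -> R[i]).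
Variables (M : set (HM -> HM)) (phi : (HM -> HM) -> R[i]).
Variables (i1 : (TP -> TP) -> (HM -> HM)) (i2 : (HQ -> HQ) -> (HM -> HM)).
Variables (TM : tensor_space HM L) (TMM : tensor_space TM L).
Variable Gamma : (HM -> HM) -> (TM -> TM).

Let iP := fun x : HP -> HP => i1 (tens_op TP x idfun).
Let lam := fun g : G => i1 (tens_op TP idfun (lambda L g)).
Let conj := fun (g : G) (x : HM -> HM) => lam g \o x \o adj (lam g).
Let N := bicommutant
  (iP @` P `|` \bigcup_(g in [set: G]) [set conj g (i2 q) | q in Q]).

Hypothesis Gcount : countable [set: G].
Hypothesis PN : von_neumann_algebra P.
Hypothesis QN : von_neumann_algebra Q.
Hypothesis psiP : is_product_state P phiP (group_vna L) (group_trace L) psi.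
Hypothesis i1E : state_embedding (vn_tensor TP P (group_vna L)) psi M phi i1.
Hypothesis i2E : state_embedding Q phiQ M phi i2.
Hypothesis Mfree : is_free_product
  (fun b : bool => if b then i1 @` vn_tensor TP P (group_vna L) else i2 @` Q) M phi.
Hypothesis GammaH : normal_star_hom M (vn_tensor TM M (group_vna L)) Gamma.
Hypothesis GammaP : forall x, P x -> Gamma (iP x) = tens_op TM (iP x) idfun.
Hypothesis GammaQ : forall x, Q x -> Gamma (i2 x) = tens_op TM (i2 x) idfun.
Hypothesis GammaL : forall g, Gamma (lam g) = tens_op TM (lam g) (lambda L g).

Local Notation VT := (vn_tensor TP P (group_vna L)).

Let MN : von_neumann_algebra M. Proof. by case: Mfree. Qed.
Let MA : star_algebra M := vN_star MN.
Let Mb : M `<=` @bop R HM HM := vN_bop MN.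
Let PA : star_algebra P := vN_star PN.
Let Pb : P `<=` @bop R HP HP := vN_bop PN.
Let QA : star_algebra Q := vN_star QN.
Let LA : star_algebra (group_vna L) := vN_star (group_vna_vN L).
Let VTN : von_neumann_algebra VT := vn_tensor_vN TP PA LA.
Let P1 : P idfun. Proof. by case: PA. Qed.
Let L1 : group_vna L idfun. Proof. by case: LA. Qed.
Let idb (H : hilbertType R) : bop (idfun : H -> H) := @bop_id R H.

Let VTPl p g : P p -> VT (tens_op TP p (lambda L g)).
Proof. by move=> Pp; apply: vn_tensor_gen => //; exact: lambda_group_vna. Qed.

(** The image of p (x) lambda_g in M, which contains both [lam g] (p = 1) and [iP p] (g = 1). *)
Let pl p g := i1 (tens_op TP p (lambda L g)).

Let i1M x : VT x -> M (i1 x).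
Proof. by have [[[h _ _ _ _] _] _] := i1E; exact: h. Qed.
Let i1_comp x y : VT x -> VT y -> i1 (x \o y) = i1 x \o i1 y.
Proof. by have [[[_ _ _ h _] _] _] := i1E; exact: h. Qed.
Let i1_adj x : VT x -> i1 (adj x) = adj (i1 x).
Proof. by have [[[_ _ _ _ h] _] _] := i1E; exact: h. Qed.
Let phi_i1 x : VT x -> phi (i1 x) = psi x.
Proof. by have [_ h] := i1E; exact: h. Qed.
Let i2M x : Q x -> M (i2 x).
Proof. by have [[[h _ _ _ _] _] _] := i2E; exact: h. Qed.

Let plM p g : P p -> M (pl p g). Proof. by move=> Pp; apply/i1M/VTPl. Qed.
Let lamM g : M (lam g). Proof. exact: plM. Qed.
Let lamb g : bop (lam g). Proof. exact/Mb/lamM. Qed.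

Let pl_comp p g q h : P p -> P q -> pl p g \o pl q h = pl (p \o q) (g * h)%g.
Proof.
move=> Pp Pq; rewrite /pl -i1_comp ?tens_op_comp ?lambdaM //;
  by [exact: VTPl | exact: Pb | exact: lambda_bop].
Qed.

Let lam_mul g h : lam g \o lam h = lam (g * h)%g.
Proof. exact: (pl_comp g h P1 P1). Qed.

Let lam_one : lam 1%g = idfun.
Proof. by rewrite /lam lambda1 tens_op_id; have [[[_ h _ _ _] _] _] := i1E. Qed.

Let adj_lam g : adj (lam g) = lam g^-1%g.
Proof.
rewrite /lam -i1_adj; last exact: VTPl.
by rewrite tens_op_adj ?adj_id ?adj_lambda //; exact: lambda_bop.
Qed.

Let iPE p : iP p = pl p 1%g. Proof. by rewrite /iP /pl lambda1. Qed.

Let iPM p : P p -> M (iP p). Proof. by rewrite iPE; exact: plM. Qed.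

Let conjE g x : conj g x = lam g \o x \o lam g^-1%g.
Proof. by rewrite /conj adj_lam. Qed.

Let M_comp x y : M x -> M y -> M (x \o y).
Proof. by have [_ _ _ h _] := MA; exact: h. Qed.

Let conjM g x : M x -> M (conj g x).
Proof. by move=> Mx; rewrite conjE; apply: M_comp => //; exact: M_comp. Qed.

Let pl_lam p g h k : P p -> lam g \o pl p h \o lam k = pl p (g * h * k)%g.
Proof. by move=> Pp; rewrite /lam -/(pl _ _) -/(pl _ _) !pl_comp. Qed.

Let conj_iP g p : P p -> conj g (iP p) = iP p.
Proof. by move=> Pp; rewrite conjE !iPE pl_lam // mulg1 mulgV. Qed.

Let conj_conj g h x : conj g (conj h x) = conj (g * h)%g x.
Proof.
rewrite !conjE -lam_mul invgM -lam_mul; by [].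
Qed.

Let conj1 x : conj 1%g x = x. Proof. by rewrite conjE invg1 lam_one. Qed.

Let phiF : faithful_normal_state M phi. Proof. by case: Mfree. Qed.
Let phi_lin (a : R[i]) x y : M x -> M y -> phi (a *: x + y) = a * phi x + phi y.
Proof. by have [[h _ _ _] _] := phiF; exact: h. Qed.
Let phi1 : phi idfun = 1. Proof. by have [[_ h _ _] _] := phiF. Qed.
Let phiN : normal_functional M phi. Proof. by have [[_ _ _ h] _] := phiF. Qed.

Let phi_pl p g : P p -> phi (pl p g) = phiP p * (g == 1%g)%:R.
Proof.
move=> Pp; rewrite /pl phi_i1; last exact: VTPl.
have [_ h] := psiP; rewrite h //; last exact: lambda_group_vna.
by rewrite group_trace_lambda.
Qed.

Let phi_lam g : g <> 1%g -> phi (lam g) = 0.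
Proof. by move=> /eqP g1; rewrite (phi_pl g P1) (negPf g1) mulr0. Qed.

Let GN := iP @` P `|` \bigcup_(g in [set: G]) [set conj g (i2 q) | q in Q].

Let GN_M : GN `<=` M.
Proof. by move=> _ [[p Pp <-]|[g _ [q Qq <-]]]; [exact: iPM|apply: conjM; exact: i2M]. Qed.

Let GNb : GN `<=` @bop R HM HM := subset_trans GN_M Mb.

Let adj_conj g x : M x -> adj (conj g x) = conj g (adj x).
Proof.
move=> Mx; have xb := Mb Mx; have gb := lamb g; have gb' := lamb g^-1%g.
rewrite !conjE (adj_comp (bop_comp gb xb) gb') (adj_comp gb xb) !adj_lam invgK.
by [].
Qed.

Let GN_adj x : GN x -> GN (adj x).
Proof.
move=> [[p Pp <-]|[g _ [q Qq <-]]].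
  left; exists (adj p); first by have [_ _ _ _] := PA; apply.
  rewrite /iP -i1_adj ?tens_op_adj ?adj_id //; first exact: Pb.
  by rewrite -(lambda1 L); exact: VTPl.
right; exists g => //; rewrite adj_conj; last exact: i2M.
exists (adj q); first by have [_ _ _ _] := QA; apply.
by have [[[_ _ _ _ h] _] _] := i2E; rewrite h.
Qed.

Let NN : von_neumann_algebra N := bicommutant_vN GNb GN_adj.
Let NA : star_algebra N := vN_star NN.
Let Nb : N `<=` @bop R HM HM := vN_bop NN.
Let GN_N : GN `<=` N := sub_bicommutant GNb.
Let NM : N `<=` M.
Proof. by have [_ _ <-] := MN; exact: bicommutantS GN_M. Qed.

Let GN_conj g x : GN x -> GN (conj g x).
Proof.
move=> [[p Pp <-]|[h _ [q Qq <-]]]; first by left; exists p => //; rewrite conj_iP.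
by right; exists (g * h)%g => //; exists q => //; rewrite conj_conj.
Qed.

Let lamK g : lam g \o lam g^-1%g = idfun.
Proof. by rewrite lam_mul mulgV lam_one. Qed.

Let lamVK g : lam g^-1%g \o lam g = idfun.
Proof. by rewrite lam_mul mulVg lam_one. Qed.

(** Conjugation by [lam g] permutes the generators of N, so it preserves their commutant, and then
    N. *)
Let N_conj g x : N x -> N (conj g x).
Proof.
move=> Nx; have xb := Nb Nx; split; first exact/bopE/Mb/conjM/NM.
move=> T TG; have Tb := commutant_bop TG.
have cT : commutant GN (conj g^-1%g T).
  split; first by rewrite conjE invgK; apply/bopE; apply: bop_comp (lamb _); exact: bop_comp.
  move=> y /(GN_conj g) yG; have [_ /(_ _ yG) E] := TG.
  have E2 := congr1 (conj g^-1%g) E.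
  have cc u v : conj g^-1%g (u \o v) = conj g^-1%g u \o conj g^-1%g v.
    rewrite !conjE invgK; apply/funext => w /=.
    by have -> : lam g (lam g^-1%g (v (lam g w))) = v (lam g w) := congr1 (@^~ _) (lamK g).
  rewrite (cc T (conj g y)) (cc (conj g y) T) (conj_conj g^-1%g g y) mulVg conj1 in E2.
  exact: E2.
have [_ /(_ _ cT) E] := Nx.
have cc u v : conj g (u \o v) = conj g u \o conj g v.
  rewrite !conjE; apply/funext => w /=.
  by have -> : lam g^-1%g (lam g (v (lam g^-1%g w))) = v (lam g^-1%g w)
    := congr1 (@^~ _) (lamVK g).
have E2 := congr1 (conj g) E.
rewrite (cc x (conj g^-1%g T)) (cc (conj g^-1%g T) x) (conj_conj g g^-1%g T) in E2.
by rewrite mulgV conj1 in E2.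
Qed.

(** * Freeness in N and the vanishing of phi on N lam g for g <> 1 *)

Let BO (o : option G) : set (HM -> HM) :=
  if o is Some g then (conj g \o i2) @` Q else iP @` P.

Let i2_lin (a : R[i]) x y : Q x -> Q y -> i2 (a *: x + y) = a *: i2 x + i2 y.
Proof. by have [[[_ _ h _ _] _] _] := i2E; exact: h. Qed.
Let i2_comp x y : Q x -> Q y -> i2 (x \o y) = i2 x \o i2 y.
Proof. by have [[[_ _ _ h _] _] _] := i2E; exact: h. Qed.
Let i2_id : i2 idfun = idfun.
Proof. by have [[[_ h _ _ _] _] _] := i2E. Qed.
Let iP_id : iP idfun = idfun.
Proof. by rewrite /iP tens_op_id; have [[[_ h _ _ _] _] _] := i1E. Qed.
Let Q1 : Q idfun. Proof. by case: QA. Qed.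

Let VTiP x : P x -> VT (tens_op TP x idfun).
Proof. by rewrite -(lambda1 L); exact: VTPl. Qed.

Let iP_lin (a : R[i]) x y : P x -> P y -> iP (a *: x + y) = a *: iP x + iP y.
Proof.
move=> Px Py; rewrite /iP (tens_op_linl TP a (Pb Px) (Pb Py) (idb L)).
by have [[[_ _ h _ _] _] _] := i1E; apply: h; exact: VTiP.
Qed.

Let iP_comp x y : P x -> P y -> iP (x \o y) = iP x \o iP y.
Proof. by move=> Px Py; rewrite !iPE pl_comp // mul1g. Qed.

Let iP_adj x : P x -> iP (adj x) = adj (iP x).
Proof.
move=> Px; rewrite /iP -i1_adj; last exact: VTiP.
by rewrite (tens_op_adj TP (Pb Px) (idb L)) adj_id.
Qed.

Let conj_comp g x y : conj g (x \o y) = conj g x \o conj g y.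
Proof.
rewrite !conjE; apply/funext => w /=.
by have -> : lam g^-1%g (lam g (y (lam g^-1%g w))) = y (lam g^-1%g w)
  := congr1 (@^~ _) (lamVK g).
Qed.

Let conj_lin g (a : R[i]) x y : conj g (a *: x + y) = a *: conj g x + conj g y.
Proof.
by apply/funext => w; rewrite !conjE /= !fctE /= (bopD (lamb g)) (bopZ (lamb g)).
Qed.

Let conj_id g : conj g idfun = idfun.
Proof. by rewrite conjE; exact: lamK. Qed.

Let free2 : freely_independent (fun b : bool => if b then i1 @` VT else i2 @` Q) phi.
Proof. by case: Mfree. Qed.

Let lamC g : (i1 @` VT) (lam g).
Proof. by exists (tens_op TP idfun (lambda L g)) => //; exact: VTPl. Qed.

Let plC p g : P p -> (i1 @` VT) (pl p g).
Proof. by move=> Pp; exists (tens_op TP p (lambda L g)) => //; exact: VTPl. Qed.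

Let phi_pl0 p g : P p -> phiP p = 0 -> phi (pl p g) = 0.
Proof. by move=> Pp p0; rewrite phi_pl // p0 mul0r. Qed.

Let phi_pl1 p : P p -> phi (pl p 1%g) = phiP p.
Proof. by move=> Pp; rewrite phi_pl // eqxx mulr1. Qed.

(** For g <> 1 the centred part r of an element of Q gives a reduced word lam g, r, lam g^-1 of
    length 3, on which phi vanishes; the scalar part is fixed by conjugation. *)
Let phi_conj g q : (i2 @` Q) q -> phi (lam g \o q \o lam g^-1%g) = phi q.
Proof.
move=> [r Qr <-]; have [->|/eqP g1] := eqVneq g 1%g; first by rewrite invg1 lam_one.
have gv : g^-1%g <> 1%g by move=> E; apply: g1; rewrite -(invgK g) E invg1.
pose c := phi (i2 r); have Mr := i2M Qr.
have Mid : M idfun by case: MA.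
have q0 : phi (i2 (- c *: idfun + r)) = 0.
  by rewrite i2_lin // i2_id phi_lin // phi1 mulr1 addNr.
have Qr0 : Q (- c *: idfun + r) by have [_ _ h _ _] := QA; exact: h.
have w0 : phi (lam g \o (i2 (- c *: idfun + r) \o lam g^-1%g)) = 0.
  apply: (@free_redword _ _ _ _ _ free2 true).
  apply: (@redwordS _ _ _ _ _ true false); [exact: lamC|exact: phi_lam|by []|].
  apply: (@redwordS _ _ _ _ _ false true); [by exists (- c *: idfun + r)|exact: q0|by []|].
  by apply: (@redword1 _ _ _ _ _ true); [exact: (lamC g^-1%g)|exact: phi_lam].
have Mc := conjM g (i2M Qr0).
have E : i2 r = c *: idfun + i2 (- c *: idfun + r).
  by rewrite i2_lin // i2_id scaleNr addrA subrr add0r.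
rewrite -conjE {1}E conj_lin conj_id phi_lin // phi1 conjE -[_ \o _ \o _]/(lam g \o (_ \o _)) w0 addr0 mulr1.
by [].
Qed.

Let free_sub (I : Type) (B B' : I -> set (HM -> HM)) : (forall o, B o `<=` B' o) ->
  freely_independent B' phi -> freely_independent B phi.
Proof.
move=> BB' f n i x xB; apply: f => k kn; have [Bk k0] := xB k kn; split=> //.
exact: BB'.
Qed.

Let fam (o : option G) : set (HM -> HM) := if o is Some g
  then [set lam g \o q \o lam g^-1%g | q in i2 @` Q] else [set pl p 1%g | p in P].

Let BO_fam o : BO o = fam o.
Proof.
case: o => [g|] /=; apply/seteqP; split=> x [].
- by move=> q Qq <-; exists (i2 q); [exists q | rewrite -conjE].
- by move=> _ [q Qq <-] <-; exists q => //=; rewrite conjE.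
- by move=> p Pp <-; exists p => //; rewrite iPE.
- by move=> p Pp <-; exists p => //; rewrite iPE.
Qed.

Let BO_free : freely_independent BO phi.
Proof.
apply: (@free_sub _ _ fam); first by move=> o; rewrite BO_fam.
exact: (conj_family_free lam_mul lam_one lamC phi_lam plC phi_pl0 pl_lam free2
  phi_conj phi_pl1).
Qed.

Let BO_word0 o w k : redword BO phi o w -> phi (w \o lam k) = 0.
Proof.
have -> : BO = fam by apply/funext => o'; exact: BO_fam.
exact: (redword_lam0 lam_mul lam_one lamC phi_lam plC phi_pl0 pl_lam free2
  phi_conj phi_pl1).
Qed.

Let BO_M o : BO o `<=` M.
Proof.
by case: o => [g|] _ [x Qx <-]; [apply/conjM/i2M | exact: iPM].
Qed.

Let BO_GN o : BO o `<=` GN.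
Proof. by case: o => [g|] _ [x Qx <-]; [right; exists g => //; exists x|left; exists x]. Qed.

Let GN_BO x : GN x -> exists2 o, BO o x & BO o (adj x).
Proof.
move=> [[p Pp <-]|[g _ [q Qq <-]]].
  exists None; first by exists p.
  by exists (adj p); [have [_ _ _ _] := PA; apply | rewrite iP_adj].
exists (Some g); first by exists q.
exists (adj q); first by have [_ _ _ _] := QA; apply.
by rewrite /= adj_conj; [have [[[_ _ _ _ h] _] _] := i2E; rewrite h|exact: i2M].
Qed.

Let WS := word_span BO phi.

Let WS_mull o a y : BO o a -> WS y -> WS (a \o y).
Proof.
have [_ _ PL PM _] := PA; have [_ _ QL QM _] := QA.
apply: word_span_mull.
- by move=> o' x /BO_M/Mb.
- by case=> [g|]; exists idfun => //=; rewrite i2_id conj_id.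
- case=> [g|] c x z /= [x' Qx <-] [z' Qz <-]; exists (c *: x' + z').
  + exact: QL.
  + by rewrite /= i2_lin // conj_lin.
  + exact: PL.
  + by rewrite iP_lin.
- case=> [g|] x z /= [x' Qx <-] [z' Qz <-]; exists (x' \o z').
  + exact: QM.
  + by rewrite /= i2_comp // conj_comp.
  + exact: PM.
  + by rewrite iP_comp.
- exact: phi1.
- by move=> o' c x z /BO_M Mx /BO_M Mz; exact: phi_lin.
Qed.

Let redword_M o w : redword BO phi o w -> M w.
Proof.
elim=> {o w} [ o x /BO_M //|o o' x y /BO_M Mx _ _ _ My]; exact: M_comp.
Qed.

(** Holds on reduced words by [BO_word0], then on N by normality. The *-algebra needed for density
    consists of the n in N that, together with their adjoints, multiply the word span into itself
    from the left; applied to [idfun] they lie in the word span. *)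
Let phi_N_lam n g : N n -> g <> 1%g -> phi (n \o lam g) = 0.
Proof.
move=> Nn g1.
have WS0 : WS `<=` [set y | M y /\ phi (y \o lam g) = 0].
  apply: lin_span_min.
    have [M0 ML] := star_algebra_lin MA.
    split; first by split=> //; exact: (lin_on0 (star_algebra_lin MA) phi_lin).
    move=> a x z [Mx x0] [Mz z0]; split; first exact: ML.
    have -> : (a *: x + z) \o lam g = a *: (x \o lam g) + (z \o lam g) by [].
    by rewrite phi_lin ?x0 ?z0 ?mulr0 ?addr0 //; exact: M_comp.
  move=> w [->|[i oW]]; first by split; [case: MA | exact: phi_lam].
  by split; [exact: redword_M oW | exact: BO_word0 oW].
have [_ WSL] : lin_set (V := HM -> HM) WS := lin_span_lin _.
pose A := [set a : HM -> HM | [/\ N a, forall y, WS y -> WS (a \o y) &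
  forall y, WS y -> WS (adj a \o y)]].
have AN : A `<=` N by move=> a [].
have [_ N1 NL NMul Nadj] := NA.
have AA : star_algebra A.
  split.
  - by move=> a /AN/Nb.
  - by split=> // y; rewrite adj_id.
  - move=> c a b [Na a1 a2] [Nb' b1 b2]; split; first exact: NL.
      by move=> y yS; exact: (WSL c _ _ (a1 y yS) (b1 y yS)).
    move=> y yS; rewrite (adj_lin _ (Nb Na) (Nb Nb')).
    exact: (WSL _ _ _ (a2 y yS) (b2 y yS)).
  - move=> a b [Na a1 a2] [Nb' b1 b2]; split; first exact: NMul.
      by move=> y yS; exact: (a1 _ (b1 y yS)).
    by move=> y yS; rewrite (adj_comp (Nb Na) (Nb Nb')); exact: (b2 _ (a2 y yS)).
  - move=> a [Na a1 a2]; split=> //; first exact: Nadj.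
    by rewrite (adjK (Nb Na)).
have GNA : GN `<=` A.
  move=> x Gx; have [w xo xo'] := GN_BO Gx; split; first exact: GN_N.
    by move=> y; exact: WS_mull xo.
  by move=> y; exact: WS_mull xo'.
have h1 : set_fun N M (fun x : HM -> HM => x \o lam g).
  by move=> x Nx; exact: (M_comp (NM Nx) (lamM g)).
have h2 : normal_map N (fun x : HM -> HM => idfun \o x \o lam g).
  exact: (normal_map_conj Nb (idb HM) (lamb g)).
have fN : normal_functional N (fun x : HM -> HM => phi (x \o lam g) : R[i]^o).
  exact: (@normal_functional_comp _ HM HM N M (fun x => x \o lam g) phi h1 h2 phiN).
have f0 a : A a -> phi (a \o lam g) = 0.
  by move=> [_ a1 _]; have [] := WS0 _ (a1 idfun (@word_span_id _ _ _ BO phi)).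
exact: (normal_zero AA AN fN f0 (bicommutantS GNA Nn) Nn).
Qed.

(** * The coaction and its fixed points *)

Let GammaM x : M x -> vn_tensor TM M (group_vna L) (Gamma x).
Proof. by have [[h _ _ _ _] _] := GammaH; exact: h. Qed.
Let Gamma1 : Gamma idfun = idfun. Proof. by have [[_ h _ _ _] _] := GammaH. Qed.
Let Gamma_lin (a : R[i]) x y : M x -> M y -> Gamma (a *: x + y) = a *: Gamma x + Gamma y.
Proof. by have [[_ _ h _ _] _] := GammaH; exact: h. Qed.
Let Gamma_comp x y : M x -> M y -> Gamma (x \o y) = Gamma x \o Gamma y.
Proof. by have [[_ _ _ h _] _] := GammaH; exact: h. Qed.
Let Gamma_adj x : M x -> Gamma (adj x) = adj (Gamma x).
Proof. by have [[_ _ _ _ h] _] := GammaH; exact: h. Qed.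
Let GammaN : normal_map M Gamma. Proof. by have [_ h] := GammaH. Qed.
Let Gammab x : M x -> bop (Gamma x).
Proof. by move=> /GammaM/commutant_bop. Qed.

Let Gamma_conj g x : M x -> Gamma x = tens_op TM x idfun ->
  Gamma (conj g x) = tens_op TM (conj g x) idfun.
Proof.
move=> Mx xE; have gb := lamb g; have gb' := lamb g^-1%g; have xb := Mb Mx.
have Lb := lambda_bop L g; have Lb' := lambda_bop L g^-1%g.
rewrite conjE (Gamma_comp (M_comp (lamM g) Mx) (lamM _)) (Gamma_comp (lamM g) Mx).
rewrite !GammaL xE (tens_op_comp _ gb Lb xb (idb L)).
rewrite (tens_op_comp _ (bop_comp gb xb) (bop_comp Lb (idb L)) gb' Lb').
by rewrite -[(_ \o idfun) \o _]/(lambda L g \o lambda L g^-1%g) lambdaM mulgV lambda1.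
Qed.

Let GammaGN x : GN x -> Gamma x = tens_op TM x idfun.
Proof.
move=> [[p Pp <-]|[g _ [q Qq <-]]]; first exact: GammaP.
by apply: Gamma_conj; [exact: i2M | exact: GammaQ].
Qed.

Let F0 := fixed_points TM M Gamma.

Let F0_star : star_algebra F0.
Proof.
have [_ M1 ML MM Madj] := MA; split.
- by move=> x [/Mb].
- by split; [exact: M1 | rewrite Gamma1 tens_op_id].
- move=> a x y [Mx xE] [My yE]; split; first exact: ML.
  by rewrite (Gamma_lin _ Mx My) xE yE (tens_op_linl _ _ (Mb Mx) (Mb My) (idb L)).
- move=> x y [Mx xE] [My yE]; split; first exact: MM.
  by rewrite (Gamma_comp Mx My) xE yE (tens_op_comp _ (Mb Mx) (idb L) (Mb My) (idb L)).
- move=> x [Mx xE]; split; first exact: Madj.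
  by rewrite (Gamma_adj Mx) xE (tens_op_adj _ (Mb Mx) (idb L)) adj_id.
Qed.

(** Gamma and x |-> x (x) 1 are normal and agree on the *-algebra [F0], which contains the
    generators of N. Normality of the second map uses that G is countable. *)
Let Gamma_fixN x : N x -> Gamma x = tens_op TM x idfun.
Proof.
move=> Nx; have Mx := NM Nx.
apply/funext => t; apply: dotp_ext => t'.
pose f y : R[i]^o := dotp (Gamma y t) t' - dotp (tens_op TM y idfun t) t'.
have fN : normal_functional M f.
  exact: (normal_functionalB (normal_map_vector (k := t) (k' := t') GammaN)
    (normal_map_vector (k := t) (k' := t') (@normal_amplification _ _ _ _ TM _ Gcount Mb))).
have F0M : F0 `<=` M by move=> y [].
have f0 y : F0 y -> f y = 0 by move=> [_ E]; rewrite /f E subrr.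
have GF : GN `<=` F0 by move=> y Gy; split; [exact: GN_M | exact: GammaGN].
have := normal_zero F0_star F0M fN f0 (bicommutantS GF Nx) Mx.
by move/eqP; rewrite subr_eq0 => /eqP.
Qed.

Let Gamma_nlam n g : N n -> Gamma (n \o lam g) = tens_op TM (n \o lam g) (lambda L g).
Proof.
move=> Nn; rewrite (Gamma_comp (NM Nn) (lamM g)) (Gamma_fixN Nn) GammaL.
by rewrite (tens_op_comp _ (Nb Nn) (idb L) (lamb g) (lambda_bop L g)).
Qed.

Let S0 := [set x | exists n g, N n /\ x = n \o lam g].
Let A0 := lin_span S0.

Let S0M : S0 `<=` M.
Proof. by move=> _ [n [g [Nn ->]]]; exact: (M_comp (NM Nn) (lamM g)). Qed.

Let N_comp x y : N x -> N y -> N (x \o y).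
Proof. by have [_ _ _ h _] := NA; exact: h. Qed.

Let N1 : N idfun. Proof. by case: NA. Qed.

(** The relation lam g m = (conj g m) lam g moves all unitaries to the right. *)
Let A0_star : star_algebra A0.
Proof.
apply: lin_span_star.
- by move=> x /S0M/Mb.
- by exists idfun, 1%g; rewrite lam_one.
- move=> _ _ [n [g [Nn ->]]] [m [h [Nm ->]]].
  exists (n \o conj g m), (g * h)%g; split; first exact: (N_comp Nn (N_conj g Nm)).
  rewrite conjE -lam_mul; apply/funext => w /=.
  by have -> : lam g^-1%g (lam g (lam h w)) = lam h w := congr1 (@^~ _) (lamVK g).
- move=> _ [n [g [Nn ->]]]; exists (conj g^-1%g (adj n)), g^-1%g; split.
    by apply: N_conj; have [_ _ _ _] := NA; apply.
  rewrite (adj_comp (Nb Nn) (lamb g)) adj_lam conjE invgK; apply/funext => w /=.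
  by have -> : lam g (lam g^-1%g w) = w := congr1 (@^~ _) (lamK g).
Qed.

Let A0M : A0 `<=` M.
Proof. by apply: lin_span_min S0M; exact: star_algebra_lin. Qed.

(** Arbitrary elements of i1 (P (x) L(G)) are reached by [vN_preimage] for the normal map i1, since
    P (x) L(G) is generated by P (x) 1 and the 1 (x) lambda_g. *)
Let A0_dense : M `<=` bicommutant A0.
Proof.
have A0b : A0 `<=` @bop R HM HM by case: A0_star.
have A0adj x : A0 x -> A0 (adj x) by case: A0_star => _ _ _ _; apply.
have CN := bicommutant_vN A0b A0adj.
have sub : S0 `<=` bicommutant A0 by move=> x Sx; apply: sub_bicommutant => //; exact: sub_lin_span.
have [_ _ ME _] := Mfree; rewrite {1}ME -[X in _ `<=` X](bicommutantK A0b).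
apply: bicommutantS => x [[] _].
  move=> [X VX <-].
  have i1H : normal_star_hom VT M i1 by have [h _] := i1E.
  apply: (vN_preimage VTN CN Mb i1H (B := [set tens_op TP x idfun | x in P] `|`
    range (fun g => tens_op TP idfun (lambda L g)))).
  - move=> _ [[p Pp <-]|[g _ <-]]; [exact: VTiP | exact: VTPl].
  - move=> _ [[p Pp <-]|[g _ <-]]; apply: sub.
      exists (iP p), 1%g; rewrite lam_one; split=> //; apply: GN_N; left; by exists p.
    by exists idfun, g.
  - exact: (vn_tensor_group PA VX).
move=> [q Qq <-]; apply: sub; exists (i2 q), 1%g; rewrite lam_one; split=> //.
by apply: GN_N; right; exists 1%g => //; exists q => //; rewrite conj1.
Qed.

(* To identify normal objects on M it suffices to look at the n lam g. *)
Let M_principle (f : (HM -> HM) -> R[i]^o) : normal_functional M f ->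
  lin_on (V := HM -> HM) M f -> (forall n g, N n -> f (n \o lam g) = 0) ->
  forall x, M x -> f x = 0.
Proof.
move=> fN fL f0 x Mx; apply: (normal_zero A0_star A0M fN) => //; last exact: A0_dense.
have [M0 ML] := star_algebra_lin MA.
have h : A0 `<=` [set y | M y /\ f y = 0].
  apply: lin_span_min; last first.
    by move=> y Sy; split; [exact: S0M | have [n [g [Nn ->]]] := Sy; exact: f0].
  split; first by split=> //; exact: (lin_on0 (star_algebra_lin MA) fL).
  move=> a y z [My y0] [Mz z0]; split; first exact: ML.
  by rewrite fL // y0 z0 mulr0 addr0.
by move=> a /h[].
Qed.

Let M_preimage (K : hilbertType R) (C C' : set (K -> K)) f :
  von_neumann_algebra C -> C' `<=` @bop R K K -> normal_star_hom M C' f ->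
  (forall n g, N n -> C (f (n \o lam g))) -> forall x, M x -> C (f x).
Proof.
move=> CN C'b fH Cf x Mx; have [[_ _ fL _ _] _] := fH.
have [C0 CL] := star_algebra_lin (vN_star CN); have [M0 ML] := star_algebra_lin MA.
apply: (vN_preimage MN CN C'b fH A0M) (A0_dense Mx).
have h : A0 `<=` [set y | M y /\ C (f y)].
  apply: lin_span_min.
    split.
      split=> //; rewrite -[0 : HM -> HM](_ : 0 \o lam 1%g = _) //; apply: Cf.
      by case: (star_algebra_lin NA).
    move=> a y z [My Cy] [Mz Cz]; split; first exact: ML.
    by rewrite (fL a _ _ My Mz); exact: CL.
  by move=> y Sy; split; [exact: S0M | have [n [g [Nn ->]]] := Sy; exact: Cf].
by move=> y /h[].
Qed.

(** The slice at delta_1 sends n lam g to n if g = 1 and to 0 otherwise, as a conditional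
    expectation onto N would. The functional f tests whether the slice of Gamma z commutes with y in
    the commutant of N; on a fixed point the slice is x itself. *)
Let fixedE : N = F0.
Proof.
apply/seteqP; split=> x; first by move=> Nx; split; [exact: NM | exact: Gamma_fixN].
move=> [Mx xE]; have xb := Mb Mx; split; first exact/bopE.
move=> y yG; have yb := commutant_bop yG; have ysb := adj_bop yb.
apply/funext => u; apply: dotp_ext => v /=.
pose d := delta L 1%g.
pose f z : R[i]^o := dotp (Gamma z (tens TM (y u) d)) (tens TM v d) -
  dotp (Gamma z (tens TM u d)) (tens TM (adj y v) d).
have fN : normal_functional M f.
  exact: (normal_functionalB
    (normal_map_vector (k := tens TM (y u) d) (k' := tens TM v d) GammaN)
    (normal_map_vector (k := tens TM u d) (k' := tens TM (adj y v) d) GammaN)).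
have fL : lin_on (V := HM -> HM) M f.
  by move=> a z w Mz Mw; rewrite /f Gamma_lin // !fctE !dotDl !dotZl; ring.
have dd z w u' v' : Gamma z = tens_op TM z w -> bop z -> bop w ->
    dotp (Gamma z (tens TM u' d)) (tens TM v' d) = dotp (z u') v' * dotp (w d) d.
  by move=> -> zb wb; rewrite (tens_opE _ _ _ zb wb) tens_dotp.
have f0 n g : N n -> f (n \o lam g) = 0.
  move=> Nn; rewrite /f; have nb := Nb Nn; have nlb := bop_comp nb (lamb g).
  rewrite !(dd _ _ _ _ (Gamma_nlam g Nn) nlb (lambda_bop L g)) -mulrBl.
  rewrite lambdaE mulg1 delta_orthonormal.
  have [->|_] := eqVneq g 1%g; last by rewrite mulr0.
  rewrite lam_one /= -(adjP _ _ yb).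
  have [_ /(_ _ yG) E] := Nn.
  by have -> : n (y u) = y (n u) := congr1 (@^~ u) E; rewrite subrr mul0r.
have := M_principle fN fL f0 Mx.
rewrite /f !(dd _ _ _ _ xE xb (idb L)) -mulrBl delta_orthonormal eqxx mulr1.
by rewrite -(adjP _ _ yb) => /eqP; rewrite subr_eq0 => /eqP.
Qed.

(** * The representation theta and its intertwiners *)

Let W_ex : exists W : TM -> TM, unitary W /\
  forall u h, W (tens TM u (delta L h)) = tens TM (lam h u) (delta L h).
Proof.
have [|||W [WU WE]] := @gram_unitary R TM TM (HM * G)
  (fun i => tens TM i.1 (delta L i.2)) (fun i => tens TM (lam i.2 i.1) (delta L i.2)).
- move=> [u g] [v h]; rewrite !dotp_tens_delta /=.
  have [<-|_] := eqVneq g h; last by rewrite !mulr0.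
  rewrite (adjPl _ _ (lamb g)) adj_lam.
  by have -> : lam g^-1%g (lam g u) = u := congr1 (@^~ u) (lamVK g).
- by move=> d ds; apply: tens_delta_sep => _ [u [h ->]]; apply: ds; exists (u, h).
- move=> d ds; apply: tens_delta_sep => _ [u [h ->]]; apply: ds; exists (lam h^-1%g u, h) => //=.
  by have -> : lam h (lam h^-1%g u) = u := congr1 (@^~ u) (lamK h).
by exists W; split=> // u h; exact: (WE (u, h)).
Qed.

Let W : TM -> TM := sval (cid W_ex).

Let WE u h : W (tens TM u (delta L h)) = tens TM (lam h u) (delta L h).
Proof. by have [_ E] := svalP (cid W_ex); exact: E. Qed.

Let WU : unitary W. Proof. by have [] := svalP (cid W_ex). Qed.
Let Wb : bop W. Proof. by case: WU. Qed.

Let W' := hadj W.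
Let W'b : bop W'. Proof. exact: hadj_bop. Qed.

Let W'K t : W' (W t) = t.
Proof. by have [_ _ E] := WU; exact: (congr1 (@^~ t) E). Qed.

Let WK t : W (W' t) = t.
Proof. by have [_ E _] := WU; exact: (congr1 (@^~ t) E). Qed.

Let W'E u h : W' (tens TM u (delta L h)) = tens TM (lam h^-1%g u) (delta L h).
Proof.
have E : lam h (lam h^-1%g u) = u := congr1 (@^~ u) (lamK h).
by rewrite -{1}E -WE W'K.
Qed.

Let theta x := W' \o Gamma x \o W.

Let thetab x : M x -> bop (theta x).
Proof. by move=> Mx; exact: bop_comp (bop_comp W'b (Gammab Mx)) Wb. Qed.

Let theta_id : theta idfun = idfun.
Proof. by rewrite /theta Gamma1; apply/funext => t /=; exact: W'K. Qed.

Let theta_lin (a : R[i]) x y : M x -> M y -> theta (a *: x + y) = a *: theta x + theta y.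
Proof.
move=> Mx My; rewrite /theta (Gamma_lin a Mx My); apply/funext => t /=.
by rewrite !fctE /= (bopD W'b) (bopZ W'b).
Qed.

Let theta_comp x y : M x -> M y -> theta (x \o y) = theta x \o theta y.
Proof.
move=> Mx My; rewrite /theta (Gamma_comp Mx My); apply/funext => t /=.
by rewrite WK.
Qed.

Let theta_adj x : M x -> theta (adj x) = adj (theta x).
Proof.
move=> Mx; apply: adj_unique; first exact: thetab.
move=> v w; rewrite /theta /= Gamma_adj //.
by rewrite -(hadjPl Wb) (adjP _ _ (Gammab Mx)) (hadjP Wb).
Qed.

Let theta_hom : star_hom M (@bop R TM TM) theta.
Proof.
split; [exact: thetab|exact: theta_id|exact: theta_lin|exact: theta_comp|exact: theta_adj].
Qed.

Let thetaN : normal_map M theta.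
Proof.
have h : normal_map (vn_tensor TM M (group_vna L)) (fun z => W' \o z \o W).
  by apply: normal_map_conj => // z /commutant_bop.
exact: (normal_map_comp GammaM GammaN h).
Qed.

Let theta_tens x y u h : M x -> bop y -> Gamma x = tens_op TM x y ->
  theta x (tens TM u (delta L h)) = W' (tens TM (x (lam h u)) (y (delta L h))).
Proof. by move=> Mx yb xE; rewrite /theta /= WE xE (tens_opE _ _ _ (Mb Mx) yb). Qed.

Let theta_n n u h : N n -> theta n (tens TM u (delta L h)) =
  tens TM (conj h^-1%g n u) (delta L h).
Proof.
move=> Nn; rewrite (theta_tens _ _ (NM Nn) (idb L) (Gamma_fixN Nn)) W'E.
by rewrite conjE invgK.
Qed.

Let theta_lam g : theta (lam g) = crossed_unitary TM g.
Proof.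
have Lb := lambda_bop L g; have ub : bop (crossed_unitary TM g) := tens_op_bopW _ _ _.
apply: (tens_delta_ext (thetab (lamM g)) ub) => u h.
rewrite (theta_tens _ _ (lamM g) Lb (GammaL g)) lambdaE W'E.
rewrite /crossed_unitary (tens_opE _ _ _ (idb HM) Lb) lambdaE; congr (tens TM _ _).
have E : lam (g * h)^-1%g \o (lam g \o lam h) = idfun by rewrite lam_mul lamVK.
exact: (congr1 (@^~ u) E).
Qed.

Let theta_embed n : N n -> crossed_embed TM conj n = theta n.
Proof.
move=> Nn; apply: the_op_eq; first exact/thetab/NM.
  by move=> u h; exact: theta_n.
move=> w wb wE; apply: (tens_delta_ext wb (thetab (NM Nn))) => u h.
by rewrite wE theta_n.
Qed.

Let theta_nlam n g u h : N n -> theta (n \o lam g) (tens TM u (delta L h)) =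
  tens TM (conj (g * h)^-1%g n u) (delta L (g * h)%g).
Proof.
move=> Nn; rewrite (theta_comp (NM Nn) (lamM g)) theta_lam /= /crossed_unitary.
by rewrite (tens_opE _ _ _ (idb HM) (lambda_bop L g)) lambdaE theta_n.
Qed.

Let CP := crossed_product TM N conj.
Let CPgens := crossed_embed TM conj @` N `|` range (crossed_unitary TM).

Let CPgens_theta : CPgens `<=` theta @` M.
Proof.
move=> _ [[n Nn <-]|[g _ <-]].
  by exists n; [exact: NM | rewrite theta_embed].
by exists (lam g); [exact: lamM | rewrite theta_lam].
Qed.

Let CPgens_bop : CPgens `<=` @bop R TM TM.
Proof. by move=> _ /CPgens_theta[x Mx <-]; exact: thetab. Qed.

Let CPgens_adj x : CPgens x -> CPgens (adj x).
Proof.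
have [_ _ _ _ Nadj] := NA.
move=> [[n Nn <-]|[g _ <-]].
  left; exists (adj n); first exact: Nadj.
  rewrite (theta_embed Nn) -(theta_adj (NM Nn)) theta_embed //; exact: Nadj.
by right; exists g^-1%g => //; rewrite -!theta_lam -(theta_adj (lamM g)) adj_lam.
Qed.

Let CPN : von_neumann_algebra CP := bicommutant_vN CPgens_bop CPgens_adj.
Let CPA : star_algebra CP := vN_star CPN.

Let theta_CP x : M x -> CP (theta x).
Proof.
move=> Mx; have [_ _ _ CM _] := CPA.
have sub : CPgens `<=` CP := sub_bicommutant CPgens_bop.
have h : normal_star_hom M (@bop R TM TM) theta by split.
apply: (M_preimage CPN (@subset_refl _ _) h) => // n g Nn.
rewrite (theta_comp (NM Nn) (lamM g)); apply: CM; apply: sub.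
  by left; exists n => //; rewrite theta_embed.
by right; exists g => //; rewrite theta_lam.
Qed.

Let J1 (u : HM) : TM := tens TM u (delta L 1%g).
Let J1b : bop J1. Proof. exact: tens_bopl. Qed.

Let c1 : TM -> HM := @coord R G L HM TM 1%g.
Let c1b : bop c1. Proof. exact: coord_bop. Qed.

(** Compressing theta (n lam g) to delta_1 leaves n if g = 1 and 0 otherwise, which matches phi by
    [phi_N_lam]. So the vectors representing phi, placed at delta_1, represent it through theta. *)
Let phi_theta : exists U V : l2n TM, forall x, M x -> phi x = dotp (hat (theta x) U) V.
Proof.
have phiL : lin_on (V := HM -> HM) M phi by move=> a x y; exact: phi_lin.
have [u [v uv]] := normal_functional_hat Mb (star_algebra_lin MA) phiL phiN.
exists (hat J1 u), (hat J1 v) => x Mx; apply/eqP; rewrite -subr_eq0; apply/eqP.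
pose f y : R[i]^o := phi y - dotp (hat (theta y) (hat J1 u)) (hat J1 v).
have rep := hat_rep MA (star_hom_rep (@subset_refl _ _) theta_hom).
have fN : normal_functional M f.
  exact: (normal_functionalB phiN (normal_map_hat (u := hat J1 u) (v := hat J1 v) thetaN)).
have fL : lin_on (V := HM -> HM) M f.
  have [_ hL _ _ _] := rep; move=> a y z My Mz.
  by rewrite /f phi_lin // hL // dotDl dotZl; ring.
apply: (M_principle fN fL _ Mx) => n g Nn; rewrite /f.
have Mn := M_comp (NM Nn) (lamM g); have tb := thetab Mn.
have E : dotp (hat (theta (n \o lam g)) (hat J1 u)) (hat J1 v) =
    dotp (hat (c1 \o (theta (n \o lam g) \o J1)) u) v.
  rewrite (hat_comp _ c1b (bop_comp tb J1b)) (hat_comp _ tb J1b).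
  by rewrite (hat_adj _ _ c1b) /c1 /coord (hadjK J1b).
have cE : c1 \o (theta (n \o lam g) \o J1) =
    if g == 1%g then n else 0.
  apply/funext => w /=; rewrite /J1 (theta_nlam _ _ _ Nn) mulg1 /c1 coord_tens eq_sym.
  by case: eqP => [->|_]; rewrite ?scale0r // scale1r invg1 conj1.
rewrite E cE; have [g1|/eqP g1] := eqVneq g 1%g.
  by rewrite g1 lam_one -uv ?subrr //; exact: NM.
rewrite (phi_N_lam Nn g1) sub0r.
have -> : hat (0 : HM -> HM) u = 0 by apply: l2_ext => k; rewrite (hatE _ _ (bop_0 _ _)).
by rewrite dot0l oppr0.
Qed.

Let intertwiner_sep : sep (ranges (intertwiners M id theta)) /\
  sep (ranges (intertwiners M theta id)).
Proof.
have rep := star_hom_rep (@subset_refl _ _) theta_hom.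
have [U [V UV]] := phi_theta; split; first exact: normal_rep_sep MN rep thetaN.
have h := @faithful_sep R HM TM M theta MN rep phi U V phiF UV; exact: h.
Qed.

(** Quasi-equivalence makes theta a bijection onto the bicommutant of theta(M). This is the crossed
    product, because the generators of the latter lie in theta(M) and theta(M) lies in it. *)
Let theta_iso : vn_iso M CP theta /\ CP = theta @` M.
Proof.
have [s1 s2] := intertwiner_sep; have [_ _ _ _ Madj] := MA.
have [|||Phi [[_ PB] PE _]] := @quasi_equivalence R HM TM (HM -> HM) M id theta (@adj R HM) _ _ _ s1 s2.
- exact: Mb.
- exact: thetab.
- by move=> x Mx; split; [exact: Madj | by [] | exact: theta_adj].
have ME : bicommutant (id @` M) = M by rewrite image_id; case: MN.
have CE : bicommutant (theta @` M) = CP.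
  apply/seteqP; split; last exact: bicommutantS CPgens_theta.
  have -> : CP = bicommutant CP := esym (bicommutantK CPgens_bop).
  by apply: bicommutantS => _ [x Mx <-]; exact: theta_CP.
rewrite ME CE in PB; have [P1' P2 P3] := PB.
have CP_M : CP `<=` theta @` M.
  by move=> z /P3[x Mx <-]; exists x => //; rewrite -PE.
split; last first.
  by apply/seteqP; split=> // _ [x Mx <-]; exact: theta_CP.
split.
  split; [exact: theta_CP|exact: theta_id|exact: theta_lin|exact: theta_comp|exact: theta_adj].
split; [exact: theta_CP| |exact: CP_M].
move=> x y xM yM; have := P2 x y xM yM; rewrite !inE in xM yM.
by rewrite !PE.
Qed.

(** * The dual action and the isomorphism of coactions *)

(** Y implements the dual action: conjugating z (x) 1 by it turns z = theta (n lam g) into z (x)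
    lambda_g, since (g h) (h^-1 k) = g k. *)
Let Y_ex : exists Y : TMM -> TMM, unitary Y /\ forall u h k,
  Y (tens TMM (tens TM u (delta L h)) (delta L k)) =
  tens TMM (tens TM u (delta L h)) (delta L (h * k)%g).
Proof.
have [|||Y [YU YE]] := @gram_unitary R TMM TMM (HM * G * G)
  (fun i => tens TMM (tens TM i.1.1 (delta L i.1.2)) (delta L i.2))
  (fun i => tens TMM (tens TM i.1.1 (delta L i.1.2)) (delta L (i.1.2 * i.2)%g)).
- move=> [[u h] k] [[u' h'] k']; rewrite !dotp_tens_delta /=.
  have [<-|_] := eqVneq h h'; last by rewrite mulr0 !mul0r.
  by rewrite (inj_eq (mulgI h)).
- by move=> d ds; apply: (@tens_delta2_sep _ _ _ _ TM TMM) => _ [u [h [k ->]]]; apply: ds; exists (u, h, k).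
- move=> d ds; apply: (@tens_delta2_sep _ _ _ _ TM TMM) => _ [u [h [k ->]]].
  by apply: ds; exists (u, h, (h^-1 * k)%g) => //=; rewrite mulVKg.
by exists Y; split=> // u h k; exact: (YE (u, h, k)).
Qed.

Let Y : TMM -> TMM := sval (cid Y_ex).

Let YE u h k : Y (tens TMM (tens TM u (delta L h)) (delta L k)) =
  tens TMM (tens TM u (delta L h)) (delta L (h * k)%g).
Proof. by have [_ E] := svalP (cid Y_ex); exact: E. Qed.

Let YU : unitary Y. Proof. by have [] := svalP (cid Y_ex). Qed.
Let Yb : bop Y. Proof. by case: YU. Qed.

Let Y' := hadj Y.
Let Y'b : bop Y'. Proof. exact: hadj_bop. Qed.

Let Y'K t : Y' (Y t) = t.
Proof. by have [_ _ E] := YU; exact: (congr1 (@^~ t) E). Qed.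

Let YK t : Y (Y' t) = t.
Proof. by have [_ E _] := YU; exact: (congr1 (@^~ t) E). Qed.

Let Y'E u h k : Y' (tens TMM (tens TM u (delta L h)) (delta L k)) =
  tens TMM (tens TM u (delta L h)) (delta L (h^-1 * k)%g).
Proof. by rewrite -{1}(mulVKg h k) -YE Y'K. Qed.

Let alphahat z := Y \o tens_op TMM z idfun \o Y'.

Let alphahat_b z : bop (alphahat z).
Proof. by apply: bop_comp Y'b; apply: bop_comp Yb _; exact: tens_op_bopW. Qed.

Let CPb : CP `<=` @bop R TM TM := vN_bop CPN.

Let alphahat_hom : star_hom CP (@bop R TMM TMM) alphahat.
Proof.
split.
- by move=> z _; exact: alphahat_b.
- by rewrite /alphahat tens_op_id; apply/funext => t /=; exact: YK.
- move=> a x y /CPb xb /CPb yb; rewrite /alphahat (tens_op_linl _ _ xb yb (idb L)).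
  by apply/funext => t; rewrite /= !fctE /= (bopD Yb) (bopZ Yb).
- move=> x y /CPb xb /CPb yb; rewrite /alphahat.
  rewrite -[idfun in LHS](_ : (idfun : L -> L) \o idfun = _) //.
  rewrite -(tens_op_comp _ xb (idb L) yb (idb L)).
  by apply/funext => t /=; rewrite Y'K.
- move=> x /CPb xb; apply: adj_unique; first exact: alphahat_b.
  move=> v w; rewrite /alphahat /= -(adj_id (H := L)) -(tens_op_adj _ xb (idb L)).
  by rewrite adj_id (hadjP Yb) (adjP _ _ (tens_op_bop TMM xb (idb L))) -(hadjPl Yb).
Qed.

Let alphahatN : normal_map CP alphahat.
Proof.
have h1 : normal_map CP (fun z => tens_op TMM z idfun).
  exact: normal_amplification.
have h2 : normal_map (@bop R TMM TMM) (fun z => Y \o z \o Y').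
  exact: (normal_map_conj (@subset_refl _ _) Yb Y'b).
have h3 : set_fun CP (@bop R TMM TMM) (fun z => tens_op TMM z idfun).
  by move=> z _; exact: tens_op_bopW.
exact: (normal_map_comp h3 h1 h2).
Qed.

Let theta_set_fun : set_fun M CP theta := theta_CP.

Let beta_nlam n g : N n -> alphahat (theta (n \o lam g)) =
  tens_op TMM (theta (n \o lam g)) (lambda L g).
Proof.
move=> Nn; have Mn := M_comp (NM Nn) (lamM g); have tb := thetab Mn.
have Lb := lambda_bop L g.
apply: (bop_ext (alphahat_b _) (tens_op_bop TMM tb Lb) (@tens_delta2_sep _ _ _ _ TM TMM)).
move=> _ [u [h [k ->]]]; rewrite (tens_opE _ _ _ tb Lb) lambdaE /alphahat /= Y'E.
rewrite (tens_opE _ _ _ tb (idb L)) (theta_nlam _ _ _ Nn) YE.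
by congr (tens TMM _ (delta L _)); rewrite -mulgA mulVKg.
Qed.

Let VTH := vn_tensor TMM CP (group_vna L).
Let VTHN : von_neumann_algebra VTH := vn_tensor_vN TMM CPA LA.

(** An element of the crossed product is theta x with x in M, so it is enough to examine the normal
    homomorphism [alphahat \o theta] on the n lam g. *)
Let alphahat_VTH z : CP z -> VTH (alphahat z).
Proof.
have [_ CE] := theta_iso; rewrite {1}CE => -[x Mx <-].
have [aB a1 aL aM aS] := alphahat_hom.
have bH : normal_star_hom M (@bop R TMM TMM) (alphahat \o theta).
  split; last exact: (normal_map_comp theta_set_fun thetaN alphahatN).
  split.
  - by move=> y _; exact: alphahat_b.
  - by rewrite /= theta_id a1.
  - move=> a y w My Mw; rewrite /= (theta_lin a My Mw).
    exact: (aL a _ _ (theta_CP My) (theta_CP Mw)).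
  - move=> y w My Mw; rewrite /= (theta_comp My Mw).
    exact: (aM _ _ (theta_CP My) (theta_CP Mw)).
  - move=> y My; rewrite /= (theta_adj My); exact: (aS _ (theta_CP My)).
apply: (M_preimage VTHN (@subset_refl _ _) bH) => // n g Nn.
rewrite /= (beta_nlam g Nn); apply: vn_tensor_gen; last exact: lambda_group_vna.
by apply: theta_CP; exact: (M_comp (NM Nn) (lamM g)).
Qed.

Let dual_action : is_dual_action TMM N conj alphahat.
Proof.
split.
- split; last exact: alphahatN.
  by have [_ a1 aL aM aS] := alphahat_hom; split=> //; exact: alphahat_VTH.
- move=> n Nn; rewrite (theta_embed Nn); have := beta_nlam 1%g Nn.
  by rewrite lam_one lambda1.
- move=> g; rewrite -theta_lam; have := beta_nlam g N1; by [].
Qed.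

(** theta (x) Id is the quasi-equivalence of two families of elementary tensors indexed by M and
    L(G), whose intertwiners are amplified from those of theta. It satisfies Phi X (J t) = J (X t),
    so the intertwining identity is compared on the vectors J t, where it becomes an equality of
    normal functionals on M. *)
Let coaction_isomorphism : coaction_iso M Gamma CP alphahat.
Proof.
have [tI CE] := theta_iso; have [s1 s2] := intertwiner_sep.
have [_ _ _ _ Madj] := MA; have [Lb' _ _ _ Ladj] := LA.
pose S := [set p : (HM -> HM) * (L -> L) | M p.1 /\ group_vna L p.2].
pose a (p : (HM -> HM) * (L -> L)) := tens_op TM (id p.1) p.2.
pose b (p : (HM -> HM) * (L -> L)) := tens_op TMM (theta p.1) p.2.
have sab : sep (ranges (intertwiners S a b)).
  have h := @tens_intertwiners_sep R HM TM L TM TMM (HM -> HM) M id theta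
    (group_vna L) Mb thetab Lb' s1.
  exact: h.
have sba : sep (ranges (intertwiners S b a)).
  have h := @tens_intertwiners_sep R TM HM L TMM TM (HM -> HM) M theta id
    (group_vna L) thetab Mb Lb' s2.
  exact: h.
have [|||Phi [PI PE PJ]] := @quasi_equivalence R TM TMM _ S a b
    (fun p => (adj p.1, adj p.2)) _ _ _ sab sba.
- by move=> p _; exact: tens_op_bopW.
- by move=> p _; exact: tens_op_bopW.
- move=> [x y] [/= Mx Ly]; have yb := Lb' _ Ly; split.
  + by split; [exact: Madj | exact: Ladj].
  + by rewrite /a /= (tens_op_adj _ (Mb Mx) yb).
  + by rewrite /b /= (theta_adj Mx) (tens_op_adj _ (thetab Mx) yb).
have aE : bicommutant (a @` S) = vn_tensor TM M (group_vna L).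
  congr bicommutant; apply/seteqP; split=> [_ [[x y] [/= Mx Ly] <-]|_ [x [y [Mx Ly ->]]]].
    by exists x, y.
  by exists (x, y).
have bE : bicommutant (b @` S) = VTH.
  rewrite /VTH /vn_tensor; congr bicommutant; apply/seteqP; split.
    by move=> _ [[x y] [/= Mx Ly] <-]; exists (theta x), y; split=> //; exact: theta_CP.
  by rewrite CE => _ [z [y [[x Mx <-] Ly ->]]]; exists (x, y).
rewrite aE bE in PI; rewrite aE in PJ.
exists theta, Phi; split=> //.
  by move=> x y Mx Ly; exact: (PE (x, y)).
move=> x Mx; have Vx := GammaM Mx.
have Phib : bop (Phi (Gamma x)) by have [[h _ _ _ _] _] := PI; exact/(vN_bop VTHN)/h.
apply: (bop_ext (alphahat_b _) Phib sab) => _ [J [t [j ->]]].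
rewrite (PJ _ _ _ Vx j); have [Jb JI] := j.
apply: dotp_ext => w; rewrite (hadjP Jb).
have [_ _ aL _ _] := alphahat_hom.
have h1 : normal_map M (alphahat \o theta).
  exact: (normal_map_comp theta_set_fun thetaN alphahatN).
pose f y : R[i]^o := dotp ((alphahat \o theta) y (J t)) w - dotp (Gamma y t) (hadj J w).
have fN : normal_functional M f.
  exact: (normal_functionalB (normal_map_vector (k := J t) (k' := w) h1)
    (normal_map_vector (k := t) (k' := hadj J w) GammaN)).
have fL : lin_on (V := HM -> HM) M f.
  move=> c y z My Mz; rewrite /f /= (theta_lin c My Mz) (aL c _ _ (theta_CP My) (theta_CP Mz)).
  by rewrite (Gamma_lin c My Mz) !fctE !dotDl !dotZl; ring.
have := M_principle fN fL _ Mx => h; apply/eqP; rewrite -subr_eq0; apply/eqP; apply: h.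
move=> n g Nn; rewrite /f /= (beta_nlam g Nn) (Gamma_nlam g Nn) -(hadjP Jb).
have Sn : S (n \o lam g, lambda L g).
  by split; [exact: (M_comp (NM Nn) (lamM g)) | exact: lambda_group_vna].
have E : tens_op TMM (theta (n \o lam g)) (lambda L g) (J t) =
    J (tens_op TM (n \o lam g) (lambda L g) t) := congr1 (@^~ t) (JI _ Sn).
by rewrite E subrr.
Qed.

(** * The crossed product by the coaction, through commutants *)

Let Nc_amp := [set X | exists2 y, commutant N y & X = tens_op TM y idfun].

(** Serves both generating sets. Commuting with the matrix units forces X = y (x) 1; commuting with
    an operator that acts as n on the delta_1 column forces y to commute with n. *)
Let commute_gens (S : set (TM -> TM)) (X : TM -> TM) : bop X ->
  (forall Z, S Z -> X \o Z = Z \o X) ->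
  S (tens_op TM idfun (@unit_proj R G L)) ->
  (forall h, S (tens_op TM idfun (lambda L h))) ->
  (forall n, N n -> exists2 Z, S Z &
    forall u, Z (tens TM u (delta L 1%g)) = tens TM (n u) (delta L 1%g)) ->
  Nc_amp X.
Proof.
move=> Xb XS Se Sl Sn.
have [y yb XE] : exists2 y, bop y & X = tens_op TM y idfun.
  apply: (commute_matrix_units Xb) => [t|h t]; first exact: (congr1 (@^~ t) (XS _ Se)).
  exact: (congr1 (@^~ t) (XS _ (Sl h))).
exists y => //; split; first exact/bopE.
move=> n Nn; have [Z SZ ZE] := Sn n Nn; apply/funext => u /=.
have := congr1 (@^~ (tens TM u (delta L 1%g))) (XS _ SZ).
rewrite /= ZE XE !(tens_opE _ _ _ yb (idb L)) ZE => /(congr1 c1).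
by rewrite /c1 !coord_tens eqxx !scale1r.
Qed.

Let commutant_tensor : commutant
  [set z | exists x y, [/\ N x, bounded_op y & z = tens_op TM x y]] = Nc_amp.
Proof.
set S := [set z | _]; apply/seteqP; split=> X.
  move=> XC; have [_ XS] := XC; have bo (y : L -> L) : bop y -> bounded_op y by move/bopE.
  apply: (commute_gens (S := S) (commutant_bop XC) XS).
  - by exists idfun, (@unit_proj R G L); split=> //; exact/bo/unit_proj_bop.
  - by move=> h; exists idfun, (lambda L h); split=> //; exact/bo/lambda_bop.
  - move=> n Nn; exists (tens_op TM n idfun).
      by exists n, idfun; split=> //; exact/bo/bop_id.
    by move=> u; rewrite (tens_opE _ _ _ (Nb Nn) (idb L)).
move=> [y yN ->]; have yb := commutant_bop yN; split; first exact/bopE/tens_op_bopW.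
move=> _ [n [z [Nn /bopE zb ->]]].
rewrite (tens_op_comp _ yb (idb L) (Nb Nn) zb) (tens_op_comp _ (Nb Nn) zb yb (idb L)).
by have [_ /(_ _ Nn) ->] := yN.
Qed.

Let co_gens := theta @` M `|` tens_op TM idfun @` linfty L.

Let Nc_ampb : Nc_amp `<=` @bop R TM TM.
Proof. by move=> _ [y _ ->]; exact: tens_op_bopW. Qed.

Let Nc_amp_adj X : Nc_amp X -> Nc_amp (adj X).
Proof.
have [_ _ _ _ Nadj] := NA.
have [_ _ _ _ cadj] := commutant_star Nb Nadj.
move=> [y yN ->]; exists (adj y); first exact: cadj.
by rewrite (tens_op_adj _ (commutant_bop yN) (idb L)) adj_id.
Qed.

(** The entries of theta (n lam g) are conjugates of n, hence in N, and commute with z; [M_preimage]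
    extends this to M since the commutant is a von Neumann algebra. *)
Let theta_Nc x : M x -> commutant Nc_amp (theta x).
Proof.
move=> Mx; have CN := commutant_vN Nc_ampb Nc_amp_adj.
have h : normal_star_hom M (@bop R TM TM) theta by split.
apply: (M_preimage CN (@subset_refl _ _) h) => // n g Nn.
have Mn := M_comp (NM Nn) (lamM g); have tb := thetab Mn.
split; first exact/bopE.
move=> _ [z zN ->]; have zb := commutant_bop zN.
have zTb := tens_op_bop TM zb (idb L).
apply: (tens_delta_ext (bop_comp tb zTb) (bop_comp zTb tb)) => u k /=.
rewrite (tens_opE _ _ _ zb (idb L)) !(theta_nlam _ _ _ Nn) (tens_opE _ _ _ zb (idb L)).
have [_ /(_ _ (N_conj (g * k)^-1%g Nn)) E] := zN.
by congr (tens TM _ _); exact: (esym (congr1 (@^~ u) E)).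
Qed.

Let commutant_co_gens : commutant co_gens = Nc_amp.
Proof.
apply/seteqP; split=> X.
  move=> XC; have [_ XS] := XC.
  apply: (commute_gens (S := co_gens) (commutant_bop XC) XS).
  - by right; exists (@unit_proj R G L) => //; exact: unit_proj_linfty.
  - by move=> h; left; exists (lam h); [exact: lamM | rewrite theta_lam].
  - move=> n Nn; exists (theta n); first by left; exists n => //; exact: NM.
    by move=> u; rewrite (theta_n _ _ Nn) invg1 conj1.
move=> XN; split; first exact/bopE/Nc_ampb.
move=> _ [[x Mx <-]|[y /linfty_diag[yb _] <-]].
  by have [_ /(_ _ XN) ->] := theta_Nc Mx.
have [z zN ->] := XN; have zb := commutant_bop zN.
by rewrite (tens_op_comp _ zb (idb L) (idb HM) yb) (tens_op_comp _ (idb HM) yb zb (idb L)).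
Qed.

(** W preserves each fibre over delta_h, where a diagonal operator is a scalar. *)
Let W_linfty y : linfty L y ->
  W' \o tens_op TM idfun y \o W = tens_op TM idfun y.
Proof.
move=> /linfty_diag[yb [c yE]]; have yTb := tens_op_bop TM (idb HM) yb.
apply: (tens_delta_ext (bop_comp (bop_comp W'b yTb) Wb) yTb) => u h /=.
rewrite WE !(tens_opE _ _ _ (idb HM) yb) yE.
rewrite !(bopZ (tens_bopr TM _)) (bopZ W'b) W'E.
by have -> : lam h^-1%g (lam h u) = u := congr1 (@^~ u) (lamVK h).
Qed.

Let gens_conj : [set W' \o X \o W | X in Gamma @` M `|` tens_op TM idfun @` linfty L] = co_gens.
Proof.
apply/seteqP; split.
  move=> _ [_ [[x Mx <-]|[y yL <-]] <-]; first by left; exists x.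
  by right; exists y => //; rewrite W_linfty.
move=> _ [[x Mx <-]|[y yL <-]]; first by exists (Gamma x) => //; left; exists x.
by exists (tens_op TM idfun y); [right; exists y | exact: W_linfty].
Qed.

(** After conjugation by W the two algebras are equal and not merely isomorphic: both generating
    sets have as commutant the amplified commutant of N. *)
Let duality : exists th, vn_iso (cocrossed_product TM M Gamma)
  (vn_tensor TM N (@bounded_op R L)) th.
Proof.
have E : bicommutant co_gens = vn_tensor TM N (@bounded_op R L).
  by rewrite /vn_tensor /bicommutant commutant_tensor commutant_co_gens.
pose gens := Gamma @` M `|` tens_op TM idfun @` linfty L.
have gensE : [set W' \o X \o W | X in gens] = co_gens := gens_conj.
have gensE' : [set W \o X \o W' | X in co_gens] = gens.
  rewrite -gensE; apply/seteqP; split=> [_ [_ [X SX <-] <-]|X SX].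
    rewrite (_ : W \o (W' \o X \o W) \o W' = X) //; apply/funext => t /=.
    by rewrite !WK.
  exists (W' \o X \o W); first by exists X.
  by apply/funext => t /=; rewrite !WK.
have fwd X : bicommutant gens X -> vn_tensor TM N (@bounded_op R L) (W' \o X \o W).
  by move=> /(conj_bicommutant Wb W'b WK W'K); rewrite gensE E.
have bwd X : vn_tensor TM N (@bounded_op R L) X -> bicommutant gens (W \o X \o W').
  by rewrite -E => /(conj_bicommutant W'b Wb W'K WK); rewrite gensE'.
exists (fun X => W' \o X \o W); split.
  split.
  - exact: fwd.
  - by apply/funext => t /=; exact: W'K.
  - by move=> a X Z _ _; apply/funext => t; rewrite /= !fctE /= (bopD W'b) (bopZ W'b).
  - by move=> X Z _ _; apply/funext => t /=; rewrite WK.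
  - move=> X /commutant_bop Xb; apply: adj_unique.
      exact: (bop_comp (bop_comp W'b Xb) Wb).
    by move=> v w /=; rewrite -(hadjPl Wb) (adjP _ _ Xb) (hadjP Wb).
split; first exact: fwd.
  move=> X Z _ _ XZ; apply/funext => t.
  have := congr1 W (congr1 (@^~ (W' t)) XZ); by rewrite /= !WK.
move=> Z VZ; exists (W \o Z \o W'); first exact: bwd.
by apply/funext => t /=; rewrite !W'K.
Qed.

(** * The free product structure of N *)

Let iP_state : state_embedding P phiP N phi iP.
Proof.
split; last by move=> x Px; rewrite iPE phi_pl1.
have iPN x : P x -> N (iP x) by move=> Px; apply: GN_N; left; exists x.
split.
  by split; [exact: iPN|exact: iP_id|exact: iP_lin|exact: iP_comp|exact: iP_adj].
have h1 : normal_map P (fun x => tens_op TP x idfun) by exact: normal_amplification.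
have h2 : normal_map VT i1 by have [[_ h] _] := i1E.
have h3 : set_fun P VT (fun x => tens_op TP x idfun) by move=> x; exact: VTiP.
exact: (normal_map_comp h3 h1 h2).
Qed.

Let conj_state g : state_embedding Q phiQ N phi (conj g \o i2).
Proof.
have [[[_ _ _ _ i2adj] i2N] phii2] := i2E.
have cN x : Q x -> N ((conj g \o i2) x).
  by move=> Qx; apply: GN_N; right; exists g => //; exists x.
split; last first.
  move=> x Qx; rewrite /= conjE phi_conj; last by exists x.
  exact: phii2.
split.
  split.
  - exact: cN.
  - by rewrite /= i2_id conj_id.
  - by move=> a x y Qx Qy; rewrite /= i2_lin // conj_lin.
  - by move=> x y Qx Qy; rewrite /= i2_comp // conj_comp.
  - by move=> x Qx; rewrite /= i2adj // adj_conj //; exact: i2M.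
have h1 : normal_map M (conj g) by exact: (normal_map_conj Mb (lamb g) (adj_bop (lamb g))).
have h2 : set_fun Q M i2 by move=> x; exact: i2M.
exact: (normal_map_comp h2 i2N h1).
Qed.

Let N_free_product : is_free_product BO N phi.
Proof.
have [[pL p1 p_ge0 pN] pF] := phiF.
split; [exact: NN | split| |exact: BO_free].
- split; [|exact: p1| |exact: (normal_functionalS NM pN)].
    by move=> a x y /NM Mx /NM My; exact: pL.
  by move=> x /NM Mx; exact: p_ge0.
- by move=> x /NM Mx; exact: pF.
- rewrite /N; congr bicommutant; apply/seteqP; split=> x.
    move=> Gx; have [w xw _] := GN_BO Gx; by exists w.
  by move=> [w _ xw]; exact: BO_GN xw.
Qed.

Lemma coaction_theorem :
  [/\ [/\ state_embedding P phiP N phi iP,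
          forall g, state_embedding Q phiQ N phi (conj g \o i2),
          is_free_product BO N phi,
          forall g x, P x -> conj g (iP x) = iP x &
          forall g h x, Q x ->
            conj g ((conj h \o i2) x) = (conj (g * h)%g \o i2) x],
      exists alphahat, is_dual_action TMM N conj alphahat /\
        coaction_iso M Gamma (crossed_product TM N conj) alphahat,
      N = fixed_points TM M Gamma &
      exists th, vn_iso (cocrossed_product TM M Gamma)
                        (vn_tensor TM N (@bounded_op R L)) th].
Proof.
split; [|by exists alphahat; split; [exact: dual_action|exact: coaction_isomorphism]
  |exact: fixedE|exact: duality].
split; [exact: iP_state|exact: conj_state|exact: N_free_product|exact: conj_iP|].
by move=> g h x _; exact: conj_conj.
Qed.

End CoactionTheorem.

Theorem theorem9 (R : realType) (G : groupType) (L : l2_space R G)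
    (HP HQ HM : hilbertType R)
    (P : set (HP -> HP)) (phiP : (HP -> HP) -> R[i])
    (Q : set (HQ -> HQ)) (phiQ : (HQ -> HQ) -> R[i])
    (TP : tensor_space HP L) (psi : (TP -> TP) -> R[i])
    (M : set (HM -> HM)) (phi : (HM -> HM) -> R[i])
    (i1 : (TP -> TP) -> (HM -> HM)) (i2 : (HQ -> HQ) -> (HM -> HM))
    (TM : tensor_space HM L) (TMM : tensor_space TM L)
    (Gamma : (HM -> HM) -> (TM -> TM)) :
  let iP := fun x : HP -> HP => i1 (tens_op TP x idfun) in
  let lam := fun g : G => i1 (tens_op TP idfun (lambda L g)) in
  let conj := fun (g : G) (x : HM -> HM) => lam g \o x \o adj (lam g) in
  let N := bicommutant
    (iP @` P `|` \bigcup_(g in [set: G]) [set conj g (i2 q) | q in Q]) in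
  let alpha := conj in
  countable [set: G] ->
  von_neumann_algebra P -> faithful_normal_state P phiP ->
  von_neumann_algebra Q -> faithful_normal_state Q phiQ ->
  is_product_state P phiP (group_vna L) (group_trace L) psi ->
  (* (M, phi) = (P (x) L(G), phiP (x) tau_G) * (Q, phiQ) *)
  state_embedding (vn_tensor TP P (group_vna L)) psi M phi i1 ->
  state_embedding Q phiQ M phi i2 ->
  is_free_product
    (fun b : bool => if b then i1 @` vn_tensor TP P (group_vna L) else i2 @` Q)
    M phi ->
  (* Gamma = (Id_P (x) delta_G) * (Id_Q (x) 1) *)
  normal_star_hom M (vn_tensor TM M (group_vna L)) Gamma ->
  (forall x, P x -> Gamma (iP x) = tens_op TM (iP x) idfun) ->
  (forall x, Q x -> Gamma (i2 x) = tens_op TM (i2 x) idfun) ->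
  (forall g, Gamma (lam g) = tens_op TM (lam g) (lambda L g)) ->
  [/\ (* (N, phi|N) = (P, phiP) * ( *_g (Q, phiQ)_g ), alpha = Id_P * gamma^G *)
      [/\ state_embedding P phiP N phi iP,
          forall g, state_embedding Q phiQ N phi (conj g \o i2),
          is_free_product
            (fun o : option G =>
               if o is Some g then (conj g \o i2) @` Q else iP @` P) N phi,
          forall g x, P x -> alpha g (iP x) = iP x &
          forall g h x, Q x ->
            alpha g ((conj h \o i2) x) = (conj (g * h)%g \o i2) x],
      (* (1) *)
      exists alphahat, is_dual_action TMM N alpha alphahat /\
        coaction_iso M Gamma (crossed_product TM N alpha) alphahat,
      (* (2) *)
      N = fixed_points TM M Gamma &
      (* (3) *)
      exists theta, vn_iso (cocrossed_product TM M Gamma)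
                           (vn_tensor TM N (@bounded_op R L)) theta].
Proof.
move=> iP lam conj N alpha Gcount PN _ QN _ psiP i1E i2E Mfree GammaH GammaP GammaQ GammaL.
exact: (coaction_theorem TMM Gcount PN QN psiP i1E i2E Mfree GammaH GammaP GammaQ GammaL).
Qed.
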